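(* Let $m\ge 1$ and let $\Omega=A\times B\subset\mathbb{R}^2\times\mathbb{R}^m$, where $A$ is a convex polygon in $\mathbb{R}^2$ and $B$ is a bounded, measurable set in $\mathbb{R}^m$. Then $\Omega$ is spectral if and only if $A$ and $B$ are both spectral sets.
   Context: A bounded, measurable set $\Omega\subset\mathbb{R}^d$ of positive Lebesgue measure is called spectral if there exists a countable set $\Lambda\subset\mathbb{R}^d$ (called a spectrum for $\Omega$) such that the system of exponential functions $E(\Lambda)=\{e_\lambda\}_{\lambda\in\Lambda}$, $e_\lambda(x)=e^{2\pi i\langle\lambda,x\rangle}$, is orthogonal and complete in $L^2(\Omega)$, i.e. is an orthogonal basis of $L^2(\Omega)$. (In particular, a spectral set has positive measure by definition.) A convex polygon in $\mathbb{R}^2$ is a compact set with nonempty interior which is the convex hull of finitely many points. *)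

(* Defs.v *)
From HB Require Import structures.
From mathcomp Require Import all_boot all_order all_algebra.
From mathcomp Require Import all_classical all_reals all_analysis.
From mathcomp Require Import complex.

Set Implicit Arguments.
Unset Strict Implicit.
Unset Printing Implicit Defensive.

Import Order.TTheory GRing.Theory Num.Theory.
Import numFieldNormedType.Exports.

Local Open Scope classical_set_scope.
Local Open Scope ring_scope.

Section lebesgue_outer.
Context (R : realType) (d : nat).
Implicit Types (p : 'rV[R]_d * 'rV[R]_d) (C : set ('rV[R]_d * 'rV[R]_d)).
Local Open Scope ereal_scope.

Definition box p : set 'rV[R]_d :=
  [set x | forall i, (p.1 ord0 i < x ord0 i <= p.2 ord0 i)%R].

(* The factor is 0, and the box empty, as soon as [p.2 i <= p.1 i]. *)
Definition box_volume p : R :=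
  (\prod_(i < d) Num.max 0 (p.2 ord0 i - p.1 ord0 i))%R.

Definition box_cover (A : set 'rV[R]_d) :=
  [set C | countable C /\ A `<=` \bigcup_(p in C) box p].

Definition lebesgue_outer (A : set 'rV[R]_d) : \bar R :=
  ereal_inf [set \esum_(p in C) (box_volume p)%:E | C in box_cover A].

Lemma box_volume_ge0 p : (0 <= box_volume p)%R.
Proof. by apply: prodr_ge0 => i _; rewrite le_max lexx. Qed.

Lemma lebesgue_outer_ge0 A : 0 <= lebesgue_outer A.
Proof.
apply: le_ereal_inf_tmp => _ [C _ <-].
by apply: esum_ge0 => p _; rewrite lee_fin box_volume_ge0.
Qed.

Lemma lebesgue_outer0 : lebesgue_outer set0 = 0.
Proof.
apply/eqP; rewrite eq_le lebesgue_outer_ge0 andbT.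
apply: ereal_inf_lbound; exists set0; last by rewrite esum_set0.
by split; [exact: countable0 | exact: sub0set].
Qed.

Lemma le_lebesgue_outer : {homo lebesgue_outer : A B / A `<=` B >-> A <= B}.
Proof.
move=> A B AB; apply: ereal_inf_le_tmp => _ [C [cC BC] <-].
by exists C => //; split => //; exact: subset_trans AB BC.
Qed.

Lemma lebesgue_outer_sigma_subadditive : sigma_subadditive lebesgue_outer.
Proof.
move=> A; have [[i ioo]|] := pselect (exists i, lebesgue_outer (A i) = +oo).
  rewrite (eseries_pinfty _ _ ioo) ?leey// => n _.
  by rewrite -ltNye (lt_le_trans _ (lebesgue_outer_ge0 _)).
rewrite -forallNE => Aoo; apply/lee_addgt0Pr => e e0.
apply: le_trans (epsilon_trick _ _ (ltW e0)); last first.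
  by move=> n; exact: lebesgue_outer_ge0.
pose P n C := box_cover (A n) C /\
  \esum_(p in C) (box_volume p)%:E <=
    lebesgue_outer (A n) + (e / (2 ^ n.+1)%:R)%:E.
have [G PG] : {G : (set _)^nat & forall n, P n (G n)}.
  apply: (@choice _ _ P) => n.
  have en : (0 < e / (2 ^ n.+1)%:R)%R by rewrite divr_gt0// ltr0n expn_gt0.
  have : lebesgue_outer (A n) \is a fin_num.
    by rewrite ge0_fin_numE ?lebesgue_outer_ge0// ltey; apply/eqP/Aoo.
  move=> /(lb_ereal_inf_adherent en)[_ [C AC <-] /ltW leC].
  by exists C; split.
apply: (@le_trans _ _
  (\esum_(p in \bigcup_n G n) (box_volume p)%:E)).
  apply: ereal_inf_lbound; exists (\bigcup_n G n) => //; split.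
    by apply: bigcup_countable => // n _; exact: (PG n).1.1.
  move=> x [n _ /(PG n).1.2[p Gp px]].
  by exists p => //; exists n.
have v0 p : 0 <= (box_volume p)%:E by rewrite lee_fin box_volume_ge0.
rewrite seqDU_bigcup_eq (nneseries_sum_bigcup (@trivIset_seqDU _ G) v0).
apply: lee_nneseries => [n _ _|n _]; first by apply: esum_ge0 => p _; exact: v0.
apply: (le_trans _ (PG n).2); rewrite esum_mkcond [leRHS]esum_mkcond.
apply: le_esum => p _; case: ifPn => [|_]; last by case: ifP.
by rewrite inE => /(@subset_seqDU _ G n) Gp; rewrite mem_set.
Qed.

HB.instance Definition _ := isOuterMeasure.Build R 'rV[R]_d lebesgue_outer
  lebesgue_outer0 lebesgue_outer_ge0 le_lebesgue_outer
  lebesgue_outer_sigma_subadditive.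

End lebesgue_outer.

(* R^d with the sigma-algebra of Lebesgue (not only Borel) measurable sets. *)
Definition lebesgueRn (R : realType) (d : nat) :=
  caratheodory_type (@lebesgue_outer R d).

HB.instance Definition _ (R : realType) (d : nat) :=
  Measurable.on (lebesgueRn R d).

Definition lebesgue_measure_Rn (R : realType) (d : nat) :
    set (lebesgueRn R d) -> \bar R := @lebesgue_outer R d.

HB.instance Definition _ (R : realType) (d : nat) :=
  Measure.copy (@lebesgue_measure_Rn R d)
    ([the {outer_measure set 'rV[R]_d -> \bar R} of @lebesgue_outer R d]
       : set (caratheodory_type _) -> \bar R).

Section spectral_sets.
Context (R : realType) (d : nat).
Local Notation mu := (@lebesgue_measure_Rn R d).
Implicit Types (Omega : set 'rV[R]_d) (f g : 'rV[R]_d -> R[i]).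

Definition complex_integral Omega f : R[i] :=
  Complex (\int[mu]_(x in Omega) complex.Re (f x))
          (\int[mu]_(x in Omega) complex.Im (f x)).

Definition complex_measurable_fun Omega f :=
  measurable_fun (Omega : set (lebesgueRn R d)) (fun x => complex.Re (f x)) /\
  measurable_fun (Omega : set (lebesgueRn R d)) (fun x => complex.Im (f x)).

Definition L2_normsq Omega f : \bar R :=
  (\int[mu]_(x in Omega) ((Normc.normc (f x)) ^+ 2)%:E)%E.

(* The elements of L^2(Omega) are represented by functions, which matter only
   through their values on Omega. *)
Definition in_L2 Omega f :=
  complex_measurable_fun Omega f /\ (L2_normsq Omega f < +oo)%E.

Definition L2_dot Omega f g : R[i] :=
  complex_integral Omega (fun x => f x * conjc (g x)).

Definition euclid_dot (u v : 'rV[R]_d) : R :=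
  \sum_(i < d) u ord0 i * v ord0 i.

Definition exponential (l x : 'rV[R]_d) : R[i] :=
  Complex (cos (2 * pi * euclid_dot l x)) (sin (2 * pi * euclid_dot l x)).

Definition orthogonal_exponentials (Lambda : set 'rV[R]_d) Omega :=
  forall l l', Lambda l -> Lambda l' -> l <> l' ->
    L2_dot Omega (exponential l) (exponential l') = 0.

(* The linear span of the exponentials is dense in L^2(Omega). *)
Definition complete_exponentials (Lambda : set 'rV[R]_d) Omega :=
  forall f, in_L2 Omega f -> forall e : R, 0 < e ->
    exists (s : seq 'rV[R]_d) (c : 'rV[R]_d -> R[i]),
      (forall l, l \in s -> Lambda l) /\
      (L2_normsq Omega
         (fun x => f x - \sum_(l <- s) c l * exponential l x)%R
       < (e ^+ 2)%:E)%E.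

Definition is_spectrum (Lambda : set 'rV[R]_d) Omega :=
  [/\ countable Lambda, orthogonal_exponentials Lambda Omega &
      complete_exponentials Lambda Omega].

Definition spectral Omega :=
  [/\ bounded_set Omega, measurable (Omega : set (lebesgueRn R d)),
      (0 < mu Omega)%E & exists Lambda, is_spectrum Lambda Omega].

End spectral_sets.

Definition convex_hull (R : realType) (d : nat) (V : set 'rV[R]_d) :
  set 'rV[R]_d := smallest (@convex_set R 'rV[R]_d) V.

Definition convex_polygon (R : realType) (A : set 'rV[R]_2) :=
  [/\ compact A, A° !=set0 &
      exists2 V, finite_set V & A = convex_hull V].

Definition cartesian (R : realType) (n m : nat)
  (A : set 'rV[R]_n) (B : set 'rV[R]_m) : set 'rV[R]_(n + m) :=
  [set row_mx a b | a in A & b in B].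

(* Main.v *)
(* Orthogonality of the exponentials is read off the Fourier transform of the
   indicator of A x B, which is a product. Translating the polygon A by w changes
   it by signed parallelograms spanned by w and the edges of A; this gives the
   Fourier transform of 1_A as a sum over the edges. Weak limits of translates of
   a spectrum are again spectra. Following a spectrum to infinity along the normal
   of an edge e isolates the terms of the edges parallel to e; in the limit they
   must cancel, so that A has an opposite edge e + tau (up to orientation) of the
   same length, and for any two points of the limit spectrum, with difference
   (xi, eta), either <xi, tau> is an integer, or <xi, e> is a nonzero integer, or
   the Fourier transform of 1_B vanishes at eta. If the parallelogram P spanned by
   e and its opposite edge is not all of A, polarized Parseval applied to
   restrictions of exponentials to P x B excludes the second alternative.
   Once this is done for all edges, the xi for which all <xi, tau> are integers
   form a group on which the transform of 1_A vanishes outside 0, and the classes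
   of the spectrum modulo this group provide spectra of A and of B. If A is a
   parallelogram, the spectrum is first modified so that its A-components lie in
   the dual lattice of the edges. *)
From HB Require Import structures.
Require Import Defs.
From mathcomp Require Import all_boot all_order all_algebra.
From mathcomp Require Import all_classical all_reals all_analysis.
From mathcomp Require Import measurable_realfun complex zify ring lra.
Import Order.TTheory GRing.Theory Num.Theory.
Import numFieldNormedType.Exports.
Set Implicit Arguments.
Unset Strict Implicit.
Unset Printing Implicit Defensive.
Local Open Scope classical_set_scope.
Local Open Scope ring_scope.

(** The obstacle is that a spectrum of a product need not be a product, and that orthogonality of
    two frequencies only says that one of two transforms vanishes, not which one. Passing to
    infinity along an edge normal replaces the complicated zero set of the transform of A by a
    closed condition on differences of frequencies. Such a condition survives later limits, so the
    edges can be treated one after another. Completeness survives the limits because the tail of a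
    spectrum outside a ball is small uniformly in the centre of the ball; limits are taken along one
    ultrafilter. The second alternative is excluded by volume: if it occurred, Parseval would reduce
    to a single term and force P and A to have equal volume. In a parallelogram, lines of
    frequencies can be shifted independently of one another, so the second alternative does occur
    and the spectrum has to be straightened first. The transform of a segment is never evaluated in
    closed form: a functional equation supplies its zeros and its decay. *)

Lemma countable_cover_le (R : realType) (T : Type) (I : choiceType)
    (nu : set T -> \bar R) (M : set (set T)) (C : set I) (A : I -> set T) :
  nu set0 = 0%E -> M set0 -> (forall X, (0 <= nu X)%E) ->
  (forall F : (set T)^nat, (forall n, M (F n)) ->
     (nu (\bigcup_n F n) <= \sum_(0 <= n <oo) nu (F n))%E) ->
  countable C -> (forall p, C p -> M (A p)) ->
  (nu (\bigcup_(p in C) A p) <= \esum_(p in C) nu (A p))%E.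
Proof.
move=> nu0 M0 nuge nusub /countable_injP[f finj] MA.
(* The fibres of the injection [f] have at most one point, which turns the family over [C] into a
   sequence padded with empty sets. [M] is the class where sigma-subadditivity is known: all sets
   for an outer measure, the measurable ones for a measure. *)
pose D n := C `&` [set p | f p = n].
have D1 n : D n = set0 \/ exists2 p, C p & D n = [set p].
  have [->|/set0P[p [Cp fp]]] := eqVneq (D n) set0; first by left.
  right; exists p => //; apply/seteqP; split=> [q [Cq fq]|q ->//].
  by apply: finj; rewrite ?inE// fp fq.
have CD : C = \bigcup_n D n.
  by apply/seteqP; split=> [p Cp|p [n _ []]//]; exists (f p).
have tD : trivIset setT D by move=> i j _ _ [p [[_ <-] [_ <-]]].
rewrite [X in (_ <= \esum_(_ in X) _)%E]CD (nneseries_sum_bigcup tD)//.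
have -> : \bigcup_(p in C) A p = \bigcup_n \bigcup_(p in D n) A p.
  by rewrite [in LHS]CD bigcup_bigcup.
have MD n : M (\bigcup_(p in D n) A p).
  case: (D1 n) => [->|[p Cp ->]]; first by rewrite bigcup_set0.
  by rewrite bigcup_set1; exact: MA.
apply: (le_trans (nusub _ MD)); apply: lee_nneseries => [n _ _|n _]; first exact: nuge.
case: (D1 n) => [->|[p Cp ->]]; first by rewrite bigcup_set0 nu0 esum_set0.
by rewrite bigcup_set1 esum_set1.
Qed.

(** * Boxes and the Caratheodory measure *)

Section outer_boxes.
Context (R : realType) (d : nat).
Local Notation mu := (@lebesgue_outer R d).
Implicit Types p q : 'rV[R]_d * 'rV[R]_d.

Lemma lebesgue_outer_box_le p : (mu (box p) <= (box_volume p)%:E)%E.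
Proof.
apply: ereal_inf_lbound; exists [set p]; last first.
  by rewrite esum_set1// lee_fin box_volume_ge0.
by split; [exact: countable1 | rewrite bigcup_set1].
Qed.

Lemma lebesgue_outer_bigcup (I : choiceType) (C : set I) (A : I -> set 'rV[R]_d) :
  countable C -> (mu (\bigcup_(p in C) A p) <= \esum_(p in C) mu (A p))%E.
Proof.
move=> cC; apply: (@countable_cover_le _ _ _ mu setT) => //.
  by move=> X; exact: lebesgue_outer_ge0.
by move=> F _; exact: lebesgue_outer_sigma_subadditive.
Qed.

(** The outer measure is an infimum over covers by boxes, so splitting each box of a cover of [X]
    splits [X]: the Caratheodory condition has to be tested on boxes only. *)
Lemma measurable_of_boxes (Z : set 'rV[R]_d) :
  (forall p, (mu (box p `&` Z) + mu (box p `&` ~` Z) <= (box_volume p)%:E)%E) ->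
  measurable (Z : set (lebesgueRn R d)).
Proof.
move=> hZ; apply: le_caratheodory_measurable => X.
apply: le_ereal_inf_tmp => _ [C [cC XC] <-].
have sub Y : (mu (X `&` Y) <= \esum_(p in C) mu (box p `&` Y))%E.
  apply: (le_trans _ (lebesgue_outer_bigcup _ cC)); apply: le_lebesgue_outer.
  by move=> x [/XC[p Cp px] Yx]; exists p.
apply: (le_trans (leeD (sub Z) (sub (~` Z)))).
rewrite -esumD; try by move=> *; exact: lebesgue_outer_ge0.
by apply: le_esum => p _; exact: hZ.
Qed.

Lemma halfspace_measurable (i : 'I_d) (c : R) :
  measurable ([set x : 'rV[R]_d | x ord0 i <= c] : set (lebesgueRn R d)).
Proof.
apply: measurable_of_boxes => p; set H := [set x | _].
(* The hyperplane cuts the box into two boxes that differ from it in coordinate [i] only; their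
   factors at [i] add up to at most the factor of [p]. *)
pose lo : 'rV[R]_d * 'rV[R]_d :=
  (p.1, \row_j if j == i then Num.min (p.2 ord0 j) c else p.2 ord0 j).
pose hi : 'rV[R]_d * 'rV[R]_d :=
  (\row_j if j == i then Num.max (p.1 ord0 j) c else p.1 ord0 j, p.2).
have lo_le : (mu (box p `&` H) <= (box_volume lo)%:E)%E.
  apply: (le_trans _ (lebesgue_outer_box_le _)); apply: le_lebesgue_outer.
  move=> x [px Hx] j; rewrite !mxE; case: eqP => [->|_]; last exact: px.
  by have /andP[px1 px2] := px i; rewrite px1 le_min px2.
have hi_le : (mu (box p `&` ~` H) <= (box_volume hi)%:E)%E.
  apply: (le_trans _ (lebesgue_outer_box_le _)); apply: le_lebesgue_outer.
  move=> x [px /negP]; rewrite -ltNge => Hx j; rewrite !mxE.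
  case: eqP => [->|_]; last exact: px.
  by have /andP[px1 px2] := px i; rewrite px2 gt_max px1 Hx.
apply: (le_trans (leeD lo_le hi_le)).
rewrite -EFinD lee_fin /box_volume.
rewrite (bigD1 i)//= [X in _ + X](bigD1 i)//= [leRHS](bigD1 i)//= !mxE eqxx.
rewrite (eq_bigr (fun j => Num.max 0 (p.2 ord0 j - p.1 ord0 j))); last first.
  by move=> j /negPf ji; rewrite !mxE ji.
rewrite [X in _ + _ * X](eq_bigr (fun j => Num.max 0 (p.2 ord0 j - p.1 ord0 j))); last first.
  by move=> j /negPf ji; rewrite !mxE ji.
rewrite -mulrDl ler_wpM2r//; first by apply: prodr_ge0 => j _; rewrite le_max lexx.
move: (p.1 ord0 i) (p.2 ord0 i) => a b.
rewrite /Num.max /Num.min; repeat case: ifPn; lra.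
Qed.

Lemma coordinate_measurable (i : 'I_d) :
  measurable_fun [set: lebesgueRn R d] (fun x => x ord0 i).
Proof.
apply: (measurability _ (RGenOInfty.measurableE R)).
move=> _ [_ [c ->] <-]; rewrite setTI.
rewrite (_ : _ @^-1` _ = ~` [set x : 'rV[R]_d | x ord0 i <= c]).
  by apply: measurableC; exact: halfspace_measurable.
by apply/seteqP; split=> x /=; rewrite in_itv/= andbT ltNge => /negP.
Qed.

Lemma box_measurable p : measurable (box p : set (lebesgueRn R d)).
Proof.
rewrite (_ : box p = \bigcap_(i : 'I_d) ((fun x : lebesgueRn R d => x ord0 i) @^-1`
   `]p.1 ord0 i, p.2 ord0 i]%classic)); last first.
  apply/seteqP; split=> x /= px i.
    by move=> _; rewrite /= in_itv/=; exact: px.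
  by have := px i I; rewrite /= in_itv.
apply: fin_bigcap_measurable => // i _; rewrite -[X in measurable X]setTI.
exact: coordinate_measurable.
Qed.

End outer_boxes.

Definition cube (R : realType) (d : nat) (r : R) : set 'rV[R]_d :=
  box (const_mx (- r), const_mx r).
Arguments cube {R d} r.

Lemma in_cube (R : realType) (d : nat) (r : R) (x : 'rV[R]_d) : `|x| < r -> cube r x.
Proof.
move=> xr i; rewrite !mxE.
have : `|x ord0 i| < r.
  apply: le_lt_trans xr; rewrite [leRHS]mx_normrE.
  by apply: (le_trans _ (le_bigmax _ _ (ord0, i))).
by rewrite ltr_norml => /andP[-> /ltW].
Qed.

Lemma cube_cover (R : realType) (d : nat) (x : 'rV[R]_d) : exists n : nat, cube n%:R x.
Proof.
exists (Num.truncn `|x|).+1; apply: in_cube.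
by rewrite truncnS_gt.
Qed.

Lemma sigma_finite_lebesgueRn (R : realType) (d : nat) :
  sigma_finite [set: lebesgueRn R d] (@lebesgue_measure_Rn R d).
Proof.
exists (fun n => cube n%:R).
  by apply/seteqP; split=> // x _; have [n] := cube_cover x; exists n.
move=> n; split; first exact: box_measurable.
by apply: le_lt_trans (lebesgue_outer_box_le _) _; rewrite ltry.
Qed.

HB.instance Definition _ (R : realType) (d : nat) :=
  @Measure_isSigmaFinite.Build _ _ _ (@lebesgue_measure_Rn R d)
    (@sigma_finite_lebesgueRn R d).

Lemma esum_mulr_le (R : realType) (I : choiceType) (C : set I) (a : I -> R) (k : R) :
  0 <= k -> (forall p, 0 <= a p) ->
  (\esum_(p in C) (k%:E * (a p)%:E) <= k%:E * \esum_(p in C) (a p)%:E)%E.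
Proof.
move=> k0 a0; apply: ge_ereal_sup => _ [X CX <-].
rewrite -ge0_mule_fsumr; last by move=> p; rewrite lee_fin.
by rewrite lee_wpmul2l ?lee_fin//; apply: esum_ge; exists X.
Qed.

(** For [k > 0] one divides by [k]. For [k = 0] a cover must be exhibited to use the hypothesis; the
    cubes serve, and the convention that 0 times infinity is 0 gives the bound. *)
Lemma le_mul_lebesgue_outer (R : realType) (d : nat) (S : set 'rV[R]_d) (x : \bar R) (k : R) :
  0 <= k ->
  (forall C, box_cover S C -> (x <= k%:E * \esum_(p in C) (box_volume p)%:E)%E) ->
  (x <= k%:E * lebesgue_outer S)%E.
Proof.
rewrite le_eqVlt => /predU1P[<- h|k0 h].
  pose C := range (fun n : nat => (const_mx (- n%:R), const_mx n%:R) : 'rV[R]_d * 'rV[R]_d).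
  have /h : box_cover S C.
    split=> [|y _]; first by exact: (card_le_trans (card_image_le _ _) (countableP _)).
    by have [n yn] := cube_cover y; exists (const_mx (- n%:R), const_mx n%:R) => //; exists n.
  by rewrite !mul0e.
rewrite muleC -lee_pdivrMr//; apply: le_ereal_inf_tmp => _ [C SC <-].
by rewrite lee_pdivrMr// muleC; exact: h.
Qed.

(** * Products of Lebesgue measures and Fubini *)

Section box_product.
Context (R : realType) (n m : nat).
Local Notation mun := (@lebesgue_measure_Rn R n).
Local Notation mum := (@lebesgue_measure_Rn R m).
Local Notation mu := (@lebesgue_outer R (n + m)).

Definition row_box (p : 'rV[R]_n * 'rV[R]_n) (q : 'rV[R]_m * 'rV[R]_m) :=
  (row_mx p.1 q.1, row_mx p.2 q.2).

Lemma box_row_mx p q (a : 'rV[R]_n) (b : 'rV[R]_m) :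
  box (row_box p q) (row_mx a b) <-> box p a /\ box q b.
Proof.
split=> [pq|[pa qb] i]; last first.
  by rewrite /= -(splitK i); case: (fintype.split i) => j; rewrite /= ?row_mxEl ?row_mxEr.
by split=> i; [have := pq (lshift m i)|have := pq (rshift n i)]; rewrite /= ?row_mxEl ?row_mxEr.
Qed.

Lemma box_volume_row_mx p q :
  box_volume (row_box p q) = box_volume p * box_volume q.
Proof.
rewrite /box_volume big_split_ord/=.
by congr (_ * _); apply: eq_bigr => i _; rewrite ?row_mxEl ?row_mxEr.
Qed.

Lemma row_boxK (r : 'rV[R]_(n + m) * 'rV[R]_(n + m)) :
  row_box (lsubmx r.1, lsubmx r.2) (rsubmx r.1, rsubmx r.2) = r.
Proof. by case: r => r1 r2; rewrite /row_box /= !hsubmxK. Qed.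

Lemma cartesianE (A : set 'rV[R]_n) (B : set 'rV[R]_m) :
  cartesian A B = [set x | A (lsubmx x) /\ B (rsubmx x)].
Proof.
apply/seteqP; split=> x /=; first by case=> a Aa [b Bb <-]; rewrite row_mxKl row_mxKr.
by case=> Ax Bx; exists (lsubmx x) => //; exists (rsubmx x) => //; rewrite hsubmxK.
Qed.

Lemma cartesian_row_mx (A : set 'rV[R]_n) (B : set 'rV[R]_m) a b :
  cartesian A B (row_mx a b) <-> A a /\ B b.
Proof. by rewrite cartesianE /= row_mxKl row_mxKr. Qed.

Lemma lebesgue_outer_cartesian_box_le (S : set 'rV[R]_n) (q : 'rV[R]_m * 'rV[R]_m) :
  (mu (cartesian S (box q)) <= (box_volume q)%:E * lebesgue_outer S)%E.
Proof.
apply: le_mul_lebesgue_outer => [|C [cC SC]]; first exact: box_volume_ge0.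
apply: (@le_trans _ _ (mu (\bigcup_(p in C) box (row_box p q)))).
  apply: le_lebesgue_outer => x; rewrite cartesianE => -[/SC[p Cp px] qx].
  by exists p => //; rewrite -(hsubmxK x); apply/box_row_mx.
apply: (le_trans (lebesgue_outer_bigcup _ cC)).
apply: (@le_trans _ _ (\esum_(p in C) ((box_volume q)%:E * (box_volume p)%:E))%E).
  apply: le_esum => p _; apply: (le_trans (lebesgue_outer_box_le _)).
  by rewrite box_volume_row_mx mulrC.
by apply: esum_mulr_le => *; exact: box_volume_ge0.
Qed.

(** The case where [T] is a box comes from covering [S]; covering [T] then gives the case where [S]
    has finite measure. If [S] has infinite measure, only a null [T] is in question, and [S] is cut
    into pieces by cubes. *)
Lemma lebesgue_outer_cartesian_le (S : set 'rV[R]_n) (T : set 'rV[R]_m) :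
  (mu (cartesian S T) <= lebesgue_outer S * lebesgue_outer T)%E.
Proof.
have finS (S' : set 'rV[R]_n) : (lebesgue_outer S' < +oo)%E ->
    (mu (cartesian S' T) <= lebesgue_outer S' * lebesgue_outer T)%E.
  move=> S'oo; have S'fin : lebesgue_outer S' \is a fin_num.
    by rewrite ge0_fin_numE// lebesgue_outer_ge0.
  rewrite -(fineK S'fin); apply: le_mul_lebesgue_outer => [|C [cC TC]].
    by rewrite fine_ge0// lebesgue_outer_ge0.
  apply: (@le_trans _ _ (mu (\bigcup_(q in C) cartesian S' (box q)))).
    apply: le_lebesgue_outer => x; rewrite cartesianE => -[S'x /TC[q Cq qx]].
    by exists q => //; rewrite cartesianE.
  apply: (le_trans (lebesgue_outer_bigcup _ cC)).
  apply: (@le_trans _ _ (\esum_(q in C) ((fine (lebesgue_outer S'))%:E * (box_volume q)%:E))%E).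
    apply: le_esum => q _; apply: (le_trans (lebesgue_outer_cartesian_box_le _ _)).
    by rewrite fineK// muleC.
  apply: esum_mulr_le => *; last exact: box_volume_ge0.
  by rewrite fine_ge0// lebesgue_outer_ge0.
have [/finS//|Soo] := ltP (lebesgue_outer S) +oo%E.
have {}Soo : lebesgue_outer S = +oo%E by apply/eqP; rewrite -leye_eq.
have [T0|T0] := eqVneq (lebesgue_outer T) 0%E; last first.
  by rewrite Soo gt0_mulye ?leey// lt0e T0 lebesgue_outer_ge0.
rewrite T0 mule0.
have -> : cartesian S T = \bigcup_k cartesian (S `&` cube k%:R) T.
  apply/seteqP; split=> x; rewrite ?cartesianE; last first.
    by case=> k _; rewrite cartesianE => -[[]].
  move=> [Sx Tx]; have [k kx] := cube_cover (lsubmx x).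
  by exists k => //; rewrite cartesianE.
apply: (le_trans (lebesgue_outer_sigma_subadditive _)).
rewrite eseries0// => k _ _; apply/eqP; rewrite eq_le lebesgue_outer_ge0 andbT.
apply: (le_trans (finS _ _)); last by rewrite T0 mule0.
apply: (@le_lt_trans _ _ (lebesgue_outer (cube k%:R))).
  by apply: le_lebesgue_outer; exact: subIsetr.
by apply: le_lt_trans (lebesgue_outer_box_le _) _; rewrite ltry.
Qed.

Lemma measurable_cartesianl (A : set 'rV[R]_n) :
  measurable (A : set (lebesgueRn R n)) ->
  measurable (cartesian A setT : set (lebesgueRn R (n + m))).
Proof.
move=> mA; apply: measurable_of_boxes => z; rewrite -(row_boxK z).
set p := (lsubmx _, lsubmx _); set q := (rsubmx _, rsubmx _).
have sub Y : (mu (box (row_box p q) `&` [set x | Y (lsubmx x)]) <=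
    mun (box p `&` Y) * (box_volume q)%:E)%E.
  apply: (le_trans _ (le_trans (lebesgue_outer_cartesian_le (box p `&` Y) (box q)) _)).
    apply: le_lebesgue_outer => x [zx Yx]; rewrite cartesianE.
    by move: zx; rewrite -{1}(hsubmxK x) => /box_row_mx[px qx]; exact: (conj (conj px Yx) qx).
  by rewrite lee_wpmul2l// ?lebesgue_outer_ge0// lebesgue_outer_box_le.
rewrite (_ : cartesian _ _ = [set x | A (lsubmx x)]); last first.
  by rewrite cartesianE; apply/seteqP; split=> x //= [].
apply: (le_trans (leeD (sub A) (sub (~` A)))).
rewrite -ge0_muleDl ?measure_ge0//.
have -> : (mun (box p `&` A) + mun (box p `&` ~` A) = mun (box p))%E by rewrite -(mA (box p)).
rewrite box_volume_row_mx EFinM lee_wpmul2r//; first by rewrite lee_fin box_volume_ge0.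
exact: lebesgue_outer_box_le.
Qed.

Lemma measurable_cartesianr (B : set 'rV[R]_m) :
  measurable (B : set (lebesgueRn R m)) ->
  measurable (cartesian setT B : set (lebesgueRn R (n + m))).
Proof.
move=> mB; apply: measurable_of_boxes => z; rewrite -(row_boxK z).
set p := (lsubmx _, lsubmx _); set q := (rsubmx _, rsubmx _).
have sub Y : (mu (box (row_box p q) `&` [set x | Y (rsubmx x)]) <=
    (box_volume p)%:E * mum (box q `&` Y))%E.
  apply: (le_trans _ (le_trans (lebesgue_outer_cartesian_le (box p) (box q `&` Y)) _)).
    apply: le_lebesgue_outer => x [zx Yx]; rewrite cartesianE.
    by move: zx; rewrite -{1}(hsubmxK x) => /box_row_mx[px qx]; exact: (conj px (conj qx Yx)).
  by rewrite lee_wpmul2r// ?lebesgue_outer_ge0// lebesgue_outer_box_le.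
rewrite (_ : cartesian _ _ = [set x | B (rsubmx x)]); last first.
  by rewrite cartesianE; apply/seteqP; split=> x //= [].
apply: (le_trans (leeD (sub B) (sub (~` B)))).
rewrite -ge0_muleDr ?measure_ge0//.
have -> : (mum (box q `&` B) + mum (box q `&` ~` B) = mum (box q))%E by rewrite -(mB (box q)).
rewrite box_volume_row_mx EFinM lee_wpmul2l//; first by rewrite lee_fin box_volume_ge0.
exact: lebesgue_outer_box_le.
Qed.

Lemma measurable_cartesian (A : set 'rV[R]_n) (B : set 'rV[R]_m) :
  measurable (A : set (lebesgueRn R n)) -> measurable (B : set (lebesgueRn R m)) ->
  measurable (cartesian A B : set (lebesgueRn R (n + m))).
Proof.
move=> mA mB; rewrite (_ : cartesian A B = cartesian A setT `&` cartesian setT B).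
  by apply: measurableI; [exact: measurable_cartesianl|exact: measurable_cartesianr].
by rewrite !cartesianE; apply/seteqP; split=> x /= [] => [|[? _] []].
Qed.

End box_product.

Lemma countable_bigcup_measurable d (T : measurableType d) (I : Type)
    (C : set I) (A : I -> set T) :
  countable C -> (forall p, measurable (A p)) -> measurable (\bigcup_(p in C) A p).
Proof.
move=> /countable_injP[f finj] mA.
rewrite (_ : \bigcup_(r in C) A r = \bigcup_k \bigcup_(r in C `&` [set r | f r = k]) A r).
  apply: bigcupT_measurable => k.
  have [->|/set0P[r [Cr fr]]] := eqVneq (C `&` [set r | f r = k]) set0.
    by rewrite bigcup_set0.
  rewrite (_ : C `&` _ = [set r]) ?bigcup_set1//.
  apply/seteqP; split=> [s [Cs fs]|s ->//].
  by apply: finj; rewrite ?inE// fr fs.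
apply/seteqP; split=> x; first by case=> r Cr rx; exists (f r) => //; exists r.
by case=> k _ [r [Cr _] rx]; exists r.
Qed.

Section product_measure.
Context (R : realType) (n m : nat).
Local Notation mun := (@lebesgue_measure_Rn R n).
Local Notation mum := (@lebesgue_measure_Rn R m).
Local Notation mu := (@lebesgue_measure_Rn R (n + m)).

Definition split_row (x : lebesgueRn R (n + m)) : lebesgueRn R n * lebesgueRn R m :=
  (lsubmx x, rsubmx x).

(** A cover by boxes of the big space is a cover by products of boxes, whose product measure is at
    most their volume. The measures of boxes in the two factors are hypotheses because this is the
    induction step for [lebesgue_outer_box]. *)
Lemma product_measure_le_outer
    (hn : forall p : 'rV[R]_n * 'rV[R]_n, lebesgue_outer (box p) = (box_volume p)%:E)
    (hm : forall p : 'rV[R]_m * 'rV[R]_m, lebesgue_outer (box p) = (box_volume p)%:E)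
    (E : set (lebesgueRn R n * lebesgueRn R m)) :
  measurable E -> ((mun \x mum) E <= lebesgue_outer (split_row @^-1` E))%E.
Proof.
move=> mE; apply: le_ereal_inf_tmp => _ [C [cC EC] <-].
pose p (r : 'rV[R]_(n + m) * 'rV[R]_(n + m)) := (lsubmx r.1, lsubmx r.2).
pose q (r : 'rV[R]_(n + m) * 'rV[R]_(n + m)) := (rsubmx r.1, rsubmx r.2).
pose A r : set (lebesgueRn R n * lebesgueRn R m) := box (p r) `*` box (q r).
have mA r : measurable (A r) by apply: measurableX; exact: box_measurable.
have EA : E `<=` \bigcup_(r in C) A r.
  move=> [a b] Eab; have /EC[r Cr] : (split_row @^-1` E) (row_mx a b).
    by rewrite /= /split_row row_mxKl row_mxKr.
  by rewrite -{1}(row_boxK r) => /box_row_mx; exists r.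
have mCA : measurable (\bigcup_(r in C) A r).
  exact: countable_bigcup_measurable.
apply: (@le_trans _ _ ((mun \x mum)%E (\bigcup_(r in C) A r))).
  exact: (le_measure (mun \x mum)%E (mem_set mE) (mem_set mCA) EA).
apply: (le_trans (@countable_cover_le _ _ _ (mun \x mum)%E measurable C A _ _ _ _ cC _)) => //.
- by move=> F mF; apply: measure_sigma_subadditive => //; exact: bigcupT_measurable.
apply: le_esum => r _; rewrite product_measure1E; try exact: box_measurable.
rewrite -{3}(row_boxK r) box_volume_row_mx EFinM; apply: lee_pmul; try exact: measure_ge0.
  by rewrite -hn.
by rewrite -hm.
Qed.

End product_measure.

Section box_volume.
Context (R : realType).

Lemma lebesgue_outer_box1 (p : 'rV[R]_1 * 'rV[R]_1) :
  lebesgue_outer (box p) = (box_volume p)%:E.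
Proof.
apply/eqP; rewrite eq_le lebesgue_outer_box_le/=.
(* In dimension one boxes are half-open intervals, and the Lebesgue measure on the line bounds every
   cover from below. *)
have leb (r : 'rV[R]_1 * 'rV[R]_1) :
    lebesgue_measure (`]r.1 ord0 ord0, r.2 ord0 ord0]%classic : set (measurableTypeR R)) =
    (box_volume r)%:E.
  rewrite lebesgue_measure_itv/= lte_fin /box_volume big_ord_recl big_ord0 mulr1 -EFinB.
  by rewrite /Num.max subr_gt0; case: ifP.
apply: le_ereal_inf_tmp => _ [C [cC pC] <-].
rewrite -leb; under eq_esum do rewrite -leb.
apply: (@le_trans _ _ (lebesgue_measure (\bigcup_(r in C)
  (`]r.1 ord0 ord0, r.2 ord0 ord0]%classic : set (measurableTypeR R))))).
  apply: le_measure; rewrite ?inE//=; first exact: countable_bigcup_measurable.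
  move=> t; rewrite /= in_itv/= => pt; have /pC[r Cr rt] : box p (const_mx t).
    by move=> i; rewrite (ord1 i) mxE.
  by exists r => //; have := rt ord0; rewrite mxE/= in_itv.
apply: (@countable_cover_le _ _ _ (@lebesgue_measure R) measurable) => //.
by move=> F mF; apply: measure_sigma_subadditive => //; exact: bigcupT_measurable.
Qed.

(** Induction splits off one coordinate and compares with the product measure of the two factors. *)
Lemma lebesgue_outer_box (d : nat) : (0 < d)%N ->
  forall p : 'rV[R]_d * 'rV[R]_d, lebesgue_outer (box p) = (box_volume p)%:E.
Proof.
case: d => // d _; elim: d => [|d IH] p; first exact: lebesgue_outer_box1.
apply/eqP; rewrite eq_le lebesgue_outer_box_le/=.
move: p; rewrite -[d.+2]/(1 + d.+1)%N => p.
have := @product_measure_le_outer R 1 d.+1 lebesgue_outer_box1 IH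
  (box (lsubmx p.1, lsubmx p.2) `*` box (rsubmx p.1, rsubmx p.2))
  (measurableX (box_measurable _) (box_measurable _)).
rewrite product_measure1E; try exact: box_measurable.
rewrite [X in (X * _)%E]lebesgue_outer_box1 [X in (_ * X)%E]IH -EFinM -box_volume_row_mx row_boxK.
move=> /le_trans; apply; apply: le_lebesgue_outer => x [/= px qx].
by rewrite -(row_boxK p) -(hsubmxK x); apply/box_row_mx.
Qed.

End box_volume.

Section fubini_cartesian.
Context (R : realType) (n m : nat) (n0 : (0 < n)%N) (m0 : (0 < m)%N).
Local Notation mun := (@lebesgue_measure_Rn R n).
Local Notation mum := (@lebesgue_measure_Rn R m).
Local Notation mu := (@lebesgue_measure_Rn R (n + m)).
Local Notation split_row := (@split_row R n m).

Lemma lebesgue_cartesian (A : set 'rV[R]_n) (B : set 'rV[R]_m) :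
  measurable (A : set (lebesgueRn R n)) -> measurable (B : set (lebesgueRn R m)) ->
  mu (cartesian A B) = (mun A * mum B)%E.
Proof.
move=> mA mB; apply/eqP; rewrite eq_le lebesgue_outer_cartesian_le/=.
have := product_measure_le_outer (lebesgue_outer_box n0) (lebesgue_outer_box m0) (measurableX mA mB).
by rewrite product_measure1E// cartesianE.
Qed.

Lemma measurable_split_row :
  measurable_fun [set: lebesgueRn R (n + m)]
    split_row.
Proof.
apply: measurable_fun_pair => _ A mA; rewrite setTI.
  rewrite (_ : _ @^-1` A = cartesian A setT); first exact: measurable_cartesianl.
  by rewrite cartesianE; apply/seteqP; split=> x //= [].
rewrite (_ : _ @^-1` A = cartesian setT A); first exact: measurable_cartesianr.
by rewrite cartesianE; apply/seteqP; split=> x //= [].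
Qed.

Lemma product_measureE (E : set (lebesgueRn R n * lebesgueRn R m)) : measurable E ->
  (mun \x mum)%E E = pushforward mu split_row E.
Proof.
move=> mE; apply: product_measure_unique => //; first exact: measurable_split_row.
move=> mf A B mA mB /=.
by rewrite /pushforward -lebesgue_cartesian// cartesianE.
Qed.

End fubini_cartesian.

Section integral_tensor.
Context (R : realType) (n m : nat) (n0 : (0 < n)%N) (m0 : (0 < m)%N).
Local Notation mun := (@lebesgue_measure_Rn R n).
Local Notation mum := (@lebesgue_measure_Rn R m).
Local Notation mu := (@lebesgue_measure_Rn R (n + m)).
Local Notation split_row := (@split_row R n m).
Local Open Scope ereal_scope.

Lemma integral_tensor (f : lebesgueRn R n -> R) (g : lebesgueRn R m -> R) :
  mun.-integrable setT (EFin \o f) -> mum.-integrable setT (EFin \o g) ->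
  let h := fun x : lebesgueRn R (n + m) => (f (lsubmx x) * g (rsubmx x))%:E in
  mu.-integrable setT h /\ \int[mu]_x h x = \int[mun]_x (f x)%:E * \int[mum]_y (g y)%:E.
Proof.
move=> intf intg h.
pose k (z : lebesgueRn R n * lebesgueRn R m) := (f z.1 * g z.2)%:E.
have mf : measurable_fun setT f by apply/measurable_EFinP; exact: measurable_int intf.
have mg : measurable_fun setT g by apply/measurable_EFinP; exact: measurable_int intg.
have mk : measurable_fun setT k.
  apply/measurable_EFinP; apply: measurable_funM; exact: measurableT_comp.
have hk : h = k \o split_row by [].
have mh : measurable_fun setT h.
  exact: (measurableT_comp mk (@measurable_split_row R n m)).
(* By uniqueness of the product measure, integrals over the product are integrals against the image
   measure under [split_row], to which Tonelli and Fubini apply. *)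
have pm (F : lebesgueRn R n * lebesgueRn R m -> \bar R) :
    \int[mun \x mum]_z F z = \int[pushforward mu split_row]_z F z.
  apply: eq_measure_integral => [|mf0 A mA _]; first exact: (@measurable_split_row R n m).
  exact: (product_measureE n0 m0 mA).
have nf : measurable_fun setT (fun x => `|f x|%:E).
  by apply/measurable_EFinP; exact: measurableT_comp.
have ng : measurable_fun setT (fun y => `|g y|%:E).
  by apply/measurable_EFinP; exact: measurableT_comp.
have nk : measurable_fun setT (fun z => `|k z|).
  exact: measurableT_comp.
have fub : \int[mun]_x \int[mum]_y `|k (x, y)| =
    (\int[mun]_x `|f x|%:E) * (\int[mum]_y `|g y|%:E).
  rewrite -ge0_integralZr//; last by apply: integral_ge0 => *; rewrite lee_fin.
  apply: eq_integral => x _; rewrite -ge0_integralZl ?lee_fin//.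
  by apply: eq_integral => y _; rewrite /k/= normrM EFinM.
have foo : \int[mun]_x `|f x|%:E < +oo by have /integrableP[] := intf.
have goo : \int[mum]_y `|g y|%:E < +oo by have /integrableP[] := intg.
have koo : \int[mun]_x \int[mum]_y `|k (x, y)| < +oo.
  rewrite fub; apply: lte_mul_pinfty => //; first by apply: integral_ge0 => *; rewrite lee_fin.
  by rewrite ge0_fin_numE//; apply: integral_ge0 => *; rewrite lee_fin.
have ik : (mun \x mum).-integrable setT k by apply/integrable12ltyP.
have ih : mu.-integrable setT h.
  apply/integrableP; split=> //.
  rewrite (_ : \int[mu]_x `|h x| = \int[mun \x mum]_z `|k z|).
    by rewrite fubini_tonelli1.
  rewrite pm (ge0_integral_pushforward (@measurable_split_row R n m) _ measurableT nk)//.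
split=> //.
rewrite hk -[LHS](integral_pushforward (@measurable_split_row R n m) mk ih measurableT) -pm.
rewrite -integral12_prod_meas1//.
have gfin : \int[mum]_y (g y)%:E \is a fin_num by exact: integrable_fin_num.
rewrite -(fineK gfin) -integralZr//.
apply: eq_integral => x _; rewrite fineK// -integralZl//.
Qed.

End integral_tensor.

(** * Semi-inner products, Bessel and Parseval *)

Section complex_square.
Context (R : realType).
Implicit Types z w : R[i].

Definition sqnorm z : R := complex.Re z ^+ 2 + complex.Im z ^+ 2.

Lemma sqnorm_ge0 z : 0 <= sqnorm z.
Proof. by rewrite addr_ge0 ?sqr_ge0. Qed.

Lemma sqnormM z w : sqnorm (z * w) = sqnorm z * sqnorm w.
Proof. case: z w => [a b] [c e]; rewrite /sqnorm /=; ring. Qed.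

Lemma sqnorm_eq0 z : (sqnorm z == 0) = (z == 0).
Proof.
case: z => a b; rewrite /sqnorm /= paddr_eq0 ?sqr_ge0// !sqrf_eq0.
by apply/andP/eqP => [[/eqP-> /eqP->]//|[-> ->]].
Qed.

Lemma sqnorm0 : sqnorm 0 = 0.
Proof. by apply/eqP; rewrite sqnorm_eq0. Qed.

Lemma sqnorm_real (a : R) : sqnorm a%:C%C = a ^+ 2.
Proof. by rewrite /sqnorm /= expr0n addr0. Qed.

Lemma sqnorm_normc z : Normc.normc z ^+ 2 = sqnorm z.
Proof. by case: z => a b; rewrite sqr_sqrtr// addr_ge0 ?sqr_ge0. Qed.

Lemma sqnormD_le z w : sqnorm (z + w) <= 2 * (sqnorm z + sqnorm w).
Proof.
case: z w => [a b] [c e]; rewrite /sqnorm /= -subr_ge0.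
rewrite (_ : _ - _ = (a - c) ^+ 2 + (b - e) ^+ 2); last by ring.
by rewrite addr_ge0 ?sqr_ge0.
Qed.

Lemma sqnorm_gt0 z : (0 < sqnorm z) = (z != 0).
Proof. by rewrite lt0r sqnorm_eq0 sqnorm_ge0 andbT. Qed.

Lemma conjcM z w : conjc (z * w) = conjc z * conjc w.
Proof. exact: (rmorphM (@conjc R)). Qed.

Lemma mulr_conjc z : z * conjc z = (sqnorm z)%:C%C.
Proof. by case: z => a b; apply/eqP; rewrite eq_complex/=; apply/andP; split; apply/eqP; rewrite /sqnorm /=; ring. Qed.

End complex_square.

(* Only positive semidefinite: functions equal almost everywhere are not identified. *)
Record semi_inner (R : realType) (V : lmodType R[i]) (H : set V) (dot : V -> V -> R[i]) : Prop :=
  SemiInner {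
  subspace_lin : forall a u v, H u -> H v -> H (a *: u + v);
  subspace0 : H 0;
  dot_lin : forall a u v w, H u -> H v -> H w -> dot (a *: u + v) w = a * dot u w + dot v w;
  dotC : forall u v, H u -> H v -> dot v u = conjc (dot u v);
  dot_ge0 : forall u, H u -> 0 <= complex.Re (dot u u) }.

Section hilbert.
Context (R : realType) (V : lmodType R[i]) (H : set V) (dot : V -> V -> R[i]).
Hypothesis hd : semi_inner H dot.
Implicit Types (u v w : V) (a : R[i]).

Definition nsq (dot0 : V -> V -> R[i]) u : R := complex.Re (dot0 u u).
Local Notation n := (nsq dot).

Lemma subspaceD u v : H u -> H v -> H (u + v).
Proof. by move=> Hu Hv; rewrite -(scale1r u); exact: (subspace_lin hd). Qed.

Lemma subspaceZ a u : H u -> H (a *: u).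
Proof. by move=> Hu; rewrite -[_ *: _]addr0; apply: (subspace_lin hd) => //; exact: (subspace0 hd). Qed.

Lemma subspaceB u v : H u -> H v -> H (u - v).
Proof. by move=> Hu Hv; rewrite -scaleN1r; apply: subspaceD => //; exact: subspaceZ. Qed.

Lemma subspace_sum (I : eqType) (s : seq I) (F : I -> V) :
  (forall i, i \in s -> H (F i)) -> H (\sum_(i <- s) F i).
Proof.
elim: s => [|i s IH] h; first by rewrite big_nil; exact: (subspace0 hd).
rewrite big_cons; apply: subspaceD; first by apply: h; rewrite mem_head.
by apply: IH => j js; apply: h; rewrite inE js orbT.
Qed.

Lemma dotDl u v w : H u -> H v -> H w -> dot (u + v) w = dot u w + dot v w.
Proof. by move=> *; rewrite -(scale1r u) (dot_lin hd)// scale1r mul1r. Qed.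

Lemma dot0l w : H w -> dot 0 w = 0.
Proof.
move=> Hw; have := dotDl (subspace0 hd) (subspace0 hd) Hw.
by rewrite addr0 => /eqP; rewrite -subr_eq0 opprD addNKr oppr_eq0 => /eqP.
Qed.

Lemma dotZl a u w : H u -> H w -> dot (a *: u) w = a * dot u w.
Proof.
by move=> *; rewrite -[_ *: _]addr0 (dot_lin hd)//; [rewrite dot0l// addr0|exact: (subspace0 hd)].
Qed.

Lemma dotBl u v w : H u -> H v -> H w -> dot (u - v) w = dot u w - dot v w.
Proof.
move=> *; rewrite -scaleN1r dotDl//; last exact: subspaceZ.
by rewrite dotZl// mulN1r.
Qed.

Lemma dotBr u v w : H u -> H v -> H w -> dot w (u - v) = dot w u - dot w v.
Proof.
move=> *; rewrite (dotC hd) ?dotBl//; last exact: subspaceB.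
by rewrite rmorphB/= -!(dotC hd).
Qed.

Lemma dotZr a u w : H u -> H w -> dot w (a *: u) = conjc a * dot w u.
Proof.
move=> *; rewrite (dotC hd) ?dotZl//; last exact: subspaceZ.
by rewrite rmorphM/= -!(dotC hd).
Qed.

Lemma dot_suml (I : eqType) (s : seq I) (F : I -> V) w :
  (forall i, i \in s -> H (F i)) -> H w ->
  dot (\sum_(i <- s) F i) w = \sum_(i <- s) dot (F i) w.
Proof.
move=> + Hw; elim: s => [|i s IH] h; first by rewrite !big_nil dot0l.
rewrite !big_cons dotDl//; last 2 first.
- by apply: h; rewrite mem_head.
- by apply: subspace_sum => j js; apply: h; rewrite inE js orbT.
by rewrite IH// => j js; apply: h; rewrite inE js orbT.
Qed.

Lemma nsqE u : H u -> dot u u = (n u)%:C%C.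
Proof.
move=> Hu; have := dotC hd Hu Hu; rewrite /nsq; case: (dot u u) => x y /= [] yy.
by congr Complex; lra.
Qed.

Lemma nsq_ge0 u : H u -> 0 <= n u. Proof. exact: (dot_ge0 hd). Qed.

Lemma nsqBZ a u v : H u -> H v ->
  n (u - a *: v) = n u - 2 * complex.Re (conjc a * dot u v) + sqnorm a * n v.
Proof.
move=> Hu Hv; have Hav := subspaceZ a Hv; rewrite /nsq dotBl ?dotBr//; try exact: subspaceB.
rewrite !dotZl// !dotZr// (dotC hd Hu Hv) (nsqE Hu) (nsqE Hv).
by case: a Hav => a b _; case: (dot u v) => x y; rewrite /sqnorm /=; ring.
Qed.

Lemma nsqZ a u : H u -> n (a *: u) = sqnorm a * n u.
Proof.
move=> Hu; rewrite /nsq dotZl ?dotZr//; last exact: subspaceZ.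
by rewrite nsqE//; case: a => x y; rewrite /sqnorm /=; ring.
Qed.

(** A vector of zero seminorm need not vanish, so this case is separate: subtracting a large
    multiple of [v] from [u] would make the squared seminorm negative unless [dot u v] vanishes.
    Otherwise the multiple of [v] nearest to [u] gives the bound. *)
Lemma cauchy_schwarz u v : H u -> H v -> sqnorm (dot u v) <= n u * n v.
Proof.
move=> Hu Hv; have := nsq_ge0 Hv; rewrite le_eqVlt => /predU1P[nv|nv].
- have h t : 0 <= n u - 2 * (t * sqnorm (dot u v)).
    have := nsq_ge0 (subspaceB Hu (subspaceZ (t%:C%C * dot u v) Hv)).
    rewrite nsqBZ// -nv; case: (dot u v) => x y; rewrite /sqnorm /= => ht.
    by apply: le_trans ht _; rewrite le_eqVlt; apply/orP; left; apply/eqP; ring.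
  rewrite -nv mulr0; rewrite leNgt; apply/negP => d0.
  have := h ((n u + 1) / sqnorm (dot u v)).
  by rewrite divfK ?gt_eqF//; have := nsq_ge0 Hu; lra.
- have := nsq_ge0 (subspaceB Hu (subspaceZ ((n v)^-1%:C%C * dot u v) Hv)).
  rewrite nsqBZ// => ht; rewrite -ler_pdivrMr// -subr_ge0; apply: le_trans ht _.
  rewrite le_eqVlt; apply/orP; left; apply/eqP; case: (dot u v) => x y.
  by rewrite /sqnorm /=; field; rewrite gt_eqF.
Qed.

(** Replaces the triangle inequality: [n] is a squared norm, and square roots are avoided at the
    cost of the factor 2. *)
Lemma nsqD_le u v : H u -> H v -> n (u + v) <= 2 * (n u + n v).
Proof.
move=> Hu Hv; have := nsq_ge0 (subspaceB Hu (subspaceZ 1 Hv)).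
rewrite nsqBZ//; have := nsqBZ (-1) Hu Hv; rewrite scaleN1r opprK => ->.
by move: (dot u v) => [x y]; rewrite /sqnorm /=; lra.
Qed.

Section family.
Context (I : choiceType) (phi : I -> V) (Lam : set I).
Hypothesis Hphi : forall i, Lam i -> H (phi i).

Definition lincomb (S : set I) v :=
  exists ps : seq (R[i] * I), (forall p, p \in ps -> S p.2) /\ v = \sum_(p <- ps) p.1 *: phi p.2.

Definition cspan (S : set I) u := forall e : R, 0 < e -> exists2 v, lincomb S v & n (u - v) < e.

Lemma lincomb_H (S : set I) v : S `<=` Lam -> lincomb S v -> H v.
Proof.
move=> SL [ps [Sps ->]]; apply: subspace_sum => p pps; apply: subspaceZ.
exact/Hphi/SL/Sps.
Qed.

Lemma lincomb1 (S : set I) i : S i -> lincomb S (phi i).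
Proof.
move=> Si; exists [:: (1, i)]; split; first by move=> p; rewrite inE => /eqP->.
by rewrite big_seq1 scale1r.
Qed.

Lemma lincomb_lin (S : set I) a u v : lincomb S u -> lincomb S v -> lincomb S (a *: u + v).
Proof.
move=> [ps [Sps ->]] [qs [Sqs ->]]; exists ([seq (a * p.1, p.2) | p <- ps] ++ qs); split.
  by move=> p; rewrite mem_cat => /orP[/mapP[q /Sps ? ->]|/Sqs].
rewrite big_cat big_map/= scaler_sumr; congr (_ + _).
by apply: eq_bigr => p _; rewrite /= scalerA.
Qed.

Lemma cspan_sub (S T : set I) u : S `<=` T -> cspan S u -> cspan T u.
Proof.
move=> ST Su e /Su[v [ps [Sps ->]] h]; exists (\sum_(p <- ps) p.1 *: phi p.2) => //.
by exists ps; split=> // p /Sps/ST.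
Qed.

Lemma cspan_lim (S : set I) u : S `<=` Lam -> H u ->
  (forall e : R, 0 < e -> exists2 v, H v /\ cspan S v & n (u - v) < e) -> cspan S u.
Proof.
move=> SL Hu h e e0; have e4 : 0 < e / 4 by lra.
have [v [Hv Sv] uv] := h _ e4; have [w Sw vw] := Sv _ e4; exists w => //.
have Hw : H w by exact: lincomb_H Sw.
have -> : u - w = (u - v) + (v - w) by rewrite addrA subrK.
by have := nsqD_le (subspaceB Hu Hv) (subspaceB Hv Hw); lra.
Qed.

Lemma cspan_lin (S : set I) a u v : S `<=` Lam -> H u -> H v -> cspan S u -> cspan S v -> cspan S (a *: u + v).
Proof.
move=> SL Hu Hv Su Sv e e0.
have a0 : 0 < 4 * (sqnorm a + 1) by have := sqnorm_ge0 a; lra.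
have [u' Su' hu] := Su (e / (4 * (sqnorm a + 1))) (divr_gt0 e0 a0).
have [v' Sv' hv] := Sv (e / 4) ltac:(lra).
have Hu' := lincomb_H SL Su'; have Hv' := lincomb_H SL Sv'.
exists (a *: u' + v'); first exact: lincomb_lin.
have -> : a *: u + v - (a *: u' + v') = a *: (u - u') + (v - v').
  by rewrite scalerBr opprD addrACA.
have Huu := subspaceB Hu Hu'.
have := nsqD_le (subspaceZ a Huu) (subspaceB Hv Hv').
rewrite nsqZ//; have : sqnorm a * n (u - u') <= (sqnorm a + 1) * (e / (4 * (sqnorm a + 1))).
  apply: ler_pM; [exact: sqnorm_ge0|exact: nsq_ge0|lra|exact: ltW].
have -> : (sqnorm a + 1) * (e / (4 * (sqnorm a + 1))) = e / 4.
  by field; rewrite gt_eqF//; have := sqnorm_ge0 a; lra.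
lra.
Qed.

End family.

Lemma cspan_trans (I J : choiceType) (phi : I -> V) (psi : J -> V) (S : set I) (T : set J) u :
  (forall i, S i -> H (phi i)) -> (forall j, T j -> H (psi j)) -> H u ->
  (forall i, S i -> cspan psi T (phi i)) -> cspan phi S u -> cspan psi T u.
Proof.
move=> HS HT Hu h Su.
apply: (cspan_lim HT (@subset_refl _ T) Hu) => e /Su[v [ps [Sps ->]] uv].
exists (\sum_(p <- ps) p.1 *: phi p.2) => //; elim: ps Sps {uv} => [|p ps IH] Sps.
  rewrite big_nil; split; first exact: (subspace0 hd).
  move=> e' e'0; exists 0; last by rewrite subr0 /n dot0l//; exact: (subspace0 hd).
  by exists [::]; rewrite big_nil.
have [Hv cv] : H (\sum_(q <- ps) q.1 *: phi q.2) /\ cspan psi T (\sum_(q <- ps) q.1 *: phi q.2).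
  by apply: IH => q qps; apply: Sps; rewrite inE qps orbT.
have Sp : S p.2 by apply: Sps; rewrite mem_head.
rewrite big_cons; split; first by apply: (subspace_lin hd) => //; exact: HS.
by apply: (cspan_lin HT) => //; [exact: HS|exact: h].
Qed.

Section orthogonal.
Context (I : choiceType) (phi : I -> V) (Lam : set I) (N : R).
Hypothesis (N0 : 0 < N) (Hphi : forall i, Lam i -> H (phi i)).
Hypothesis nphi : forall i, Lam i -> n (phi i) = N.
Hypothesis orth : forall i j, Lam i -> Lam j -> i <> j -> dot (phi i) (phi j) = 0.

Lemma nsq_sub_lincomb (s : seq I) (c : I -> R[i]) u : H u -> uniq s -> (forall i, i \in s -> Lam i) ->
  n (u - \sum_(i <- s) c i *: phi i) =
  n u + \sum_(i <- s) (sqnorm (c i) * N - 2 * complex.Re (conjc (c i) * dot u (phi i))).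
Proof.
move=> Hu; elim: s => [|i s IH]; first by rewrite !big_nil subr0 addr0.
rewrite cons_uniq => /andP[nis us] sL.
have Li : Lam i by apply: sL; rewrite mem_head.
have sL' j : j \in s -> Lam j by move=> js; apply: sL; rewrite inE js orbT.
have Hs : H (\sum_(j <- s) c j *: phi j).
  by apply: subspace_sum => j /sL' Lj; apply: subspaceZ; exact: Hphi.
have Hi := Hphi Li; rewrite !big_cons opprD [- _ - _]addrC addrA nsqBZ ?IH ?nphi//; last exact: subspaceB.
rewrite dotBl// dot_suml//; last by move=> j /sL' Lj; apply: subspaceZ; exact: Hphi.
rewrite (_ : \sum_(j <- s) dot (c j *: phi j) (phi i) = 0) ?subr0; first by ring.
apply: big1_seq => j /= js; rewrite dotZl//; last exact/Hphi/sL'.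
by rewrite orth ?mulr0//; [exact: sL'|move=> ji; rewrite -ji js in nis].
Qed.

Lemma nsq_projection (s : seq I) u : H u -> uniq s -> (forall i, i \in s -> Lam i) ->
  n (u - \sum_(i <- s) (N^-1%:C%C * dot u (phi i)) *: phi i) =
  n u - N^-1 * \sum_(i <- s) sqnorm (dot u (phi i)).
Proof.
move=> Hu us sL; rewrite nsq_sub_lincomb// mulr_sumr -sumrN; congr (_ + _).
apply: eq_bigr => i _; case: (dot u _) => x y; rewrite /sqnorm /=; field; exact: lt0r_neq0.
Qed.

Lemma bessel (s : seq I) u : H u -> uniq s -> (forall i, i \in s -> Lam i) ->
  \sum_(i <- s) sqnorm (dot u (phi i)) <= N * n u.
Proof.
move=> Hu us sL; rewrite -ler_pdivrMl// -subr_ge0 -nsq_projection//.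
apply/nsq_ge0/subspaceB => //; apply: subspace_sum => i /sL Li; apply: subspaceZ; exact: Hphi.
Qed.

Lemma lincomb_uniq (S : set I) v : lincomb phi S v ->
  exists s (c : I -> R[i]), [/\ uniq s, (forall i, i \in s -> S i) & v = \sum_(i <- s) c i *: phi i].
Proof.
move=> [ps [Sps ->]]; exists (undup [seq p.2 | p <- ps]), (fun i => \sum_(p <- ps | p.2 == i) p.1).
split; first exact: undup_uniq.
  by move=> i; rewrite mem_undup => /mapP[p pps ->]; exact: Sps.
under [RHS]eq_bigr do rewrite scaler_suml big_mkcond.
rewrite exchange_big/= big_seq [RHS]big_seq; apply: eq_bigr => p pps.
rewrite (bigD1_seq p.2)/= ?undup_uniq ?mem_undup ?map_f// eqxx big1 ?addr0// => i.
by rewrite eq_sym => /negPf->.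
Qed.

(** Parseval as a supremum of finite sums, since frequencies are handled through lists. Completing
    the square shows that replacing the coefficients of an approximating combination by the Fourier
    coefficients [dot u (phi i) / N] does not increase the distance to [u]. *)
Lemma parseval (S : set I) u : S `<=` Lam -> H u -> cspan phi S u ->
  forall e : R, 0 < e -> exists s, [/\ uniq s, (forall i, i \in s -> S i) &
    N * n u - e < \sum_(i <- s) sqnorm (dot u (phi i))].
Proof.
move=> SL Hu Su e e0; have Ne0 : 0 < N^-1 * e by rewrite mulr_gt0 ?invr_gt0.
have [v /lincomb_uniq[s [c [us sS ->]]] uv] := Su _ Ne0.
exists s; split=> //; have sL i : i \in s -> Lam i by move=> /sS/SL.
move: uv; rewrite nsq_sub_lincomb// => uv.
rewrite ltrBlDr -ltrBlDl -(ltr_pM2l (x := N^-1)) ?invr_gt0//.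
rewrite mulrBr mulKf ?gt_eqF//; apply: le_lt_trans uv; rewrite lerD2l mulr_sumr -sumrN.
apply: ler_sum => i _; rewrite -subr_ge0; case: (c i) (dot u _) => [a b] [x y].
rewrite /sqnorm /= (_ : _ - _ = N^-1 * ((N * a - x) ^+ 2 + (N * b - y) ^+ 2)).
  by rewrite mulr_ge0 ?invr_ge0 ?(ltW N0)// addr_ge0 ?sqr_ge0.
by field; rewrite gt_eqF.
Qed.

(** The projection on the frequencies of [s] leaves as squared distance exactly the defect in
    Parseval, divided by [N]. *)
Lemma cspan_parseval (S : set I) u : S `<=` Lam -> H u ->
  (forall e : R, 0 < e -> exists s, [/\ uniq s, (forall i, i \in s -> S i) &
    N * n u - e < \sum_(i <- s) sqnorm (dot u (phi i))]) -> cspan phi S u.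
Proof.
move=> SL Hu h e e0; have [s [us sS hs]] := h _ (mulr_gt0 N0 e0).
exists (\sum_(i <- s) (N^-1%:C%C * dot u (phi i)) *: phi i).
  exists [seq (N^-1%:C%C * dot u (phi i), i) | i <- s]; split; last by rewrite big_map.
  by move=> p /mapP[i /sS Si ->].
rewrite nsq_projection//; last by move=> i /sS/SL.
by rewrite ltrBlDr -ltrBlDl ltr_pdivlMl// mulrBr.
Qed.

(** By Parseval, frequencies orthogonal to [u] contribute nothing to its norm, so the remaining ones
    already reach it. *)
Lemma cspan_restrict (S T : set I) u : S `<=` Lam -> H u -> cspan phi S u ->
  (forall i, S i -> ~ T i -> dot u (phi i) = 0) -> cspan phi (S `&` T) u.
Proof.
move=> SL Hu Su h; apply: cspan_parseval => //; first by move=> i [/SL].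
move=> e /(parseval SL Hu Su)[s [us sS hs]].
exists [seq i <- s | `[< T i >]]; split; first exact: filter_uniq.
  by move=> i; rewrite mem_filter => /andP[/asboolP Ti /sS].
apply: (lt_le_trans hs); rewrite big_filter [leLHS](bigID (fun i => `[< T i >]))/=.
rewrite [X in _ + X]big1_seq ?addr0// => i /andP[/asboolPn nT /sS Si].
by rewrite h// sqnorm0.
Qed.

(** The polarized identity when a single product of coefficients survives. Only [v] is expanded: for
    a finite projection [w] of [v], [N] times [dot u w] is exactly the surviving term, and
    Cauchy-Schwarz bounds the rest [dot u (v - w)]. *)
Lemma polarized_parseval1 (S : set I) u v j : S `<=` Lam -> H u -> H v -> cspan phi S v -> S j ->
  (forall i, S i -> i <> j -> dot u (phi i) * conjc (dot v (phi i)) = 0) ->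
  N%:C%C * dot u v = dot u (phi j) * conjc (dot v (phi j)).
Proof.
move=> SL Hu Hv Sv Sj h; apply/eqP; rewrite -subr_eq0 -sqnorm_eq0; apply/negPn/negP => d0.
set d := _ - _ in d0; have {}d0 : 0 < sqnorm d by rewrite lt0r d0 sqnorm_ge0.
have nu0 : 0 < N * (n u + 1) by rewrite mulr_gt0//; have := nsq_ge0 Hu; lra.
(* In the tolerance, the [+ 1] after [n u] makes the final inequality strict and covers a [u] of
   zero norm. *)
have [s [us sS hs]] := parseval SL Hv Sv (divr_gt0 d0 nu0).
(* Adding [j] to the list only enlarges the partial sum. *)
wlog js : s us sS hs / j \in s => [wl|].
  have [/wl|njs] := boolP (j \in s); first exact.
  apply: (wl (j :: s)); rewrite ?mem_head//= ?njs//.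
    by move=> i; rewrite inE => /predU1P[->//|/sS].
  by rewrite big_cons; apply: (lt_le_trans hs); rewrite lerDr sqnorm_ge0.
have sL i : i \in s -> Lam i by move=> /sS/SL.
pose w := \sum_(i <- s) (N^-1%:C%C * dot v (phi i)) *: phi i.
have Hw : H w by apply: subspace_sum => i /sL Li; apply: subspaceZ; exact: Hphi.
have uw : N%:C%C * dot u w = dot u (phi j) * conjc (dot v (phi j)).
  rewrite (dotC hd)// /w dot_suml//; last by move=> i /sL Li; apply: subspaceZ; exact: Hphi.
  rewrite rmorph_sum/= (bigD1_seq j)//= big1_seq ?addr0; last first.
    move=> i /andP[/eqP ij is_]; have Hi := Hphi (sL _ is_).
    rewrite dotZl// !conjcM -(dotC hd Hi Hu) -mulrA [conjc (dot _ _) * _]mulrC h ?mulr0//.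
    exact: sS.
  have Hj := Hphi (sL _ js); rewrite dotZl// !conjcM -(dotC hd Hj Hu) conjc_real !mulrA.
  by rewrite -rmorphM/= divff ?gt_eqF// mul1r mulrC.
have := cauchy_schwarz Hu (subspaceB Hv Hw).
rewrite dotBr// nsq_projection// => cs.
have dE : sqnorm d = N ^+ 2 * sqnorm (dot u v - dot u w).
  by rewrite -sqnorm_real -sqnormM mulrBr uw.
move: cs hs dE; set S1 := \sum_(i <- s) _; set q := sqnorm (dot u v - dot u w).
move=> cs hs dE; have nu := nsq_ge0 Hu.
have : N ^+ 2 * q <= N * n u * (N * n v - S1).
  rewrite (_ : N * n u * _ = N ^+ 2 * (n u * (n v - N^-1 * S1))); last by field; exact: lt0r_neq0.
  by rewrite ler_wpM2l// exprn_ge0// ltW.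
have : N * n u * (N * n v - S1) <= N * n u * (sqnorm d / (N * (n u + 1))).
  by rewrite ler_wpM2l ?mulr_ge0 ?(ltW N0)//; lra.
have -> : N * n u * (sqnorm d / (N * (n u + 1))) = sqnorm d - sqnorm d / (n u + 1).
  by field; rewrite !gt_eqF//; lra.
have : 0 < sqnorm d / (n u + 1) by rewrite divr_gt0//; lra.
rewrite -dE; lra.
Qed.

End orthogonal.

End hilbert.

(** * The space L^2 and the exponentials *)

Section L2_space.
Context (R : realType) (d : nat) (Om : set 'rV[R]_d).
Hypothesis mOm : measurable (Om : set (lebesgueRn R d)).
Local Notation mu := (@lebesgue_measure_Rn R d).
Implicit Types (f g h : 'rV[R]_d -> R[i]^o).
Local Notation Re := (@complex.Re R).
Local Notation Im := (@complex.Im R).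

Lemma measurable_lin a f g : complex_measurable_fun Om f -> complex_measurable_fun Om g ->
  complex_measurable_fun Om (a *: f + g).
Proof.
case: a => a b [fr fi] [gr gi]; split.
  rewrite (_ : (fun _ => _) = fun x => (a * Re (f x) - b * Im (f x)) + Re (g x)); last first.
    by apply/funext => x; rewrite !fctE/=; case: (f x) (g x) => ? ? [].
  apply: measurable_funD; last exact: gr.
  by apply: measurable_funB; apply: measurable_funM; [exact: measurable_cst|exact: fr|exact: measurable_cst|exact: fi].
rewrite (_ : (fun _ => _) = fun x => (a * Im (f x) + b * Re (f x)) + Im (g x)); last first.
  by apply/funext => x; rewrite !fctE/=; case: (f x) (g x) => ? ? [] ? ?.
apply: measurable_funD; last exact: gi.
by apply: measurable_funD; apply: measurable_funM; [exact: measurable_cst|exact: fi|exact: measurable_cst|exact: fr].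
Qed.

Lemma measurable_mul f g : complex_measurable_fun Om f -> complex_measurable_fun Om g ->
  complex_measurable_fun Om (fun x => f x * g x).
Proof.
move=> [fr fi] [gr gi]; split.
  rewrite (_ : (fun _ => _) = fun x => Re (f x) * Re (g x) - Im (f x) * Im (g x)); last first.
    by apply/funext => x; case: (f x) (g x) => ? ? [].
  by apply: measurable_funB; exact: measurable_funM.
rewrite (_ : (fun _ => _) = fun x => Re (f x) * Im (g x) + Im (f x) * Re (g x)); last first.
  by apply/funext => x; case: (f x) (g x) => ? ? [].
by apply: measurable_funD; exact: measurable_funM.
Qed.

Lemma measurable_conj f : complex_measurable_fun Om f ->
  complex_measurable_fun Om (fun x => conjc (f x)).
Proof.
move=> [fr fi]; split.
  by rewrite (_ : (fun _ => _) = fun x => Re (f x))//; apply/funext => x; case: (f x).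
rewrite (_ : (fun _ => _) = fun x => - Im (f x)); last by apply/funext => x; case: (f x).
exact: measurableT_comp.
Qed.

Lemma measurable_sqnorm f : complex_measurable_fun Om f ->
  measurable_fun (Om : set (lebesgueRn R d)) (fun x => sqnorm (f x)).
Proof. by move=> [fr fi]; apply: measurable_funD; exact: measurable_funX. Qed.

Lemma L2_normsqE f : L2_normsq Om f = (\int[mu]_(x in Om) (sqnorm (f x))%:E)%E.
Proof. by apply: eq_integral => x _; rewrite sqnorm_normc. Qed.

Lemma in_L2P f : in_L2 Om f <->
  complex_measurable_fun Om f /\ mu.-integrable Om (fun x => (sqnorm (f x))%:E).
Proof.
rewrite /in_L2 L2_normsqE; split=> -[mf h]; split=> //.
  apply/integrableP; split; first exact/measurable_EFinP/measurable_sqnorm.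
  by under eq_integral do rewrite gee0_abs ?lee_fin ?sqnorm_ge0//.
have /integrableP[_] := h.
by under eq_integral do rewrite gee0_abs ?lee_fin ?sqnorm_ge0//.
Qed.

Lemma L2_le f g : complex_measurable_fun Om f -> in_L2 Om g ->
  (exists k, forall x, Om x -> sqnorm (f x) <= k * sqnorm (g x)) -> in_L2 Om f.
Proof.
move=> mf /in_L2P[mg ig] [k fg]; apply/in_L2P; split=> //.
apply: (le_integrable mOm _ _ (integrableZl mOm k ig)).
  exact/measurable_EFinP/measurable_sqnorm.
move=> x Omx; rewrite -EFinM/= lee_fin ger0_norm ?sqnorm_ge0//.
exact: le_trans (fg _ Omx) (ler_norm _).
Qed.

Lemma integrable_mul_conj f g : in_L2 Om f -> in_L2 Om g ->
  mu.-integrable Om (fun x => (Re (f x * conjc (g x)))%:E) /\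
  mu.-integrable Om (fun x => (Im (f x * conjc (g x)))%:E).
Proof.
move=> /in_L2P[mf fi] /in_L2P[mg gi].
have [mr mi] := measurable_mul mf (measurable_conj mg).
have ifg := integrableD mOm fi gi.
split; apply: (le_integrable mOm _ _ ifg); try exact/measurable_EFinP.
- move=> x _; rewrite -EFinD !lee_fin/= [leRHS]ger0_norm; last by apply: addr_ge0; exact: sqnorm_ge0.
  case: (f x) (g x) => a b [c e]; rewrite /sqnorm /= ler_norml.
  by apply/andP; split; have := sqr_ge0 (a - c); have := sqr_ge0 (b - e);
    have := sqr_ge0 (a + c); have := sqr_ge0 (b + e); nra.
- move=> x _; rewrite -EFinD !lee_fin/= [leRHS]ger0_norm; last by apply: addr_ge0; exact: sqnorm_ge0.
  case: (f x) (g x) => a b [c e]; rewrite /sqnorm /= ler_norml.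
  by apply/andP; split; have := sqr_ge0 (a - e); have := sqr_ge0 (b - c);
    have := sqr_ge0 (a + e); have := sqr_ge0 (b + c); nra.
Qed.

Lemma L2_lin a f g : in_L2 Om f -> in_L2 Om g -> in_L2 Om (a *: f + g).
Proof.
move=> f2 g2; have /in_L2P[mf fi] := f2; have /in_L2P[mg gi] := g2.
have mafg := measurable_lin a mf mg; apply/in_L2P; split=> //.
have iB := integrableD mOm (integrableZl mOm (2 * sqnorm a) fi) (integrableZl mOm 2 gi).
apply: (le_integrable mOm _ _ iB); first exact/measurable_EFinP/measurable_sqnorm.
move=> x _; rewrite -!EFinM -EFinD/= lee_fin ger0_norm ?sqnorm_ge0//.
apply: le_trans (ler_norm _); have := sqnormD_le (a *: f x) (g x); rewrite sqnormM.
by have := sqnorm_ge0 (g x); lra.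
Qed.

Lemma L2_0 : in_L2 Om (0 : 'rV[R]_d -> R[i]^o).
Proof.
split; first by split; exact: measurable_cst.
rewrite L2_normsqE (_ : (fun _ => _) = cst 0%E) ?integral0 ?ltry//.
by apply/funext => x; rewrite !fctE sqnorm0.
Qed.

Lemma semi_inner_L2 : semi_inner (in_L2 Om : set ('rV[R]_d -> R[i]^o)) (@L2_dot R d Om).
Proof.
split.
- exact: L2_lin.
- exact: L2_0.
- move=> [a b] f g h f2 g2 h2.
  have [fr fi] := integrable_mul_conj f2 h2; have [gr gi] := integrable_mul_conj g2 h2.
  have Zi k F : mu.-integrable Om (EFin \o F) -> mu.-integrable Om (EFin \o (fun x => k * F x)).
    by move=> iF; have := integrableZl mOm k iF.
  have Di F G : mu.-integrable Om (EFin \o F) -> mu.-integrable Om (EFin \o G) ->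
      mu.-integrable Om (EFin \o (fun x => F x + G x)).
    by move=> iF iG; have := integrableD mOm iF iG.
  rewrite /L2_dot /complex_integral; apply/eqP; rewrite eq_complex/=; apply/andP; split; apply/eqP.
  + rewrite -mulNr -!RintegralZl// -!RintegralD//; last 3 first.
    * exact: Di (Zi _ _ _) (Zi _ _ _).
    * exact: Zi.
    * exact: Zi.
    apply: eq_Rintegral => x _; rewrite !fctE /=.
    by case: (f x) (g x) (h x) => ? ? [? ?] [? ?] /=; ring.
  + rewrite -!RintegralZl// -!RintegralD//; last 3 first.
    * exact: Di (Zi _ _ _) (Zi _ _ _).
    * exact: Zi.
    * exact: Zi.
    apply: eq_Rintegral => x _; rewrite !fctE /=.
    by case: (f x) (g x) (h x) => ? ? [? ?] [? ?] /=; ring.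
- move=> f g f2 g2; have [fr fi] := integrable_mul_conj f2 g2.
  rewrite /L2_dot /complex_integral /=; congr Complex.
    by apply: eq_Rintegral => x _; case: (f x) (g x) => ? ? [? ?] /=; ring.
  rewrite -[RHS]mulN1r -RintegralZl//.
  by apply: eq_Rintegral => x _; case: (f x) (g x) => ? ? [? ?] /=; ring.
- move=> f f2; rewrite /L2_dot /complex_integral /=; apply: Rintegral_ge0 => x _.
  by rewrite mulr_conjc sqnorm_ge0.
Qed.

End L2_space.

Section cis.
Context (R : realType).
Implicit Types a b t : R.

Definition cis t : R[i] := Complex (cos (2 * pi * t)) (sin (2 * pi * t)).

Lemma cisD a b : cis (a + b) = cis a * cis b.
Proof.
rewrite /cis mulrDr cosD sinD; apply/eqP; rewrite eq_complex/=.
by apply/andP; split; apply/eqP; ring.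
Qed.

Lemma cis0 : cis 0 = 1.
Proof. by rewrite /cis mulr0 cos0 sin0. Qed.

Lemma cisN a : cis (- a) = conjc (cis a).
Proof. by rewrite /cis mulrN cosN sinN. Qed.

Lemma sqnorm_cis a : sqnorm (cis a) = 1.
Proof. by rewrite /sqnorm /= cos2Dsin2. Qed.

Lemma cis_neq0 a : cis a != 0.
Proof. by rewrite -sqnorm_gt0 sqnorm_cis. Qed.

Lemma sqnorm_cisB a b : sqnorm (cis a - cis b) = 2 - 2 * cos (2 * pi * (a - b)).
Proof.
rewrite mulrBr cosB /sqnorm /=; have := cos2Dsin2 (2 * pi * a); have := cos2Dsin2 (2 * pi * b).
by move: (cos _) (sin _) (cos (_ * b)) (sin (_ * b)) => c s c' s' h1 h2; lra.
Qed.

Lemma cos_le t : 2 - 2 * cos t <= 2 * `|t|.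
Proof.
wlog t0 : t / 0 <= t => [wl|].
  by have [/wl//|/ltW t0] := leP 0 t; rewrite -cosN -normrN; apply: wl; rewrite oppr_ge0.
rewrite (ger0_norm t0); move: t0; rewrite le_eqVlt => /predU1P[<-|t0].
  by rewrite cos0; lra.
have [c _] : exists2 c, c \in `]0, t[%R & cos t - cos 0 = (- sin c) * (t - 0).
  apply: (@MVT R cos (fun x => - sin x) 0 t t0).
  by apply: continuous_subspaceT => x; exact: continuous_cos.
rewrite cos0 subr0 => h; have := sin_le1 c => sc.
have : sin c * t <= 1 * t by rewrite ler_wpM2r// ltW.
lra.
Qed.

Lemma sqnorm_cisB_le a b : sqnorm (cis a - cis b) <= 4 * pi * `|a - b|.
Proof.
rewrite sqnorm_cisB; apply: (le_trans (cos_le _)).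
by rewrite normrM ger0_norm ?mulr_ge0 ?pi_ge0//; lra.
Qed.

Lemma cis_int (k : int) : cis k%:~R = 1.
Proof.
have nat_ (n : nat) : cis n%:R = 1.
  elim: n => [|n IH]; first by rewrite cis0.
  rewrite -addn1 natrD cisD IH mul1r /cis mulr1.
  by rewrite mulr_natl cos2pi sin2pi.
case: k => n; first exact: nat_.
by rewrite NegzE mulrNz cisN nat_ rmorph1.
Qed.

Lemma cis_eq1 t : cis t = 1 -> exists k : int, t = k%:~R.
Proof.
move=> h; exists (Num.floor t); set k := Num.floor t.
have h1 : cis (t - k%:~R) = 1 by rewrite cisD h cisN cis_int rmorph1 mulr1.
have ts : t = t - k%:~R + k%:~R by rewrite subrK.
have s01 : 0 <= t - k%:~R < 1.
  by rewrite subr_ge0 floor_le/= ltrBlDl; have := floorD1_gt t; rewrite intrD.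
rewrite ts; move: (t - k%:~R) s01 h1 {h ts} => s /andP[s0 s1] [cs _].
have pi0 := pi_gt0 R.
have cos1 x : 0 <= x <= pi -> cos x = 1 -> x = 0.
  move=> xpi cx; apply: cos_inj; rewrite ?in_itv//= ?cos0//.
  by rewrite lexx pi_ge0.
have [sh|sh] := leP (2 * s) 1.
  have /eqP : 2 * pi * s = 0 by apply: cos1 => //; nra.
  by rewrite !mulf_eq0 pnatr_eq0 (gt_eqF pi0)/= => /eqP; lra.
(* Cosine is injective on [[0, pi]] only, so for [s > 1/2] the angle is reflected; its vanishing
   would force [s = 1], which is excluded. *)
have : 2 * pi * (1 - s) = 0.
  apply: cos1; first nra.
  rewrite (_ : 2 * pi * _ = pi *+ 2 - 2 * pi * s); last by rewrite mulr2n; ring.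
  by rewrite cosB cos2pi sin2pi cs; lra.
nra.
Qed.

End cis.

Section euclid.
Context (R : realType) (d : nat).
Implicit Types u v w x : 'rV[R]_d.

Lemma euclid_dotDl u v w : euclid_dot (u + v) w = euclid_dot u w + euclid_dot v w.
Proof. by rewrite /euclid_dot -big_split; apply: eq_bigr => i _; rewrite mxE mulrDl. Qed.

Lemma euclid_dotC u v : euclid_dot u v = euclid_dot v u.
Proof. by apply: eq_bigr => i _; rewrite mulrC. Qed.

Lemma euclid_dotZl a u v : euclid_dot (a *: u) v = a * euclid_dot u v.
Proof. by rewrite /euclid_dot mulr_sumr; apply: eq_bigr => i _; rewrite mxE mulrA. Qed.

Lemma euclid_dotNl u v : euclid_dot (- u) v = - euclid_dot u v.
Proof. by rewrite -scaleN1r euclid_dotZl mulN1r. Qed.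

Lemma euclid_dotBl u v w : euclid_dot (u - v) w = euclid_dot u w - euclid_dot v w.
Proof. by rewrite euclid_dotDl euclid_dotNl. Qed.

Lemma euclid_dot0l u : euclid_dot 0 u = 0.
Proof. by rewrite -(scale0r 0) euclid_dotZl mul0r. Qed.

Lemma euclid_dotDr u v w : euclid_dot w (u + v) = euclid_dot w u + euclid_dot w v.
Proof. by rewrite !(euclid_dotC w) euclid_dotDl. Qed.

Lemma euclid_dotZr a u v : euclid_dot u (a *: v) = a * euclid_dot u v.
Proof. by rewrite !(euclid_dotC u) euclid_dotZl. Qed.

Lemma coord_le_norm u i : `|u ord0 i| <= `|u|.
Proof. by rewrite [leRHS]mx_normrE; apply: (le_trans _ (le_bigmax _ _ (ord0, i))). Qed.

Lemma euclid_dot_le u v : `|euclid_dot u v| <= d%:R * (`|u| * `|v|).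
Proof.
apply: (le_trans (ler_norm_sum _ _ _)).
apply: (@le_trans _ _ (\sum_(i < d) `|u| * `|v|)); last by rewrite sumr_const card_ord mulr_natl.
by apply: ler_sum => i _; rewrite normrM; apply: ler_pM => //; exact: coord_le_norm.
Qed.

Lemma exponentialE u x : exponential u x = cis (euclid_dot u x). Proof. by []. Qed.

Lemma exponentialD u v x : exponential (u + v) x = exponential u x * exponential v x.
Proof. by rewrite !exponentialE euclid_dotDl cisD. Qed.

Lemma exponentialN u x : exponential (- u) x = conjc (exponential u x).
Proof. by rewrite !exponentialE euclid_dotNl cisN. Qed.

Lemma exponential0 (x : 'rV[R]_d) : exponential 0 x = 1 :> R[i].
Proof. by rewrite exponentialE euclid_dot0l cis0. Qed.

Lemma sqnorm_exponential u x : sqnorm (exponential u x) = 1.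
Proof. exact: sqnorm_cis. Qed.

Lemma measurable_euclid_dot u : measurable_fun [set: lebesgueRn R d] (euclid_dot u).
Proof.
rewrite /euclid_dot; apply: measurable_sum => i; apply: measurable_funM; first exact: measurable_cst.
exact: coordinate_measurable.
Qed.

Lemma measurable_exponential (Om : set (lebesgueRn R d)) u : measurable Om ->
  complex_measurable_fun Om (exponential u).
Proof.
move=> mOm.
have m2 : measurable_fun Om (fun x => 2 * pi * euclid_dot u x).
  apply: measurable_funM; first exact: measurable_cst.
  exact: (measurable_funS measurableT (@subsetT _ _) (measurable_euclid_dot u)).
split; apply: (measurableT_comp _ m2); apply: continuous_measurable_fun.
  exact: continuous_cos.
exact: continuous_sin.
Qed.

End euclid.

Section complex_integral_tensor.
Context (R : realType) (n m : nat) (n0 : (0 < n)%N) (m0 : (0 < m)%N).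
Context (A : set 'rV[R]_n) (B : set 'rV[R]_m).
Hypothesis mA : measurable (A : set (lebesgueRn R n)).
Hypothesis mB : measurable (B : set (lebesgueRn R m)).
Local Notation mun := (@lebesgue_measure_Rn R n).
Local Notation mum := (@lebesgue_measure_Rn R m).
Local Notation mu := (@lebesgue_measure_Rn R (n + m)).

Lemma Rintegral_cartesian (f : 'rV[R]_n -> R) (g : 'rV[R]_m -> R) :
  mun.-integrable A (EFin \o f) -> mum.-integrable B (EFin \o g) ->
  mu.-integrable (cartesian A B) (fun x => (f (lsubmx x) * g (rsubmx x))%:E) /\
  \int[mu]_(x in cartesian A B) (f (lsubmx x) * g (rsubmx x)) =
  \int[mun]_(x in A) f x * \int[mum]_(y in B) g y.
Proof.
move=> intf intg.
have patchE T (D : set T) (k : T -> R) : EFin \o (k \_ D) = (EFin \o k) \_ D.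
  by rewrite restrict_EFin.
have intf' : mun.-integrable setT (EFin \o (f \_ A)).
  by rewrite patchE; apply/(integrable_mkcond _ mA).
have intg' : mum.-integrable setT (EFin \o (g \_ B)).
  by rewrite patchE; apply/(integrable_mkcond _ mB).
have [ih hE] := integral_tensor n0 m0 intf' intg'.
have hp : (fun x => (((f \_ A) (lsubmx x) * (g \_ B) (rsubmx x))%:E)) =
    (EFin \o (fun x : 'rV[R]_(n + m) => f (lsubmx x) * g (rsubmx x))) \_ (cartesian A B).
  apply/funext => x; rewrite /patch; have [xAB|xAB] := boolP (x \in cartesian A B).
    by have := set_mem xAB; rewrite cartesianE => -[Ax Bx]; rewrite !mem_set.
  case: ifPn => Ax; last by rewrite mul0r.
  case: ifPn => Bx; last by rewrite mulr0.
  by case/negP: xAB; apply: mem_set; rewrite cartesianE; split; exact: set_mem.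
split.
  by apply/(integrable_mkcond _ (measurable_cartesian mA mB)); rewrite -hp.
rewrite [LHS]Rintegral_mkcond [X in _ = X * _]Rintegral_mkcond [X in _ = _ * X]Rintegral_mkcond.
rewrite /Rintegral -fineM; try exact: integrable_fin_num.
by rewrite -hE; congr fine; apply: eq_integral => x _; rewrite (congr1 (@^~ x) hp) -patchE.
Qed.

Definition cintegrable d (D : set 'rV[R]_d) (f : 'rV[R]_d -> R[i]) :=
  (@lebesgue_measure_Rn R d).-integrable D (EFin \o (fun x => complex.Re (f x))) /\
  (@lebesgue_measure_Rn R d).-integrable D (EFin \o (fun x => complex.Im (f x))).

Lemma complex_integral_tensor (f : 'rV[R]_n -> R[i]) (g : 'rV[R]_m -> R[i]) :
  cintegrable A f -> cintegrable B g ->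
  complex_integral (cartesian A B) (fun x => f (lsubmx x) * g (rsubmx x)) =
  complex_integral A f * complex_integral B g.
Proof.
move=> [fr fi] [gr gi]; rewrite /complex_integral.
have mAB := measurable_cartesian mA mB.
have [i1 e1] := Rintegral_cartesian fr gr; have [i2 e2] := Rintegral_cartesian fi gi.
have [i3 e3] := Rintegral_cartesian fr gi; have [i4 e4] := Rintegral_cartesian fi gr.
apply/eqP; rewrite eq_complex/= -e1 -e2 -e3 -e4.
rewrite -RintegralB// -RintegralD//; apply/andP; split; apply/eqP; apply: eq_Rintegral => x _.
  by case: (f _) (g _) => ? ? [].
by case: (f _) (g _) => ? ? [].
Qed.

End complex_integral_tensor.

Section bounded_domain.
Context (R : realType) (d : nat) (Om : set 'rV[R]_d).
Hypothesis mOm : measurable (Om : set (lebesgueRn R d)).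
Hypothesis bOm : bounded_set Om.
Local Notation mu := (@lebesgue_measure_Rn R d).
Local Notation dot := (@L2_dot R d Om).

Definition volume (D : set 'rV[R]_d) : R := fine (mu D).

Definition expint (D : set 'rV[R]_d) (l : 'rV[R]_d) : R[i] := complex_integral D (exponential l).

Lemma bounded_setP : exists T : R, 0 < T /\ forall x, Om x -> `|x| <= T.
Proof.
have [T [Tr hT]] := bOm; exists (`|T| + 1); split; first by have := normr_ge0 T; lra.
by move=> x Omx; apply: hT => //; have := ler_norm T; lra.
Qed.

Lemma bounded_lty : (mu Om < +oo)%E.
Proof.
have [T [T0 hT]] := bounded_setP; apply: (@le_lt_trans _ _ (mu (cube (T + 1)))).
  by apply: le_lebesgue_outer => x /hT xT; apply: in_cube; lra.
by apply: le_lt_trans (lebesgue_outer_box_le _) _; rewrite ltry.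
Qed.

Lemma volumeE (D : set 'rV[R]_d) : D `<=` Om -> (volume D)%:E = mu D.
Proof.
move=> DO; rewrite fineK// ge0_fin_numE ?lebesgue_outer_ge0//.
exact: le_lt_trans (le_lebesgue_outer DO) bounded_lty.
Qed.

Lemma L2_bounded (f : 'rV[R]_d -> R[i]) : complex_measurable_fun Om f ->
  (exists k, forall x, Om x -> sqnorm (f x) <= k) -> in_L2 Om f.
Proof.
move=> mf [k fk]; apply: (L2_le (g := (fun _ => 1) : 'rV[R]_d -> R[i]) mOm mf); last first.
  by exists k => x /fk; rewrite /sqnorm /= expr1n expr0n addr0 mulr1.
apply/in_L2P; split; first by split; exact: measurable_cst.
rewrite (_ : (fun _ => _) = cst 1%:E).
  apply: (measurable_bounded_integrable (f := cst 1) mOm bounded_lty).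
  - exact: measurable_cst.
  - by exists 1; split=> // M M1 x _ /=; rewrite normr1 ltW.
by apply/funext => x; rewrite /sqnorm /= expr1n expr0n addr0.
Qed.

Lemma L2_exponential l : in_L2 Om (exponential l).
Proof.
apply: L2_bounded; first exact: measurable_exponential.
by exists 1 => x _; rewrite sqnorm_exponential.
Qed.

Lemma L2_dot_exponential l l' : dot (exponential l) (exponential l') = expint Om (l - l').
Proof.
by congr complex_integral; apply/funext => x; rewrite exponentialD exponentialN.
Qed.

Lemma expint0 (D : set 'rV[R]_d) : measurable (D : set (lebesgueRn R d)) -> (mu D < +oo)%E ->
  expint D 0 = (volume D)%:C%C.
Proof.
move=> mD Doo; rewrite /expint /complex_integral.
rewrite (eq_Rintegral _ (g := fun=> 1)); last by move=> x _; rewrite exponential0.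
rewrite (eq_Rintegral _ (g := fun=> 0) (f := fun x => complex.Im _)); last by move=> x _; rewrite exponential0.
by rewrite !Rintegral_cst// mul0r mul1r.
Qed.

Lemma nsq_exponential l : nsq dot (exponential l) = volume Om.
Proof. by rewrite /nsq L2_dot_exponential subrr expint0//; exact: bounded_lty. Qed.

Lemma L2_dotE f : in_L2 Om f -> L2_normsq Om f = (nsq dot f)%:E.
Proof.
move=> /in_L2P[mf fi]; rewrite L2_normsqE /nsq /L2_dot/=.
rewrite -[LHS]fineK; last exact: integrable_fin_num.
by congr EFin; apply: eq_Rintegral => x _; rewrite mulr_conjc.
Qed.

(** On [Om], which [T] bounds, two exponentials differ in squared modulus by at most [K] times the
    distance of their frequencies; Cauchy-Schwarz against the constant function 1 carries this over
    to the integrals. *)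
Lemma expint_continuous e : 0 < e -> exists2 del : R, 0 < del &
  forall l l', `|l - l'| < del -> sqnorm (expint Om l - expint Om l') < e.
Proof.
move=> e0; have [T [T0 hT]] := bounded_setP.
pose K := 4 * pi * (d%:R * T); have K0 : 0 <= K by rewrite !mulr_ge0 ?pi_ge0// ltW.
have v0 : 0 <= volume Om by rewrite fine_ge0// lebesgue_outer_ge0.
have Kv0 : 0 <= K * volume Om * volume Om by do 2![apply: mulr_ge0 => //].
exists (e / (K * volume Om * volume Om + 1)) => [|l l' ll']; first by rewrite divr_gt0//; lra.
have hd := semi_inner_L2 mOm.
have E u : expint Om u = dot (exponential u) (exponential 0).
  by rewrite L2_dot_exponential subr0.
rewrite !E -(dotBl hd); try exact: L2_exponential.
apply: le_lt_trans (cauchy_schwarz hd (subspaceB hd (L2_exponential l) (L2_exponential l')) (L2_exponential 0)) _.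
rewrite nsq_exponential.
have : nsq dot ((exponential l : 'rV[R]_d -> R[i]^o) - exponential l') <= K * `|l - l'| * volume Om.
  rewrite -lee_fin EFinM -L2_dotE; last exact: (subspaceB hd (L2_exponential l) (L2_exponential l')).
  rewrite L2_normsqE (volumeE (@subset_refl _ _)) -integral_cst//.
  have [md _] := subspaceB hd (L2_exponential l) (L2_exponential l').
  have {}md := measurable_sqnorm md.
  apply: ge0_le_integral; [exact: mOm| | |exact: measurable_cst|].
  - by move=> x _; rewrite lee_fin sqnorm_ge0.
  - by apply/measurable_EFinP; exact: md.
  - move=> x Omx; rewrite lee_fin; apply: (le_trans (sqnorm_cisB_le _ _)).
    rewrite -euclid_dotBl /K -!mulrA ler_pM2l// ler_pM2l ?pi_gt0//.
    apply: (le_trans (euclid_dot_le _ _)); rewrite ler_wpM2l// mulrC ler_wpM2r//.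
    exact: hT.
have : `|l - l'| * (K * volume Om * volume Om + 1) < e by rewrite -ltr_pdivlMr//; lra.
move=> h1 h2; have := ler_wpM2r v0 h2; have := normr_ge0 (l - l'); lra.
Qed.

Lemma sqnorm_expint_le l : sqnorm (expint Om l) <= volume Om ^+ 2.
Proof.
have hd := semi_inner_L2 mOm.
have := cauchy_schwarz hd (L2_exponential l) (L2_exponential 0).
by rewrite L2_dot_exponential subr0 !nsq_exponential expr2.
Qed.

End bounded_domain.

Section projection.
Context (R : realType) (V : lmodType R[i]) (H : set V) (dot : V -> V -> R[i]).
Context (V' : lmodType R[i]) (H' : set V') (dot' : V' -> V' -> R[i]).
Hypotheses (hd : semi_inner H dot) (hd' : semi_inner H' dot').
Context (I J : choiceType) (phi : I -> V) (psi : J -> V') (S : set I).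
Context (T : V' -> V) (pr : I -> J) (c : I -> R[i]) (k : R).
Hypotheses (k0 : 0 < k) (HT : forall u, H' u -> H (T u)).
Hypothesis dotT : forall u v, H' u -> H' v -> dot (T u) (T v) = k%:C%C * dot' u v.
Hypotheses (Hphi : forall i, S i -> H (phi i)) (Hpsi : forall i, S i -> H' (psi (pr i))).
Hypothesis dotphi : forall i v, S i -> H' v ->
  dot (phi i) (T v) = k%:C%C * c i * dot' (psi (pr i)) v.

(* [T^* / k] is a contraction sending [phi i] to a multiple of [psi (pr i)]. *)
Lemma cspan_project u : H' u -> cspan dot phi S (T u) -> cspan dot' psi (pr @` S) u.
Proof.
move=> Hu Su e e0; have [_ [ps [Sps ->]] uv] := Su (k * e) (mulr_gt0 k0 e0).
pose w := \sum_(p <- ps) (p.1 * c p.2) *: psi (pr p.2).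
have Hw : H' w by apply: (subspace_sum hd') => p /Sps Sp; apply: (subspaceZ hd'); exact: Hpsi.
exists w.
  exists [seq (p.1 * c p.2, pr p.2) | p <- ps]; split; last by rewrite big_map.
  by move=> q /mapP[p /Sps Sp ->]; exists p.2.
set v := \sum_(p <- ps) _ in uv.
have Hv : H v by apply: (subspace_sum hd) => p /Sps Sp; apply: (subspaceZ hd); exact: Hphi.
pose h := u - w; have Hh : H' h by exact: (subspaceB hd').
(* The adjoint of [T] sends [v] to [k] times [w], so [T u - v] pairs with [T h] to [k] times the
   squared norm of [h]. Cauchy-Schwarz then bounds [k] times that norm by the squared norm of
   [T u - v]. *)
have E : dot (T u - v) (T h) = (k * nsq dot' h)%:C%C.
  rewrite (dotBl hd)//; try exact: HT.
  rewrite dotT// (dot_suml hd)//; last 2 first.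
  - by move=> p /Sps Sp; apply: (subspaceZ hd); exact: Hphi.
  - exact: HT.
  rewrite (_ : \sum_(p <- ps) _ = k%:C%C * dot' w h).
    by rewrite -mulrBr -(dotBl hd')// (nsqE hd')// rmorphM.
  rewrite /w (dot_suml hd')//; last by move=> p /Sps Sp; apply: (subspaceZ hd'); exact: Hpsi.
  rewrite mulr_sumr big_seq [RHS]big_seq; apply: eq_bigr => p /Sps Sp.
  rewrite (dotZl hd) ?dotphi//; [|exact: Hphi|exact: HT].
  by rewrite (dotZl hd')//; [ring|exact: Hpsi].
have := cauchy_schwarz hd (subspaceB hd (HT Hu) Hv) (HT Hh).
have nT : nsq dot (T h) = k * nsq dot' h by rewrite /nsq dotT// (nsqE hd')// -rmorphM.
rewrite E sqnorm_real nT => cs.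
have : 0 <= nsq dot' h by exact: (nsq_ge0 hd').
rewrite le_eqVlt => /predU1P[<-//|nh].
have knh : 0 < k * nsq dot' h by exact: mulr_gt0.
move: cs; rewrite expr2 ler_pM2r// => cs.
by rewrite -(ltr_pM2l k0); exact: le_lt_trans cs uv.
Qed.

End projection.

Section exponential_span.
Context (R : realType) (d : nat).
Implicit Types (Om : set 'rV[R]_d) (S T Lam : set 'rV[R]_d) (l : 'rV[R]_d).
Implicit Types f g : 'rV[R]_d -> R[i]^o.

Definition domain Om :=
  [/\ bounded_set Om, measurable (Om : set (lebesgueRn R d)) & 0 < volume Om].

Definition ecspan Om S f := cspan (@L2_dot R d Om) (@exponential R d) S f.

Lemma domain_semi_inner Om : domain Om ->
  semi_inner (in_L2 Om : set ('rV[R]_d -> R[i]^o)) (@L2_dot R d Om).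
Proof. by case=> _ mOm _; exact: semi_inner_L2. Qed.

Lemma domain_exponential Om l : domain Om -> in_L2 Om (exponential l).
Proof. by case=> bOm mOm _; exact: L2_exponential. Qed.

Lemma domain_expint0 Om : domain Om -> expint Om 0 = (volume Om)%:C%C.
Proof. by case=> bOm mOm _; apply: expint0 => //; exact: bounded_lty. Qed.

Lemma domain_expint0_neq0 Om : domain Om -> expint Om 0 != 0.
Proof. by move=> dOm; rewrite domain_expint0// -sqnorm_gt0 sqnorm_real exprn_gt0//; case: dOm. Qed.

Lemma ecspan_sub Om S T f : S `<=` T -> ecspan Om S f -> ecspan Om T f.
Proof. exact: cspan_sub. Qed.

Lemma ecspan_trans Om S T f : domain Om -> in_L2 Om f ->
  (forall l, S l -> ecspan Om T (exponential l)) -> ecspan Om S f -> ecspan Om T f.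
Proof.
move=> dOm f2 h Sf; have He := fun l (_ : _ l) => domain_exponential l dOm.
exact: (cspan_trans (domain_semi_inner dOm) (He S) (He T) f2 h Sf).
Qed.

Lemma complete_exponentialsP Om Lam : domain Om ->
  complete_exponentials Lam Om <-> forall f, in_L2 Om f -> ecspan Om Lam f.
Proof.
move=> dOm; have hd := domain_semi_inner dOm; have [bOm mOm _] := dOm.
have H2 S v : lincomb (@exponential R d : _ -> _ -> R[i]^o) S v -> in_L2 Om v.
  exact: (lincomb_H hd (fun l (_ : setT l) => domain_exponential l dOm) (@subsetT _ S)).
have sumE (s : seq 'rV[R]_d) (c : 'rV[R]_d -> R[i]) :
    (\sum_(l <- s) c l *: (exponential l : 'rV[R]_d -> R[i]^o)) =
    (fun x => \sum_(l <- s) c l * exponential l x).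
  by apply/funext => x; rewrite fct_sumE.
split=> [cLam f f2 e e0|h f f2 e e0].
  have [s [c [sL]]] := cLam f f2 (Num.sqrt e) ltac:(by rewrite sqrtr_gt0).
  rewrite sqr_sqrtr ?ltW// => hs.
  have lc : lincomb (@exponential R d : _ -> _ -> R[i]^o) Lam (\sum_(l <- s) c l *: (exponential l : _ -> R[i]^o)).
    exists [seq (c l, l) | l <- s]; split; last by rewrite big_map.
    by move=> p /mapP[l /sL Ll ->].
  exists (\sum_(l <- s) c l *: (exponential l : _ -> R[i]^o)) => //.
  have fv := subspaceB hd f2 (H2 _ _ lc).
  by rewrite -lte_fin -(L2_dotE mOm fv) sumE.
have [v lv fv] := h f f2 (e ^+ 2) (exprn_gt0 2 e0).
have v2 := subspaceB hd f2 (H2 _ _ lv).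
have [s [c [us sL vE]]] := lincomb_uniq lv; exists s, c; split=> //.
move: fv; rewrite -lte_fin -(L2_dotE mOm v2) vE sumE; exact.
Qed.

Lemma ecspan_restrict Om Lam S T f : domain Om -> orthogonal_exponentials Lam Om ->
  S `<=` Lam -> in_L2 Om f -> ecspan Om S f ->
  (forall l, S l -> ~ T l -> L2_dot Om f (exponential l) = 0) -> ecspan Om (S `&` T) f.
Proof.
move=> dOm oL SL f2 Sf h; have [bOm mOm v0] := dOm.
exact: (cspan_restrict (domain_semi_inner dOm) v0 (fun l (_ : Lam l) => domain_exponential l dOm)
  (fun l _ => nsq_exponential mOm bOm l) oL SL f2 Sf h).
Qed.

Lemma complete_of_total Om Lam Lam' : domain Om -> complete_exponentials Lam Om ->
  (forall l, Lam l -> ecspan Om Lam' (exponential l)) -> complete_exponentials Lam' Om.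
Proof.
move=> dOm /(complete_exponentialsP _ dOm) cL h; apply/(complete_exponentialsP _ dOm) => f f2.
exact: (ecspan_trans dOm f2 h (cL f f2)).
Qed.

End exponential_span.

Section tensor.
Context (R : realType) (n m : nat) (n0 : (0 < n)%N) (m0 : (0 < m)%N).
Implicit Types (f : 'rV[R]_n -> R[i]^o) (g : 'rV[R]_m -> R[i]^o).

Definition tensor f g : 'rV[R]_(n + m) -> R[i]^o := fun x => f (lsubmx x) * g (rsubmx x).

Lemma exponential_row_mx (l : 'rV[R]_n) (l' : 'rV[R]_m) :
  exponential (row_mx l l') = tensor (exponential l) (exponential l').
Proof.
apply/funext => x; rewrite /tensor !exponentialE -cisD /euclid_dot; congr cis.
by rewrite big_split_ord/=; congr (_ + _); apply: eq_bigr => i _; rewrite ?row_mxEl ?row_mxEr !mxE.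
Qed.

Lemma exponential_tensor (l : 'rV[R]_(n + m)) :
  exponential l = tensor (exponential (lsubmx l)) (exponential (rsubmx l)).
Proof. by rewrite -exponential_row_mx hsubmxK. Qed.

Lemma bounded_cartesian (A : set 'rV[R]_n) (B : set 'rV[R]_m) :
  bounded_set A -> bounded_set B -> bounded_set (cartesian A B).
Proof.
move=> /bounded_setP[T [T0 hA]] /bounded_setP[T' [T'0 hB]].
exists (T + T'); split=> [|M TM x]; first exact: num_real.
rewrite /= cartesianE => -[/hA Ax /hB Bx].
rewrite [leLHS]mx_normrE; apply/bigmax_leP; split=> [|[i j] _]; first by lra.
rewrite /= (ord1 i) -(hsubmxK x) -(splitK j); case: (fintype.split j) => k /=.
  by rewrite row_mxEl; have := coord_le_norm (lsubmx x) k; lra.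
by rewrite row_mxEr; have := coord_le_norm (rsubmx x) k; lra.
Qed.

Context (A : set 'rV[R]_n) (B : set 'rV[R]_m).
Hypothesis mA : measurable (A : set (lebesgueRn R n)).
Hypothesis mB : measurable (B : set (lebesgueRn R m)).

Lemma volume_cartesian : bounded_set A -> bounded_set B ->
  volume (cartesian A B) = volume A * volume B.
Proof.
move=> bA bB; rewrite /volume (lebesgue_cartesian n0 m0 mA mB) fineM//.
  by rewrite -(volumeE bA).
by rewrite -(volumeE bB).
Qed.

Lemma measurable_tensor f g : complex_measurable_fun A f -> complex_measurable_fun B g ->
  complex_measurable_fun (cartesian A B) (tensor f g).
Proof.
have [ml mr] := (measurable_fun_pairP _).1 (@measurable_split_row R n m).
have comp d1 (T1 : measurableType d1) (D : set T1) (h : lebesgueRn R (n + m) -> T1) (k : T1 -> R) :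
    measurable D -> measurable_fun setT h -> h @` cartesian A B `<=` D ->
    measurable_fun D k -> measurable_fun (cartesian A B : set (lebesgueRn R (n + m))) (k \o h).
  move=> mD mh hD mk.
  have mh' : measurable_fun (cartesian A B : set (lebesgueRn R (n + m))) h.
    by apply: (measurable_funS measurableT _ mh); exact: subsetT.
  by apply: (measurable_comp mD _ mk mh'); exact: hD.
move=> [fr fi] [gr gi].
have sA : (@lsubmx R 1 n m) @` cartesian A B `<=` A.
  by move=> _ [x] + <-; rewrite cartesianE => -[].
have sB : (@rsubmx R 1 n m) @` cartesian A B `<=` B.
  by move=> _ [x] + <-; rewrite cartesianE => -[].
apply: (@measurable_mul R _ (cartesian A B) (f \o lsubmx) (g \o rsubmx)).
  by split; [exact: (comp _ _ _ _ _ mA ml sA fr)|exact: (comp _ _ _ _ _ mA ml sA fi)].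
by split; [exact: (comp _ _ _ _ _ mB mr sB gr)|exact: (comp _ _ _ _ _ mB mr sB gi)].
Qed.

Lemma L2_tensor f g : in_L2 A f -> in_L2 B g -> in_L2 (cartesian A B) (tensor f g).
Proof.
move=> /in_L2P[mf fi] /in_L2P[mg gi]; apply/in_L2P; split; first exact: measurable_tensor.
rewrite (_ : (fun _ => _) = fun x => (sqnorm (f (lsubmx x)) * sqnorm (g (rsubmx x)))%:E).
  exact: (Rintegral_cartesian n0 m0 mA mB fi gi).1.
by apply/funext => x; rewrite /tensor sqnormM.
Qed.

Lemma L2_dot_tensor f g f' g' : in_L2 A f -> in_L2 B g -> in_L2 A f' -> in_L2 B g' ->
  L2_dot (cartesian A B) (tensor f g) (tensor f' g') = L2_dot A f f' * L2_dot B g g'.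
Proof.
move=> f2 g2 f2' g2'; rewrite /L2_dot -(complex_integral_tensor n0 m0 mA mB).
- by congr complex_integral; apply/funext => x; rewrite /tensor conjcM mulrACA.
- exact: (integrable_mul_conj mA f2 f2').
- exact: (integrable_mul_conj mB g2 g2').
Qed.

Lemma expint_cartesian l : bounded_set A -> bounded_set B ->
  expint (cartesian A B) l = expint A (lsubmx l) * expint B (rsubmx l).
Proof.
move=> bA bB; rewrite -[l in LHS]subr0 -L2_dot_exponential.
rewrite [exponential l]exponential_tensor (_ : exponential 0 = tensor (exponential 0) (exponential 0)).
  rewrite L2_dot_tensor; try exact: L2_exponential.
  by rewrite !L2_dot_exponential !subr0.
by rewrite -exponential_row_mx row_mx0.
Qed.

Hypotheses (dA : domain A) (dB : domain B).

Lemma domain_cartesian : domain (cartesian A B).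
Proof.
have [bA _ A0] := dA; have [bB _ B0] := dB; split; first exact: bounded_cartesian.
  exact: measurable_cartesian.
by rewrite volume_cartesian// mulr_gt0.
Qed.

(** Integrating out the first factor against [exponential z] maps [exponential l] to a multiple of
    the exponential of its second component. *)
Lemma ecspan_projr z g S : in_L2 B g ->
  ecspan (cartesian A B) S (tensor (exponential z) g) -> ecspan B (rsubmx @` S) g.
Proof.
move=> g2; have [bA _ A0] := dA; have [bB _ B0] := dB.
have zA := domain_exponential z dA; have lA l := domain_exponential l dA.
have lB l := domain_exponential l dB.
apply: (cspan_project (domain_semi_inner domain_cartesian) (domain_semi_inner dB) A0
  (T := tensor (exponential z)) (psi := @exponential R m)
  (c := fun l => (volume A)^-1%:C%C * expint A (lsubmx l - z)) _ _ _ _ _ g2).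
- by move=> u u2; exact: (L2_tensor zA u2).
- move=> u v u2 v2; rewrite (L2_dot_tensor zA u2 zA v2) L2_dot_exponential subrr.
  by rewrite (domain_expint0 dA).
- by move=> l _; exact: (domain_exponential l domain_cartesian).
- by move=> l _; exact: lB.
- move=> l v _ v2; rewrite [exponential l]exponential_tensor.
  rewrite (L2_dot_tensor (lA _) (lB _) zA v2) L2_dot_exponential.
  by rewrite mulrA -rmorphM/= divff ?gt_eqF// mul1r.
Qed.

Lemma ecspan_projl f w S : in_L2 A f ->
  ecspan (cartesian A B) S (tensor f (exponential w)) -> ecspan A (lsubmx @` S) f.
Proof.
move=> f2; have [bA _ A0] := dA; have [bB _ B0] := dB.
have wB := domain_exponential w dB; have lA l := domain_exponential l dA.
have lB l := domain_exponential l dB.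
apply: (cspan_project (domain_semi_inner domain_cartesian) (domain_semi_inner dA) B0
  (T := tensor^~ (exponential w)) (psi := @exponential R n)
  (c := fun l => (volume B)^-1%:C%C * expint B (rsubmx l - w)) _ _ _ _ _ f2).
- by move=> u u2; exact: (L2_tensor u2 wB).
- move=> u v u2 v2; rewrite (L2_dot_tensor u2 wB v2 wB) L2_dot_exponential subrr.
  by rewrite (domain_expint0 dB) mulrC.
- by move=> l _; exact: (domain_exponential l domain_cartesian).
- by move=> l _; exact: lA.
- move=> l v _ v2; rewrite [exponential l]exponential_tensor.
  rewrite (L2_dot_tensor (lA _) (lB _) v2 wB) L2_dot_exponential.
  by rewrite mulrA -rmorphM/= divff ?gt_eqF// mul1r mulrC.
Qed.

End tensor.

(** * Density of box indicators and spectra of products *)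

Section box_approximation.
Context (R : realType) (d : nat).
Local Notation mu := (@lebesgue_measure_Rn R d).

Definition box_union (s : seq ('rV[R]_d * 'rV[R]_d)) : set 'rV[R]_d := \bigcup_(p in [set` s]) box p.

Lemma measurable_box_union s : measurable (box_union s : set (lebesgueRn R d)).
Proof.
by apply: countable_bigcup_measurable; [exact/finite_set_countable|move=> p; exact: box_measurable].
Qed.

(** A nearly optimal cover by boxes exceeds [E] by less than [e / 2] in measure, and its finite
    subunions exhaust it by continuity of the measure from below. *)
Lemma box_union_approx (E : set 'rV[R]_d) (e : R) :
  measurable (E : set (lebesgueRn R d)) -> (mu E < +oo)%E -> 0 < e ->
  exists s, (mu (E `\` box_union s) < e%:E)%E /\ (mu (box_union s `\` E) < e%:E)%E.
Proof.
move=> mE Eoo e0; have e2 : 0 < e / 2 by lra.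
have Efin : mu E \is a fin_num by rewrite ge0_fin_numE.
have [_ [C [cC EC] <-] CE] := lb_ereal_inf_adherent e2 Efin.
have /countable_injP[f finj] := cC.
pose U : set (lebesgueRn R d) := \bigcup_(p in C) box p.
pose UN N : set (lebesgueRn R d) := \bigcup_(p in C `&` [set p | (f p < N)%N]) box p.
have mU : measurable U by apply: countable_bigcup_measurable => // p; exact: box_measurable.
have finN N : finite_set (C `&` [set p | (f p < N)%N]).
  rewrite -(eq_finite_set (inj_card_eq (f := f) _)); last first.
    by move=> p q /set_mem[Cp _] /set_mem[Cq _]; apply: finj; rewrite inE.
  apply: (sub_finite_set (B := `I_N)); last exact: finite_II.
  by move=> _ [p [_ pN] <-].
have mUN N : measurable (UN N).
  by apply: countable_bigcup_measurable => [|p]; [exact: finite_set_countable|exact: box_measurable].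
have UE : (mu U < mu E + (e / 2)%:E)%E.
  apply: le_lt_trans CE; apply: (le_trans (lebesgue_outer_bigcup _ cC)).
  by apply: le_esum => p _; exact: lebesgue_outer_box_le.
have Uoo : (mu U < +oo)%E by apply: (lt_trans UE); rewrite -(fineK Efin) -EFinD ltry.
have Ufin : mu U \is a fin_num by rewrite ge0_fin_numE.
have ndU : {homo UN : N M / (N <= M)%N >-> (N <= M)%O}.
  move=> N M NM; apply/subsetPset => x [p [Cp /= pN] px]; exists p => //; split=> //=.
  exact: leq_trans pN NM.
have UUN : U = \bigcup_N UN N.
  apply/seteqP; split=> [x [p Cp px]|x [N _ [p [Cp _] px]]]; last by exists p.
  by exists (f p).+1 => //; exists p => //; split => /=.
have cvgU : (mu \o UN) N @[N --> \oo] --> mu U.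
  by rewrite [in X in _ --> X]UUN; apply: nondecreasing_cvg_mu => //; rewrite -UUN.
have [N UN_e] : exists N, (mu U <= mu (UN N) + (e / 2)%:E)%E.
  have homU : {homo mu \o UN : N M / (N <= M)%N >-> (N <= M)%E}.
    by move=> N M NM; apply: le_lebesgue_outer; exact/subsetPset/ndU.
  have : ((fine (mu U) - e / 2)%:E < limn (mu \o UN))%E.
    rewrite (cvg_lim _ cvgU)// -[ltRHS](fineK Ufin) lte_fin; lra.
  move=> /(lte_lim homU (cvgP _ cvgU))[N _ /(_ N (leqnn N)) /= h]; exists N.
  by rewrite -leeBlDr// -(fineK Ufin) -EFinB.
have [s sE] := (finite_seqP _).1 (finN N); exists s.
have -> : box_union s = UN N by rewrite /box_union /UN sE.
have UD (D : set (lebesgueRn R d)) : measurable D -> D `<=` U -> (mu U <= mu D + (e / 2)%:E)%E ->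
    (mu (U `\` D) < e%:E)%E.
  move=> mD DU h; have Dfin : mu D \is a fin_num.
    by rewrite ge0_fin_numE//; apply: le_lt_trans Uoo; exact: le_lebesgue_outer.
  rewrite measureD// (setIidr DU) lteBlDr//.
  by apply: (le_lt_trans h); rewrite addeC lteD2rE// lte_fin; lra.
have UNU : UN N `<=` U by move=> x [p [Cp _] px]; exists p.
split.
  apply: le_lt_trans (UD _ (mUN N) UNU UN_e).
  by apply: le_lebesgue_outer => x [/EC Ux ?].
apply: le_lt_trans (UD _ mE EC (ltW UE)).
by apply: le_lebesgue_outer => x [/UNU Ux ?].
Qed.

End box_approximation.

Import HBNNSimple.

Section indicator_density.
Context (R : realType) (d : nat) (Om : set 'rV[R]_d) (dOm : domain Om).
Local Notation mu := (@lebesgue_measure_Rn R d).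
Local Notation dot := (@L2_dot R d Om).
Local Notation hd := (domain_semi_inner dOm).
Implicit Types (E F : set 'rV[R]_d) (f : 'rV[R]_d -> R[i]^o).

Definition cindic E : 'rV[R]_d -> R[i]^o := fun x => (\1_E x : R)%:C%C.

Lemma measurable_cindic E (D : set (lebesgueRn R d)) : measurable (E : set (lebesgueRn R d)) ->
  complex_measurable_fun D (cindic E).
Proof.
move=> mE; split; last exact: measurable_cst.
exact: (measurable_funS measurableT (@subsetT _ D) (measurable_indic mE)).
Qed.

Lemma sqnorm_cindic E x : sqnorm (cindic E x) = \1_E x.
Proof. by rewrite sqnorm_real indicE; case: (x \in E) => /=; rewrite ?expr1n ?expr0n. Qed.

Lemma L2_cindic E : measurable (E : set (lebesgueRn R d)) -> in_L2 Om (cindic E).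
Proof.
move=> mE; have [bOm mOm _] := dOm; apply: (L2_bounded mOm bOm (measurable_cindic _ mE)).
by exists 1 => x _; rewrite sqnorm_cindic indicE; case: (x \in E) => /=; lra.
Qed.

Definition box_indic p : 'rV[R]_d -> R[i]^o := cindic (box p).
Local Notation bspan f := (cspan dot box_indic setT f).

Lemma box_setI p q : exists r, box p `&` box q = box r :> set 'rV[R]_d.
Proof.
exists (\row_i Num.max (p.1 ord0 i) (q.1 ord0 i), \row_i Num.min (p.2 ord0 i) (q.2 ord0 i)).
apply/seteqP; split=> x /=.
  move=> [px qx] i; have /andP[p1 p2] := px i; have /andP[q1 q2] := qx i.
  by rewrite !mxE gt_max le_min p1 p2 q1 q2.
move=> h; split=> i; have := h i; rewrite !mxE gt_max le_min;
  by move=> /andP[/andP[h1 h2] /andP[h3 h4]]; rewrite ?h1 ?h2 ?h3 ?h4.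
Qed.

Lemma lincomb_box_union (s : seq ('rV[R]_d * 'rV[R]_d)) : lincomb box_indic setT (cindic (box_union s)).
Proof.
have lc1 p : lincomb box_indic setT (cindic (box p)) by exact: (@lincomb1 _ _ _ box_indic setT p I).
have box_cons p t : box_union (p :: t) = box p `|` box_union t.
  rewrite /box_union; apply/seteqP; split=> x /=.
    by move=> [q]; rewrite /= inE => /predU1P[->|qt] qx; [left|right; exists q].
  by move=> [px|[q qt qx]]; [exists p; rewrite /= ?mem_head|exists q; rewrite //= inE qt orbT].
have cU E F : cindic (E `|` F) = -1 *: cindic (E `&` F) + (1 *: cindic E + cindic F).
  apply/funext => x; rewrite !fctE/= scaleN1r scale1r -!rmorphN -!rmorphD/=; congr (_%:C%C).
  by rewrite !indicE in_setU in_setI; case: (x \in E); case: (x \in F) => /=; lra.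
(* Inclusion-exclusion: adding a box also calls for its intersection with the rest of the union.
   Since boxes are stable under intersection, the induction carries the claim for the intersections
   of the union with every box. *)
suff: lincomb box_indic setT (cindic (box_union s)) /\
    forall q, lincomb box_indic setT (cindic (box q `&` box_union s)) by case.
elim: s => [|p s [IH1 IH2]].
  have l0 : lincomb box_indic setT (cindic set0).
    exists [::]; split=> //; rewrite big_nil; apply/funext => x.
    by rewrite /cindic indicE in_set0.
  rewrite (_ : box_union [::] = set0); last by apply/seteqP; split=> x // [].
  by split=> // q; rewrite setI0.
rewrite box_cons; split.
  by rewrite cU; apply: lincomb_lin; [exact: IH2|apply: lincomb_lin; [exact: lc1|exact: IH1]].
move=> q; rewrite setIUr cU; have [r qr] := box_setI q p.
rewrite (_ : box q `&` box p `&` (box q `&` box_union s) = box r `&` box_union s); last first.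
  by rewrite -qr; apply/seteqP; split=> x /= [[qx px]] => [[_ Ux]|Ux].
rewrite qr; apply: lincomb_lin; [exact: IH2|apply: lincomb_lin; [exact: lc1|exact: IH2]].
Qed.

Lemma nsq_cindicB E F : measurable (E : set (lebesgueRn R d)) -> measurable (F : set (lebesgueRn R d)) ->
  ((nsq dot (cindic E - cindic F))%:E <= mu ((Om `&` E) `\` F) + mu (F `\` (Om `&` E)))%E.
Proof.
move=> mE mF; have [bOm mOm _] := dOm.
rewrite -(L2_dotE mOm (subspaceB hd (L2_cindic mE) (L2_cindic mF))) L2_normsqE.
set D1 := _ `\` F; set D2 := F `\` _.
have mD1 : measurable (D1 : set (lebesgueRn R d)) by apply: measurableD => //; exact: measurableI.
have mD2 : measurable (D2 : set (lebesgueRn R d)) by apply: measurableD => //; exact: measurableI.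
apply: (@le_trans _ _ (mu ((D1 `|` D2) `&` Om))); last first.
  apply: (@le_trans _ _ (mu (D1 `|` D2))); last exact: measureU2.
  by apply: le_lebesgue_outer; exact: subIsetl.
rewrite -integral_indic//; last exact: measurableU.
rewrite le_eqVlt; apply/orP; left; apply/eqP; apply: eq_integral => x /set_mem Omx.
rewrite !fctE /cindic -rmorphB/= sqnorm_real; congr EFin.
rewrite !indicE in_setU !in_setD in_setI (mem_set Omx)/=.
by case: (x \in E); case: (x \in F) => /=; rewrite ?subrr ?subr0 ?sub0r ?sqrrN ?expr1n ?expr0n.
Qed.

Lemma bspan_cindic E : measurable (E : set (lebesgueRn R d)) -> bspan (cindic E).
Proof.
move=> mE; have [bOm mOm _] := dOm.
have HB i : setT i -> in_L2 Om (box_indic i) by move=> _; apply: L2_cindic; exact: box_measurable.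
move=> e e0; have e2 : 0 < e / 2 by lra.
have mOE : measurable (Om `&` E : set (lebesgueRn R d)) by exact: measurableI.
have OEoo : (mu (Om `&` E) < +oo)%E.
  by apply: le_lt_trans (bounded_lty bOm); apply: le_lebesgue_outer; exact: subIsetl.
have [s [h1 h2]] := box_union_approx mOE OEoo e2.
exists (cindic (box_union s)); first exact: lincomb_box_union.
rewrite -lte_fin; apply: (le_lt_trans (nsq_cindicB mE (measurable_box_union s))).
by rewrite [e]splitr EFinD; apply: lteD.
Qed.

Lemma bspan_lin a f g : in_L2 Om f -> in_L2 Om g -> bspan f -> bspan g -> bspan (a *: f + g).
Proof.
have HB i : setT i -> in_L2 Om (box_indic i) by move=> _; apply: L2_cindic; exact: box_measurable.
by move=> f2 g2; exact: (cspan_lin hd HB a (@subset_refl _ _) f2 g2).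
Qed.

Lemma bspan0 : bspan 0.
Proof.
move=> e e0; exists 0; first by exists [::]; split=> //; rewrite big_nil.
rewrite subrr /nsq (dot0l hd)//; exact: (subspace0 hd).
Qed.

(** Simple functions increase to [f] and are combinations of indicators; dominated convergence with
    the square of [f] as majorant turns pointwise convergence into convergence in L^2. *)
Lemma bspan_ge0 (f : lebesgueRn R d -> R) : measurable_fun (Om : set (lebesgueRn R d)) f ->
  (forall x, Om x -> 0 <= f x) -> in_L2 Om (fun x => (f x)%:C%C) -> bspan (fun x => (f x)%:C%C).
Proof.
move=> mf f0 f2; have [bOm mOm _] := dOm.
have mEf : measurable_fun (Om : set (lebesgueRn R d)) (EFin \o f) by exact/measurable_EFinP.
have HB i : setT i -> in_L2 Om (box_indic i) by move=> _; apply: L2_cindic; exact: box_measurable.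
pose g k : {nnsfun lebesgueRn R d >-> R} := nnsfun_approx mOm mEf k.
pose cg k : 'rV[R]_d -> R[i]^o := fun x => (g k x)%:C%C.
have gf k x : Om x -> g k x <= f x.
  move=> Omx; rewrite -lee_fin /g nnsfun_approxE; apply: (le_approx (f := EFin \o f)) => //.
have mg k y : measurable (g k @^-1` [set y] : set (lebesgueRn R d)).
  by rewrite -[X in measurable X]setTI; exact: (measurable_funP (g k)).
have Hg k : in_L2 Om (cg k) /\ bspan (cg k).
  have -> : cg k = \sum_(y <- finmap.enum_fset (fset_set (range (g k)))) y%:C%C *: cindic (g k @^-1` [set y]).
    apply/funext => x; rewrite fct_sumE /cg (fimfunE (g k)) fsbig_finite//= rmorph_sum/=.
    by apply: eq_bigr => y _; rewrite rmorphM.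
  elim: (finmap.enum_fset _) => [|y s [IH1 IH2]].
    by rewrite big_nil; split; [exact: (subspace0 hd)|exact: bspan0].
  rewrite big_cons; split; first exact: (subspace_lin hd _ (L2_cindic (mg k y)) IH1).
  exact: (bspan_lin _ (L2_cindic (mg k y)) IH1 (bspan_cindic (mg k y)) IH2).
apply: (cspan_lim hd HB (@subset_refl _ _) f2) => e e0.
have [k hk] : exists k, nsq dot ((fun x => (f x)%:C%C) - cg k : 'rV[R]_d -> R[i]^o) < e.
  pose h k (x : lebesgueRn R d) := ((f x - g k x) ^+ 2)%:E.
  have mh k : measurable_fun (Om : set (lebesgueRn R d)) (h k).
    apply/measurable_EFinP; apply: measurable_funX; apply: measurable_funB; first exact: mf.
    exact: (measurable_funS measurableT (@subsetT _ (Om : set (lebesgueRn R d))) (measurable_funP (g k))).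
  have ff : mu.-integrable Om (fun x => (f x ^+ 2)%:E).
    have [_] := (in_L2P _ _).1 f2; apply: eq_integrable => // x _.
    by rewrite sqnorm_real.
  have hcvg x : Om x -> h k x @[k --> \oo] --> 0%E.
    move=> Omx; have := cvg_nnsfun_approx mOm mEf (fun y Oy => f0 y Oy) Omx.
    move=> /fine_cvgP[_ gx]; apply: cvg_EFin; first by apply: nearW.
    have c : (f x - g k x) @[k --> \oo] --> f x - f x by apply: cvgB; [exact: cvg_cst|exact: gx].
    have := cvgM c c; rewrite subrr mulr0 => cc.
    rewrite (_ : fine \o _ = (fun k => (f x - g k x) * (f x - g k x))); first exact: cc.
    by apply/funext => k; rewrite /h/= expr2.
  have hle x : Om x -> forall k, (`|h k x| <= (f x ^+ 2)%:E)%E.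
    move=> Omx k; rewrite lee_fin ger0_norm ?sqr_ge0//; have := gf k _ Omx.
    have g0 : 0 <= g k x by exact: fun_ge0.
    by move=> fg; rewrite ler_sqr ?nnegrE; have := f0 x Omx; lra.
  have [_ _ cv] := dominated_convergence mOm mh (measurable_cst 0%E)
    (aeW mu hcvg) ff (aeW mu (fun x k Omx => hle x Omx k)).
  move: cv; rewrite integral0 => cv.
  have /cv[k _ /(_ k (leqnn k)) /=] : nbhs (0%E : \bar R) [set y | (y < e%:E)%E].
    exists e => //= r /=; rewrite sub0r normrN lte_fin; exact: ltr_normlW.
  move=> hk; exists k; rewrite -lte_fin -(L2_dotE mOm (subspaceB hd f2 (Hg k).1)) L2_normsqE.
  apply: le_lt_trans hk; rewrite le_eqVlt; apply/orP; left; apply/eqP; apply: eq_integral => x _.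
  by rewrite !fctE /cg -rmorphB/= sqnorm_real.
by exists (cg k).
Qed.

Lemma bspan_real (f : lebesgueRn R d -> R) : measurable_fun (Om : set (lebesgueRn R d)) f ->
  in_L2 Om (fun x => (f x)%:C%C) -> bspan (fun x => (f x)%:C%C).
Proof.
move=> mf f2; have [bOm mOm _] := dOm.
have part (g : lebesgueRn R d -> R) : measurable_fun (Om : set (lebesgueRn R d)) g ->
    (forall x, 0 <= g x) -> (forall x, g x <= `|f x|) ->
    in_L2 Om (fun x => (g x)%:C%C) /\ bspan (fun x => (g x)%:C%C).
  move=> mg g0 gf; have g2 : in_L2 Om (fun x => (g x)%:C%C).
    apply: (L2_le mOm _ f2); first by split; [exact: mg|exact: measurable_cst].
    exists 1 => x _; rewrite mul1r !sqnorm_real -[leRHS]real_normK ?num_real//.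
    by rewrite ler_sqr ?nnegrE.
  by split=> //; apply: bspan_ge0.
have mp : measurable_fun (Om : set (lebesgueRn R d)) (fun x => Num.max (f x) 0).
  by apply: measurable_maxr; [exact: mf|exact: measurable_cst].
have [p2 bp] := part (fun x => Num.max (f x) 0) mp
  (fun x => ltac:(by rewrite le_max lexx orbT))
  (fun x => ltac:(by rewrite ge_max ler_norm normr_ge0)).
have mNf : measurable_fun (Om : set (lebesgueRn R d)) (fun x => - f x) by exact: measurableT_comp.
have mq : measurable_fun (Om : set (lebesgueRn R d)) (fun x => Num.max (- f x) 0).
  by apply: measurable_maxr; [exact: mNf|exact: measurable_cst].
have [q2 bq] := part (fun x => Num.max (- f x) 0) mq
  (fun x => ltac:(by rewrite le_max lexx orbT))
  (fun x => ltac:(by rewrite ge_max -normrN ler_norm normr_ge0)).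
rewrite (_ : (fun _ => _) = (-1 *: (fun x => (Num.max (- f x) 0)%:C%C) +
    (fun x => (Num.max (f x) 0)%:C%C) : 'rV[R]_d -> R[i]^o)).
  exact: bspan_lin.
apply/funext => x; rewrite !fctE/= scaleN1r -rmorphN -rmorphD/=; congr (_%:C%C).
by rewrite /Num.max; case: ifPn; case: ifPn; lra.
Qed.

Lemma bspan_L2 f : in_L2 Om f -> bspan f.
Proof.
move=> f2; have [mf _] := f2; case: mf => mr mi; have [bOm mOm _] := dOm.
have le1 (a b : R) : a ^+ 2 <= 1 * (a ^+ 2 + b ^+ 2) by have := sqr_ge0 b; lra.
have r2 : in_L2 Om (fun x => (complex.Re (f x))%:C%C).
  apply: (L2_le mOm _ f2); first by split; [exact: mr|exact: measurable_cst].
  by exists 1 => x _; rewrite sqnorm_real; exact: le1.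
have i2 : in_L2 Om (fun x => (complex.Im (f x))%:C%C).
  apply: (L2_le mOm _ f2); first by split; [exact: mi|exact: measurable_cst].
  by exists 1 => x _; rewrite sqnorm_real /sqnorm addrC; exact: le1.
rewrite (_ : f = 'i%C *: (fun x => (complex.Im (f x))%:C%C) + (fun x => (complex.Re (f x))%:C%C)).
  exact: (bspan_lin _ i2 r2 (bspan_real mi i2) (bspan_real mr r2)).
apply/funext => x; rewrite !fctE/=; case: (f x) => a b /=.
by apply/eqP; rewrite eq_complex/=; apply/andP; split; apply/eqP; ring.
Qed.

End indicator_density.

Section span_map.
Context (R : realType) (V : lmodType R[i]) (dot : V -> V -> R[i]).
Context (V' : lmodType R[i]) (H' : set V') (dot' : V' -> V' -> R[i]).
Hypothesis hd' : semi_inner H' dot'.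
Context (I : choiceType) (phi : I -> V') (S : set I) (T : V' -> V) (k : R).
Hypotheses (k0 : 0 <= k) (Hphi : forall i, S i -> H' (phi i)).
Hypothesis T_lin : forall a u v, T (a *: u + v) = a *: T u + T v.
Hypothesis nsqT : forall u, H' u -> nsq dot (T u) = k * nsq dot' u.

Lemma cspan_map u : H' u -> cspan dot' phi S u -> cspan dot (fun i => T (phi i)) S (T u).
Proof.
move=> Hu Su e e0; have k1 : 0 < k + 1 by rewrite ltr_wpDl.
have [v [ps [Sps vE]] uv] := Su (e / (k + 1)) (divr_gt0 e0 k1).
have T0 : T 0 = 0.
  by have := T_lin (-1) 0 0; rewrite scaler0 addr0 scaleN1r addNr.
have TE : T v = \sum_(p <- ps) p.1 *: T (phi p.2).
  rewrite vE; elim: (ps) => [|p s IH]; first by rewrite !big_nil.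
  by rewrite !big_cons T_lin IH.
exists (T v); first by exists ps.
have Hv : H' v.
  by rewrite vE; apply: (subspace_sum hd') => p /Sps Sp; apply: (subspaceZ hd'); exact: Hphi.
have -> : T u - T v = T (u - v).
  by rewrite [u - v]addrC -[- v]scaleN1r T_lin scaleN1r addrC.
rewrite nsqT; last exact: (subspaceB hd').
move: uv; rewrite ltr_pdivlMr// => uv.
by have := nsq_ge0 hd' (subspaceB hd' Hu Hv); lra.
Qed.

End span_map.

Section product_spectrum.
Context (R : realType) (n m : nat) (n0 : (0 < n)%N) (m0 : (0 < m)%N).
Context (A : set 'rV[R]_n) (B : set 'rV[R]_m) (dA : domain A) (dB : domain B).
Local Notation AB := (cartesian A B).

Let mA : measurable (A : set (lebesgueRn R n)). Proof. by case: dA. Qed.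
Let mB : measurable (B : set (lebesgueRn R m)). Proof. by case: dB. Qed.
Let dAB : domain AB. Proof. exact: domain_cartesian. Qed.
Local Notation hdA := (domain_semi_inner dA).
Local Notation hdB := (domain_semi_inner dB).
Local Notation hdAB := (domain_semi_inner dAB).

(** One factor at a time: tensoring with a fixed function multiplies squared norms by a constant, so
    it preserves closed spans. *)
Lemma ecspan_tensor f g U W : in_L2 A f -> in_L2 B g -> ecspan A U f -> ecspan B W g ->
  ecspan AB (cartesian U W) (tensor f g).
Proof.
move=> f2 g2 Uf Wg.
have nsqT f' g' : in_L2 A f' -> in_L2 B g' ->
    nsq (@L2_dot R _ AB) (tensor f' g') = nsq (@L2_dot R _ A) f' * nsq (@L2_dot R _ B) g'.
  move=> f2' g2'; rewrite {1}/nsq (L2_dot_tensor n0 m0 mA mB f2' g2' f2' g2').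
  by rewrite (nsqE hdA f2') (nsqE hdB g2') -rmorphM.
have He l : in_L2 A (exponential l) := domain_exponential l dA.
have He' l : in_L2 B (exponential l) := domain_exponential l dB.
have lin1 a (u v : 'rV[R]_n -> R[i]^o) (w : 'rV[R]_m -> R[i]^o) : tensor (a *: u + v) w = a *: tensor u w + tensor v w.
  by apply/funext => x; rewrite /tensor !fctE mulrDl -mulrA.
have lin2 a (u v : 'rV[R]_m -> R[i]^o) (w : 'rV[R]_n -> R[i]^o) : tensor w (a *: u + v) = a *: tensor w u + tensor w v.
  by apply/funext => x; rewrite /tensor !fctE mulrDr /= mulrCA.
have S1 := cspan_map (V := ('rV[R]_(n + m) -> R[i]^o)) (dot := @L2_dot R _ AB) hdA
  (T := fun u => tensor u g) (nsq_ge0 hdB g2) (fun l (_ : U l) => He l) (fun a u v => lin1 a u v g) (fun u u2 => etrans (nsqT u g u2 g2) (mulrC _ _)) f2 Uf.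
apply: (cspan_trans hdAB _ _ (L2_tensor n0 m0 mA mB f2 g2) _ S1).
- by move=> l _; exact: (L2_tensor n0 m0 mA mB (He l) g2).
- by move=> l _; exact: (domain_exponential l dAB).
move=> l Ul.
have S2 := cspan_map (V := ('rV[R]_(n + m) -> R[i]^o)) (dot := @L2_dot R _ AB) hdB
  (T := tensor (exponential l)) (nsq_ge0 hdA (He l)) (fun l' (_ : W l') => He' l') (fun a u v => lin2 a u v _) (fun u u2 => nsqT _ u (He l) u2) g2 Wg.
move=> e /S2[v [ps [Sps ->]] h]; exists (\sum_(p <- ps) p.1 *: tensor (exponential l) (exponential p.2)) => //.
exists [seq (p.1, row_mx l p.2) | p <- ps]; split.
  by move=> q /mapP[p /Sps Wp ->]; apply/cartesian_row_mx.
by rewrite big_map; apply: eq_bigr => p _; rewrite /= exponential_row_mx.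
Qed.

Lemma product_spectrum U W : is_spectrum U A -> is_spectrum W B -> is_spectrum (cartesian U W) AB.
Proof.
have [bA _ _] := dA; have [bB _ _] := dB.
move=> [cU oU kU] [cW oW kW]; split.
- rewrite (_ : cartesian U W = (fun p => row_mx p.1 p.2) @` (U `*` W)).
    by apply: (card_le_trans (card_image_le _ _)); exact: countableX.
  apply/seteqP; split=> x; first by move=> [a Ua [b Wb <-]]; exists (a, b).
  by move=> [[a b] [/= Ua Wb] <-]; exists a => //; exists b.
- move=> l l'; rewrite cartesianE => -[Ul Wl] [Ul' Wl'] ll'.
  rewrite L2_dot_exponential (expint_cartesian n0 m0 mA mB _ bA bB) !raddfB/= -!L2_dot_exponential.
  have [e1|/eqP e1] := eqVneq (lsubmx l) (lsubmx l'); last by rewrite oU// mul0r.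
  have [e2|/eqP e2] := eqVneq (rsubmx l) (rsubmx l'); last by rewrite [X in _ * X]oW// mulr0.
  by case: ll'; rewrite -(hsubmxK l) -(hsubmxK l') e1 e2.
- have cA := (complete_exponentialsP _ dA).1 kU; have cB := (complete_exponentialsP _ dB).1 kW.
  apply/(complete_exponentialsP _ dAB) => f f2.
  apply: (cspan_trans hdAB _ _ f2 _ (bspan_L2 dAB f2)).
  + by move=> p _; apply: (L2_cindic dAB); exact: box_measurable.
  + by move=> l _; exact: (domain_exponential l dAB).
  (* Box indicators are dense and each is a tensor of two box indicators, so it suffices to
     approximate the factors. *)
  move=> p _; set p1 := (lsubmx p.1, lsubmx p.2); set p2 := (rsubmx p.1, rsubmx p.2).
  rewrite (_ : box_indic p = tensor (box_indic p1) (box_indic p2)).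
    have i1 := L2_cindic dA (box_measurable p1); have i2 := L2_cindic dB (box_measurable p2).
    exact: (ecspan_tensor i1 i2 (cA _ i1) (cB _ i2)).
  apply/funext => x; rewrite /tensor /box_indic /cindic -rmorphM/=; congr (_%:C%C).
  rewrite !indicE -natrM mulnb; congr ((_ : bool)%:R).
  apply/idP/andP => [/set_mem|[/set_mem h1 /set_mem h2]].
    by rewrite -(row_boxK p) -{1}(hsubmxK x) => /box_row_mx[? ?]; split; apply: mem_set.
  by apply: mem_set; rewrite -(row_boxK p) -(hsubmxK x); apply/box_row_mx.
Qed.

End product_spectrum.

(** * Translations and restricted exponentials *)

Section translation.
Context (R : realType) (d : nat).
Local Notation mu := (@lebesgue_measure_Rn R d).
Implicit Types (E F : set 'rV[R]_d) (z : 'rV[R]_d).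

Definition shift_set z E : set 'rV[R]_d := [set x | E (x - z)].

Lemma shift_set_box z p : shift_set z (box p) = box (p.1 + z, p.2 + z).
Proof.
by apply/seteqP; split=> x px i; have := px i; rewrite !mxE ltrBrDr lerBlDr.
Qed.

Lemma shift_setK z E : shift_set (- z) (shift_set z E) = E.
Proof. by apply/seteqP; split=> x; rewrite /shift_set /= opprK addrK. Qed.

(** Translating covers gives one inequality; applied to the opposite translation it gives the
    other. *)
Lemma lebesgue_outer_shift z E : lebesgue_outer (shift_set z E) = lebesgue_outer E.
Proof.
suff le w F : (lebesgue_outer (shift_set w F) <= lebesgue_outer F)%E.
  by apply/eqP; rewrite eq_le le/= -{1}(shift_setK z E) le.
apply: le_ereal_inf_tmp => _ [C [cC FC] <-].
pose sh (p : 'rV[R]_d * 'rV[R]_d) := (p.1 + w, p.2 + w).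
apply: (@le_trans _ _ (lebesgue_outer (\bigcup_(p in C) box (sh p)))).
  by apply: le_lebesgue_outer => x /FC[p Cp px]; exists p => //; rewrite /sh -shift_set_box.
apply: (le_trans (lebesgue_outer_bigcup _ cC)); apply: le_esum => p _.
apply: (le_trans (lebesgue_outer_box_le _)); rewrite lee_fin /box_volume le_eqVlt.
by apply/orP; left; apply/eqP; apply: eq_bigr => i _; rewrite !mxE opprD addrACA subrr addr0.
Qed.

Lemma measurable_shift_set z E : measurable (E : set (lebesgueRn R d)) ->
  measurable (shift_set z E : set (lebesgueRn R d)).
Proof.
move=> mE; apply: le_caratheodory_measurable => X; pose Y := shift_set (- z) X.
have sh F : X `&` shift_set z F = shift_set z (Y `&` F).
  by apply/seteqP; split=> x; rewrite /Y /shift_set /= opprK subrK.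
rewrite (sh E) (_ : ~` shift_set z E = shift_set z (~` E)); last by [].
rewrite sh [X in (X + _)%E]lebesgue_outer_shift [X in (_ + X)%E]lebesgue_outer_shift.
rewrite [leRHS](_ : _ = lebesgue_outer Y); last by rewrite /Y lebesgue_outer_shift.
by rewrite [leRHS](mE Y).
Qed.

Lemma complex_integral_shift z E (f : 'rV[R]_d -> R[i]) :
  measurable (E : set (lebesgueRn R d)) ->
  complex_measurable_fun setT f -> cintegrable E (fun x => f (x + z)) ->
  complex_integral (shift_set z E) f = complex_integral E (fun x => f (x + z)).
Proof.
move=> mE [mr mi] [ir ii].
have mz : measurable_fun [set: lebesgueRn R d] (fun x : lebesgueRn R d => x + z : lebesgueRn R d).
  move=> _ Y mY; rewrite setTI; have := measurable_shift_set (- z) mY.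
  by rewrite /shift_set opprK.
have key (g : 'rV[R]_d -> R) : measurable_fun [set: lebesgueRn R d] g ->
    mu.-integrable E (EFin \o (fun x => g (x + z))) ->
    \int[mu]_(x in shift_set z E) g x = \int[mu]_(x in E) g (x + z).
  move=> mg ig; rewrite /Rintegral; congr fine.
  have mS := measurable_shift_set z mE.
  have pre : (fun x => x + z) @^-1` (shift_set z E) = E.
    by apply/seteqP; split=> x; rewrite /shift_set /= addrK.
  have := @integral_pushforward _ _ _ _ R _ mz mu (shift_set z E) (EFin \o g).
  rewrite pre => /(_ ((measurable_EFinP _ _).2 mg)) /(_ ig) /(_ mS) <-.
  apply: eq_measure_integral => Y mY _.
  have := lebesgue_outer_shift (- z) Y; rewrite /shift_set opprK => h.
  by first [exact: h|exact: (esym h)].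
by rewrite /complex_integral (key _ mr ir) (key _ mi ii).
Qed.

Lemma cvg_prod (I : eqType) (s : seq I) (F : I -> R -> R) (l : I -> R) (G : set_system R) :
  Filter G -> (forall i, F i t @[t --> G] --> l i) ->
  \prod_(i <- s) F i t @[t --> G] --> \prod_(i <- s) l i.
Proof.
move=> GF h; elim: s => [|i s IH].
  by rewrite big_nil; under eq_fun do rewrite big_nil; exact: cvg_cst.
by rewrite big_cons; under eq_fun do rewrite big_cons; exact: cvgM.
Qed.

(** The box shrunk by [r / 2] on every side lies both in the box and in its translates by less than
    [r / 2], and its volume depends continuously on the shrinking. *)
Lemma box_shift_small p (e : R) : 0 < e -> exists2 del : R, 0 < del &
  forall z, `|z| < del -> (mu (box p `\` shift_set z (box p)) < e%:E)%E.
Proof.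
move=> e0; case: (posnP d) => [d0|d0].
  exists 1 => // z _; rewrite (_ : _ `\` _ = set0) ?measure0 ?lte_fin//.
  apply/seteqP; split=> x // -[_]; apply; rewrite shift_set_box => i.
  by have := ltn_ord i; rewrite [X in (_ < X)%N]d0.
pose q (t : R) : 'rV[R]_d * 'rV[R]_d := (p.1 + const_mx t, p.2 - const_mx t).
have cv : box_volume (q t) @[t --> (0:R)] --> box_volume p.
  apply: cvg_prod => i; rewrite /=.
  rewrite [X in _ --> X](_ : _ = (0 + (p.2 ord0 i - 0 - (p.1 ord0 i + 0))
    + `|0 - (p.2 ord0 i - 0 - (p.1 ord0 i + 0))|) / 2); last by rewrite -maxr_absE subr0 addr0.
  under eq_fun do rewrite !mxE maxr_absE.
  have c0 : p.2 ord0 i - t - (p.1 ord0 i + t) @[t --> (0:R)] --> p.2 ord0 i - 0 - (p.1 ord0 i + 0).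
    apply: cvgB; first by apply: cvgB; [exact: cvg_cst|exact: cvg_id].
    by apply: cvgD; [exact: cvg_cst|exact: cvg_id].
  apply: cvgM; last exact: cvg_cst.
  apply: cvgD; first by apply: cvgD => //; exact: cvg_cst.
  by apply: cvg_norm; apply: cvgB => //; exact: cvg_cst.
have /cvgrPdist_lt/(_ _ e0)[r /= r0 hr] := cv.
exists (r / 2) => [|z zr]; first by lra.
have := hr (r / 2); rewrite /ball_ /= sub0r normrN ger0_norm; last by lra.
rewrite ltr_pdivrMr// ltr_pMr// ltrDl ltr01 => /(_ isT) hq.
have mb p' := @box_measurable R d p'.
have qp : box (q (r / 2)) `<=` box p `&` shift_set z (box p).
  move=> x qx; rewrite shift_set_box; split=> i; have := qx i; have := coord_le_norm z i;
  rewrite !mxE ler_norml => /andP[h1 h2] /andP[h3 h4]; apply/andP; split; lra.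
have pq : box (q (r / 2)) `<=` box p by move=> x /qp[].
apply: (@le_lt_trans _ _ (mu (box p `\` box (q (r / 2))))).
  by apply: le_lebesgue_outer => x [px nx]; split=> // /qp[_ /nx].
have bE p' : mu (box p') = (box_volume p')%:E := lebesgue_outer_box d0 p'.
have poo : (mu (box p) < +oo)%E by rewrite [X in (X < _)%E](bE p) ltry.
rewrite (measureD (mb _) (mb _) poo) (setIidr pq).
rewrite [X in (X - _)%E](bE p) [X in (_ - X)%E](bE (q (r / 2))) -EFinB lte_fin.
exact: le_lt_trans (ler_norm _) hq.
Qed.

End translation.

Section shifted_exponentials.
Context (R : realType) (d : nat).
Local Notation mu := (@lebesgue_measure_Rn R d).
Implicit Types (E F : set 'rV[R]_d) (z l : 'rV[R]_d).

Lemma cintegrable_L2 E (f : 'rV[R]_d -> R[i]^o) : measurable (E : set (lebesgueRn R d)) ->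
  bounded_set E -> in_L2 E f -> cintegrable E f.
Proof.
move=> mE bE f2; have := integrable_mul_conj mE f2 (L2_exponential mE bE 0).
have e1 x : f x * conjc (exponential 0 x) = f x by rewrite exponential0 conjc1 mulr1.
rewrite (_ : (fun x => _) = (EFin \o (fun x => complex.Re (f x)))).
  rewrite (_ : (fun x => _) = (EFin \o (fun x => complex.Im (f x)))); first by [].
  by apply/funext => x; rewrite e1.
by apply/funext => x; rewrite e1.
Qed.

Lemma expint_setID E F l : measurable (E : set (lebesgueRn R d)) ->
  measurable (F : set (lebesgueRn R d)) -> bounded_set E ->
  expint E l = expint (E `&` F) l + expint (E `\` F) l.
Proof.
move=> mE mF bE; have [ir ii] := cintegrable_L2 mE bE (L2_exponential mE bE l).
have m1 := measurableI _ _ mE mF; have m2 := measurableD mE mF.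
have dis : [disjoint E `&` F & E `\` F]%classic.
  by apply/disj_setPS => x [[_ Fx] [_ nFx]]; exact: nFx Fx.
have key (g : 'rV[R]_d -> R) : mu.-integrable E (EFin \o g) ->
    \int[mu]_(x in E) g x = \int[mu]_(x in E `&` F) g x + \int[mu]_(x in E `\` F) g x.
  move=> ig; rewrite -[in LHS](setUIDK E F); apply: (Rintegral_setU m1 m2 _ dis).
  by rewrite setUIDK.
by rewrite /expint /complex_integral (key _ ir) (key _ ii).
Qed.

Lemma expint_shift z E l : measurable (E : set (lebesgueRn R d)) -> bounded_set E ->
  expint (shift_set z E) l = cis (euclid_dot l z) * expint E l.
Proof.
move=> mE bE; have hd := semi_inner_L2 mE; have L2e a := L2_exponential mE bE a.
have shE : (fun x => exponential l (x + z)) = cis (euclid_dot l z) *: (exponential l : _ -> R[i]^o).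
  by apply/funext => x; rewrite fctE exponentialE euclid_dotDr cisD mulrC.
have intE (f : 'rV[R]_d -> R[i]^o) : complex_integral E f = L2_dot E f (exponential 0).
  by congr complex_integral; apply/funext => x; rewrite exponential0 conjc1 mulr1.
have ci : cintegrable E (fun x => exponential l (x + z)).
  by rewrite shE; exact: (cintegrable_L2 mE bE (subspaceZ hd _ (L2e l))).
rewrite /expint (complex_integral_shift mE (measurable_exponential l measurableT) ci).
by rewrite shE !intE (dotZl hd _ (L2e l) (L2e 0)).
Qed.

(** The common part of [E] and its translate cancels, and the part of the translate outside [E] is
    itself a translate of a subset of [E]. Only subsets of [E] remain on the right, so for [E = Om]
    Bessel's inequality applies to them. *)
Lemma expint_difference z E l : measurable (E : set (lebesgueRn R d)) -> bounded_set E ->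
  expint E l * (1 - cis (euclid_dot l z)) =
  expint (E `\` shift_set z E) l - cis (euclid_dot l z) * expint (E `\` shift_set (- z) E) l.
Proof.
move=> mE bE; have mz w := measurable_shift_set w mE.
have bS : bounded_set (E `\` shift_set (- z) E).
  have [T [Tr hT]] := bE; exists T; split=> // x Tx y [Ey _]; exact: hT Tx _ Ey.
have mS := measurableD mE (mz (- z)).
have bsh : bounded_set (shift_set z E).
  have [T [_ hT]] := bounded_setP bE; exists (T + `|z|); split; first exact: num_real.
  move=> M TM x Ex; apply: le_trans (ltW TM); rewrite -[x in leLHS](subrK z).
  exact: le_trans (ler_normD _ _) (lerD (hT _ Ex) (lexx _)).
rewrite mulrBr mulr1 [in X in X - _ = _](expint_setID l mE (mz z) bE).
rewrite -(expint_shift z l mS bS) [_ * cis _]mulrC -(expint_shift z l mE bE).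
rewrite (expint_setID l (mz z) mE bsh) setIC.
rewrite (_ : shift_set z E `\` E = shift_set z (E `\` shift_set (- z) E)); first by ring.
by apply/seteqP; split=> x; rewrite /shift_set /= opprK subrK.
Qed.

Definition cutoff E l : 'rV[R]_d -> R[i]^o := fun x => cindic E x * exponential l x.

Lemma cutoff_patch E l x : cutoff E l x = if x \in E then exponential l x else 0.
Proof. by rewrite /cutoff /cindic indicE; case: (x \in E); rewrite ?mul1r ?mul0r. Qed.

Context (Om : set 'rV[R]_d) (dOm : domain Om).

Lemma L2_cutoff E l : measurable (E : set (lebesgueRn R d)) -> in_L2 Om (cutoff E l).
Proof.
move=> mE; have [bOm mOm _] := dOm; apply: (L2_bounded mOm bOm).
  exact: (measurable_mul (measurable_cindic _ mE) (measurable_exponential _ mOm)).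
by exists 1 => x _; rewrite cutoff_patch; case: ifP => _; rewrite ?sqnorm_exponential ?sqnorm0.
Qed.

Lemma dot_cutoff E F l l' : measurable (E : set (lebesgueRn R d)) ->
  measurable (F : set (lebesgueRn R d)) -> E `&` F `<=` Om ->
  L2_dot Om (cutoff E l) (cutoff F l') = expint (E `&` F) (l - l').
Proof.
move=> mE mF EO.
have EI : E `&` F = Om `&` (E `&` F) by apply/seteqP; split=> x; [move=> h; split=> //; exact: EO|case].
have pE x : cutoff E l x * conjc (cutoff F l' x) = if x \in E `&` F then exponential (l - l') x else 0.
  rewrite in_setI !cutoff_patch; case: (x \in E); case: (x \in F) => /=; rewrite ?mul0r//.
    by rewrite exponentialD exponentialN.
  by rewrite raddf0 mulr0.
rewrite /expint /L2_dot /complex_integral EI !Rintegral_mkcondr; congr Complex;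
  by apply: eq_Rintegral => x _; rewrite pE /patch; case: (x \in _).
Qed.

Lemma cutoffT l : cutoff setT l = exponential l.
Proof. by apply/funext => x; rewrite cutoff_patch in_setT. Qed.

Lemma dot_cutoff_exponential E l l' : measurable (E : set (lebesgueRn R d)) ->
  E `<=` Om -> L2_dot Om (cutoff E l) (exponential l') = expint E (l - l').
Proof. by move=> mE EO; rewrite -cutoffT dot_cutoff ?setIT//; exact: measurableT. Qed.

Lemma nsq_cutoff E l : measurable (E : set (lebesgueRn R d)) -> E `<=` Om ->
  nsq (@L2_dot R d Om) (cutoff E l) = volume E.
Proof.
move=> mE EO; have [bOm mOm _] := dOm.
rewrite /nsq dot_cutoff// ?setIid// subrr expint0//.
exact: le_lt_trans (le_lebesgue_outer EO) (bounded_lty bOm).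
Qed.

(** Bessel for an exponential cut off to [E]: the transform of a set of small measure has a small
    square sum along every translate of the spectrum, uniformly in [l]. *)
Lemma bessel_expint Lam E l (s : seq 'rV[R]_d) : orthogonal_exponentials Lam Om ->
  measurable (E : set (lebesgueRn R d)) -> E `<=` Om -> uniq s -> (forall x, x \in s -> Lam x) ->
  \sum_(x <- s) sqnorm (expint E (l - x)) <= volume Om * volume E.
Proof.
move=> oL mE EO us sL; have [bOm mOm v0] := dOm.
rewrite -(nsq_cutoff l mE EO) (eq_bigr _ (fun x _ => congr1 (@sqnorm R) (esym (dot_cutoff_exponential l x mE EO)))).
exact: (bessel (domain_semi_inner dOm) v0 (fun l (_ : Lam l) => domain_exponential l dOm)
  (fun l _ => nsq_exponential mOm bOm l) oL (L2_cutoff l mE) us sL).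
Qed.

End shifted_exponentials.

(** * Uniform tails and weak limits of spectra *)

Section tail.
Context (R : realType) (d : nat).
Local Notation mu := (@lebesgue_measure_Rn R d).
Implicit Types (E F : set 'rV[R]_d) (z l : 'rV[R]_d).

Lemma box_union_shift_small s (e : R) : 0 < e -> exists2 del : R, 0 < del &
  forall z, `|z| < del -> (mu (box_union s `\` shift_set z (box_union s)) < e%:E)%E.
Proof.
elim: s e => [|p s IH] e e0.
  exists 1 => // z _; rewrite (_ : _ `\` _ = set0) ?measure0 ?lte_fin//.
  by apply/seteqP; split=> x // [[]].
have e2 : 0 < e / 2 by lra.
have [d1 d10 h1] := IH _ e2; have [d2 d20 h2] := box_shift_small p e2.
exists (Num.min d1 d2) => [|z]; first by rewrite lt_min d10.
rewrite lt_min => /andP[/h1 l1 /h2 l2].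
apply: (@le_lt_trans _ _ (mu (box_union s `\` shift_set z (box_union s)) +
  mu (box p `\` shift_set z (box p)))%E); last first.
  by rewrite [X in (_ < X%:E)%E](splitr e) EFinD; exact: lteD.
apply: (le_trans _ (outer_measureU2 (@lebesgue_outer R d) _ _)).
apply: le_lebesgue_outer => x [[q /=]]; rewrite inE => /predU1P[->|qs] qx nx.
  by right; split=> // px; apply: nx; exists p; rewrite //= mem_head.
left; split; first by exists q.
by move=> [r /= rs rx]; apply: nx; exists r; rewrite //= inE rs orbT.
Qed.

Lemma measurable_shift_small E (e : R) : measurable (E : set (lebesgueRn R d)) ->
  (mu E < +oo)%E -> 0 < e -> exists2 del : R, 0 < del &
  forall z, `|z| < del -> (mu (E `\` shift_set z E) < e%:E)%E.
Proof.
move=> mE Eoo e0; have e3 : 0 < e / 3 by lra.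
have [s [s1 s2]] := box_union_approx mE Eoo e3; have [del del0 h] := box_union_shift_small s e3.
exists del => // z /h hz; set U := box_union s in s1 s2 hz.
apply: (@le_lt_trans _ _ (mu (E `\` U) + (mu (U `\` shift_set z U) + mu (shift_set z (U `\` E))))%E).
  apply: (le_trans _ (leeD (lexx _) (outer_measureU2 (@lebesgue_outer R d) _ _))).
  apply: (le_trans _ (outer_measureU2 (@lebesgue_outer R d) _ _)).
  apply: le_lebesgue_outer => x [Ex nEx]; have [Ux|] := pselect (U x); last by left.
  by right; have [Uz|nU] := pselect (U (x - z)); [right|left].
have -> : mu (shift_set z (U `\` E)) = mu (U `\` E) := lebesgue_outer_shift z (U `\` E).
rewrite (_ : e = e / 3 + (e / 3 + e / 3)); last by lra.
by rewrite !EFinD; apply: lteD => //; apply: lteD.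
Qed.

Context (Om : set 'rV[R]_d) (dOm : domain Om) (Lam : set 'rV[R]_d).
Hypothesis oL : orthogonal_exponentials Lam Om.

(** The second factor is the squared modulus of [1 - cis], so by [expint_difference] the summands
    come from the transforms of [Om] minus its translates by [z] and by [- z]. These sets are thin
    for small [z], and Bessel bounds the sum by their measures, independently of [a]. *)
Lemma oscillation_small (e : R) : 0 < e -> exists2 del : R, 0 < del &
  forall z a s, `|z| < del -> uniq s -> (forall l, l \in s -> Lam l) ->
  \sum_(l <- s) sqnorm (expint Om (a - l)) * (2 - 2 * cos (2 * pi * euclid_dot (a - l) z)) <= e.
Proof.
(* Two thin sets, each with the factor 2 of [sqnormD_le] and the factor [volume Om] of Bessel. *)
move=> e0; have [bOm mOm v0] := dOm; have e4 : 0 < e / (4 * volume Om).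
  by apply: divr_gt0 => //; apply: mulr_gt0.
have [del del0 h] := measurable_shift_small mOm (bounded_lty bOm) e4.
exists del => // z a s zd us sL.
have vD w : `|w| < del -> volume (Om `\` shift_set w Om) <= e / (4 * volume Om).
  move=> /h hw; rewrite -lee_fin (volumeE bOm); first exact: ltW.
  by move=> x [].
have mD w := measurableD mOm (measurable_shift_set w mOm).
have bs w := bessel_expint dOm a oL (mD w) (@subDsetl _ Om (shift_set w Om)) us sL.
apply: (@le_trans _ _ (\sum_(l <- s) 2 * (sqnorm (expint (Om `\` shift_set z Om) (a - l)) +
    sqnorm (expint (Om `\` shift_set (- z) Om) (a - l))))).
  apply: ler_sum => l _; have := sqnorm_cisB 0 (euclid_dot (a - l) z).
  rewrite cis0 sub0r mulrN cosN => <-; rewrite -sqnormM expint_difference//.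
  apply: (le_trans (sqnormD_le _ _)); rewrite -mulN1r !sqnormM sqnorm_cis.
  by rewrite /sqnorm /=; lra.
rewrite -mulr_sumr big_split /=.
have b1 := le_trans (bs z) (ler_wpM2l (ltW v0) (vD z zd)).
have b2 := le_trans (bs (- z)) (ler_wpM2l (ltW v0) (vD (- z) ltac:(by rewrite normrN))).
move: b1 b2; rewrite [volume Om * (e / _)](_ : _ = e / 4); last by field; rewrite gt_eqF.
lra.
Qed.

Lemma euclid_dot_delta (a : 'rV[R]_d) i t : euclid_dot a (t *: delta_mx 0 i) = t * a ord0 i.
Proof.
rewrite /euclid_dot (bigD1 i)//= !mxE !eqxx big1 => [|j ji]; first by rewrite mulr1 addr0 mulrC.
by rewrite !mxE eqxx (negbTE ji) mulr0 mulr0.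
Qed.

(* Averaging the previous bound over the segment of all [t e_i], by the mean
   value theorem. *)
Lemma coordinate_tail i (e : R) : 0 < e -> exists2 r : R, 0 < r &
  forall a s, uniq s -> (forall l, l \in s -> Lam l) ->
  (forall l, l \in s -> r <= `|(a - l) ord0 i|) -> \sum_(l <- s) sqnorm (expint Om (a - l)) <= e.
Proof.
move=> e0; have [del del0 h] := oscillation_small e0; have pi0 := pi_gt0 R.
pose s0 := del / 2; have s00 : 0 < s0 by rewrite /s0; lra.
(* At this distance the sine term in the primitive [F] at [s0] costs each weight at most [s0], half
   of [2 * s0], so [F s0] is at least [s0] times the sum to be bounded. *)
exists (pi * s0)^-1 => [|a s us sL hs]; first by rewrite invr_gt0 mulr_gt0.
pose w l := sqnorm (expint Om (a - l)); pose x l := (a - l) ord0 i.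
have xn0 l : l \in s -> 2 * pi * x l != 0.
  move=> ls; rewrite mulf_neq0//; first by rewrite gt_eqF// mulr_gt0.
  by rewrite -normr_gt0; apply: lt_le_trans (hs l ls); rewrite invr_gt0 mulr_gt0.
pose F t := \sum_(l <- s) w l * (2 * t - 2 * (sin (2 * pi * x l * t) / (2 * pi * x l))).
pose f t := \sum_(l <- s) w l * (2 - 2 * cos (2 * pi * x l * t)).
have dF t : is_derive t (1:R) F (f t).
  rewrite /F /f; move: xn0; elim: (s) => [|l s' IH] hx.
    rewrite big_nil; under eq_fun do rewrite big_nil; exact: is_derive_cst.
  rewrite big_cons; under eq_fun do rewrite big_cons.
  apply: is_deriveD; last by apply: IH => l' ls'; apply: hx; rewrite inE ls' orbT.
  have hl := hx l (mem_head _ _).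
  by apply: is_derive_eq; rewrite !scaler0 add0r /GRing.scale /= !mulr1 [_^-1 * _]mulrC mulfK.
have cF : {within `[0, s0], continuous F}.
  by apply: derivable_within_continuous => t _; case: (dF t).
have [c] := MVT s00 (fun t _ => dF t) cF.
rewrite in_itv/= => /andP[c0 cs]; rewrite subr0 [F 0]big1 => [|l _]; last first.
  by rewrite !mulr0 sin0 mul0r mulr0 subrr mulr0.
rewrite subr0 => Fs0.
have cdel : `|c *: (delta_mx 0 i : 'rV[R]_d)| < del.
  rewrite normrZ ger0_norm ?ltW//; apply: (@le_lt_trans _ _ (c * 1)); last by rewrite mulr1 /s0 in cs *; lra.
  rewrite (ler_wpM2l (ltW c0))// [leLHS]mx_normrE; apply/bigmax_leP; split=> // -[j k] _ /=.
  by rewrite !mxE; case: (_ && _); rewrite ?normr1 ?normr0 ?lexx ?ler01.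
have fc : f c <= e.
  have := h _ a s cdel us sL; congr (_ <= _); apply: eq_bigr => l _.
  by rewrite euclid_dot_delta /x [c * _]mulrC mulrA.
rewrite -(ler_pM2r s00); apply: (@le_trans _ _ (F s0)); last by rewrite Fs0 ler_wpM2r// ltW.
rewrite mulr_suml /F big_seq [leRHS]big_seq; apply: ler_sum => l ls.
rewrite ler_wpM2l ?sqnorm_ge0//.
suff : sin (2 * pi * x l * s0) / (2 * pi * x l) <= s0 / 2 by lra.
apply: (le_trans (ler_norm _)); rewrite normrM normfV.
have xl := hs l ls; rewrite ler_pdivrMr ?normr_gt0 ?xn0//.
have pis : 0 < pi * s0 by apply: mulr_gt0.
rewrite -[(_)^-1]mul1r ler_pdivrMr// in xl.
apply: (@le_trans _ _ 1); first by rewrite ler_norml sin_geN1 sin_le1.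
rewrite 2!normrM (ger0_norm (ltW pi0)) [`|2|]ger0_norm//.
by apply: (le_trans xl); rewrite le_eqVlt; apply/orP; left; apply/eqP; rewrite /x; field.
Qed.

(** A point far from [a] is far in some coordinate, so the coordinate tails are added up. The
    denominator [d + 1] stays positive in dimension 0. *)
Lemma exponential_tail (e : R) : 0 < e -> exists2 r : R, 0 < r &
  forall a s, uniq s -> (forall l, l \in s -> Lam l) -> (forall l, l \in s -> r <= `|a - l|) ->
  \sum_(l <- s) sqnorm (expint Om (a - l)) <= e.
Proof.
move=> e0; have e1 : 0 < e / (d%:R + 1).
  by rewrite divr_gt0// ltr_wpDl.
have /choice[r hr] i : exists r : R, 0 < r /\ forall a s, uniq s -> (forall l, l \in s -> Lam l) ->
    (forall l, l \in s -> r <= `|(a - l) ord0 i|) ->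
    \sum_(l <- s) sqnorm (expint Om (a - l)) <= e / (d%:R + 1).
  by have [r r0 h] := coordinate_tail i e1; exists r.
exists (1 + \sum_i r i) => [|a s us sL hs].
  by apply: ltr_pwDl => //; apply: sumr_ge0 => i _; case: (hr i) => /ltW.
apply: (@le_trans _ _ (\sum_(i < d) \sum_(l <- s | r i <= `|(a - l) ord0 i|) sqnorm (expint Om (a - l)))).
  rewrite (eq_bigr _ (fun i _ => big_mkcond _ _)) exchange_big /= big_seq [leRHS]big_seq.
  apply: ler_sum => l ls; have := hs l ls; rewrite [`|a - l|]mx_normrE => hm.
  have [[i hi]|no] := pselect (exists i, r i <= `|(a - l) ord0 i|).
    rewrite (bigD1 i)//= hi lerDl; apply: sumr_ge0 => j _.
    by case: ifP; rewrite ?sqnorm_ge0.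
  exfalso; move: hm; rewrite leNgt => /negP[].
  apply: (@le_lt_trans _ _ (\sum_i r i)); last by rewrite ltrDr.
  apply/bigmax_leP; split=> [|[j i] _ /=]; first by apply: sumr_ge0 => i _; case: (hr i) => /ltW.
  rewrite (ord1 j) (bigD1 i)//=; apply: (@le_trans _ _ (r i)).
    by rewrite leNgt; apply/negP => /ltW h; apply: no; exists i.
  by rewrite lerDl; apply: sumr_ge0 => k _; case: (hr k) => /ltW.
apply: (@le_trans _ _ (\sum_(i < d) e / (d%:R + 1))).
  apply: ler_sum => i _; rewrite -big_filter; apply: (hr i).2.
  - exact: filter_uniq.
  - by move=> l; rewrite mem_filter => /andP[_ /sL].
  - by move=> l; rewrite mem_filter => /andP[].
rewrite sumr_const card_ord -[leLHS]mulr_natr mulrAC ler_pdivrMr; last by rewrite ltr_wpDl.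
by rewrite mulrDr mulr1 lerDl ltW.
Qed.

End tail.

Section ultralimit.
Context (R : realType) (d : nat) (G : set_system nat) (UG : UltraFilter G).

(** Along an ultrafilter every bounded sequence converges, so all frequencies and phases have limits
    along the same [G], without passing to subsequences. Compactness gives a cluster point, which
    for an ultrafilter is a limit. *)
Lemma ultra_bounded_cvg (u : nat -> 'rV[R]_d) (M : R) : G [set k | `|u k| <= M] ->
  exists x, forall e : R, 0 < e -> G [set k | `|u k - x| < e].
Proof.
move=> GM.
have cB : compact [set v : 'rV[R]_d | forall i, `[- M, M]%classic (v ord0 i)].
  by apply: (@rV_compact _ _ (fun=> `[- M, M]%classic)) => _; exact: segment_compact.
have GB : G [set k | forall i, `[- M, M]%classic (u k ord0 i)].
  apply: (filterS _ GM) => k /= uM i /=; rewrite in_itv/= -ler_norml.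
  exact: le_trans (coord_le_norm _ _) uM.
have [x [_ clx]] := cB (u @ G) (fmap_proper_filter u ultra_proper) GB.
exists x => e e0; have [//|GC] := in_ultra_setVsetC [set k | `|u k - x| < e] UG.
have [v [/= nv]] := clx [set v | ~ `|v - x| < e] _ GC (nbhsx_ballx x e e0).
by rewrite -ball_normE /= distrC.
Qed.

Lemma ultra_pigeonhole (f : nat -> nat) N : G [set k | (f k <= N)%N] ->
  exists n, G [set k | f k = n].
Proof.
elim: N => [|N IH] GN; first by exists 0%N; apply: filterS GN => k /=; case: (f k).
have [|GC] := in_ultra_setVsetC [set k | f k = N.+1] UG; first by exists N.+1.
apply: IH; apply: filterS2 GN GC => k /= h /eqP fN.
by rewrite -ltnS ltn_neqAle fN.
Qed.

End ultralimit.

Section separated.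
Context (R : realType) (d : nat) (del : R) (del0 : 0 < del).
Implicit Types (x y : 'rV[R]_d).

Definition separated (S : set 'rV[R]_d) := forall x y, S x -> S y -> `|x - y| < del -> x = y.

Definition cell x : {ffun 'I_d -> int} := [ffun i => Num.floor (x ord0 i / del)].

Lemma cell_close x y : cell x = cell y -> `|x - y| < del.
Proof.
move=> xy; rewrite [ltLHS]mx_normrE; apply/bigmax_ltP; split=> // -[j i] _ /=.
rewrite (ord1 j) !mxE -(ltr_pM2r (x := del^-1)) ?invr_gt0// divff ?gt_eqF//.
rewrite -[X in _ * X]ger0_norm ?invr_ge0 ?ltW// -normrM mulrBl.
have := congr1 (fun f : {ffun 'I_d -> int} => f i) xy; rewrite !ffunE => e.
have := floor_itv (x ord0 i / del); have := floor_itv (y ord0 i / del); rewrite e.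
move=> /andP[h1 h2] /andP[h3 h4]; rewrite ltr_norml; move: h2 h4; rewrite intrD; lra.
Qed.

Lemma separated_countable S : separated S -> countable S.
Proof.
move=> sS; apply/countable_injP; exists (fun x => pickle (cell x)) => x y /set_mem Sx /set_mem Sy.
by move=> /(pcan_inj pickleK) /cell_close; exact: sS.
Qed.

(** Pigeonhole on the cells of a grid of mesh [del]; adding [M] makes the cell indices natural
    numbers. A bound independent of [b] is what weak limits call for, since there the centre runs to
    infinity. *)
Lemma separated_count S (r : R) : separated S -> exists N, forall b s, uniq s ->
  (forall x, x \in s -> S x /\ `|x - b| < r) -> (size s <= N)%N.
Proof.
move=> sS; pose M := `|Num.ceil (`|r| / del)|%N.+1.
exists #|{ffun 'I_d -> 'I_(M + M).+1}| => b s us hs.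
pose g x : {ffun 'I_d -> 'I_(M + M).+1} := [ffun i => inord (absz (cell (x - b) i + M%:Z))].
have range x i : `|x - b| < r -> - M%:Z <= cell (x - b) i < M%:Z.
  move=> xr; have := le_lt_trans (coord_le_norm (x - b) i) (lt_le_trans xr (ler_norm r)).
  have := Num.Theory.ceil_itv (`|r| / del).
  rewrite ffunE => /andP[_ rM] xbr.
  have i0 : 0 < del^-1 by rewrite invr_gt0.
  have : `|(x - b) ord0 i / del| < `|r| / del.
    by rewrite normrM [`|del^-1|]ger0_norm ?(ltW i0)// ltr_pM2r.
  rewrite ltr_norml => /andP[h1 h2].
  have cM : Num.ceil (`|r| / del) < M%:Z.
    by rewrite /M -addn1 PoszD ltzD1 lez_abs.
  have rM2 : `|r| / del < M%:~R.
    by apply: (le_lt_trans rM); rewrite ltr_int.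
  apply/andP; split; last by rewrite floor_lt_int; exact: lt_trans h2 _.
  by rewrite floor_ge_int rmorphN/=; apply: ltW; apply: le_lt_trans h1; rewrite lerN2 ltW.
have ginj : {in s &, injective g}.
  move=> x y xs ys gxy; have [Sx xr] := hs x xs; have [Sy yr] := hs y ys.
  apply: sS => //; rewrite (_ : x - y = (x - b) - (y - b)); last by rewrite opprB addrA subrK.
  apply: cell_close; apply/ffunP => i.
  have := congr1 (fun f : {ffun 'I_d -> 'I_(M + M).+1} => val (f i)) gxy.
  have /andP[x1 x2] := range x i xr; have /andP[y1 y2] := range y i yr.
  rewrite /= [g x i]ffunE [g y i]ffunE; move: (cell _ i) (cell (y - b) i) x1 x2 y1 y2 => p q.
  by move=> x1 x2 y1 y2; rewrite !inordK; lia.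
rewrite -(size_map g); apply: (leq_trans _ (max_card (mem (map g s)))).
by rewrite (card_uniqP _)// map_inj_in_uniq.
Qed.

End separated.

Section weak_limit.
Context (R : realType) (d : nat) (Om : set 'rV[R]_d) (dOm : domain Om).
Implicit Types (x l : 'rV[R]_d) (Lam : set 'rV[R]_d).

(** The transform of [Om] does not vanish near 0. As [del] depends on [Om] only, the same gap serves
    for a spectrum and for its weak limits. *)
Lemma orthogonal_separated : exists2 del : R, 0 < del &
  forall Lam, orthogonal_exponentials Lam Om -> separated del Lam.
Proof.
have [bOm mOm v0] := dOm; have n0 := domain_expint0_neq0 dOm; rewrite -sqnorm_gt0 in n0.
have [del del0 h] := expint_continuous mOm bOm n0; exists del => // Lam oL x y Lx Ly xy.
apply: contrapT => nxy; have := h (x - y) 0 ltac:(by rewrite subr0).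
by rewrite -L2_dot_exponential oL// sub0r -mulN1r sqnormM {1}/sqnorm /= sqrrN expr1n oppr0 expr0n addr0 mul1r ltxx.
Qed.

Lemma sqnorm_expint_continuous (e : R) : 0 < e -> exists2 del : R, 0 < del &
  forall l l', `|l - l'| < del -> sqnorm (expint Om l) <= sqnorm (expint Om l') + e.
Proof.
move=> e0; have [bOm mOm v0] := dOm; set v := volume Om in v0.
(* In [|z|^2 <= (1 + t) |w|^2 + (1 + 1/t) |z - w|^2] with [|w| <= v], this [t] spends half of [e] on
   [w] and leaves the other half for [z - w]. *)
pose t := e / (2 * v ^+ 2); have v20 : 0 < v ^+ 2 by rewrite exprn_gt0.
have t0 : 0 < t by rewrite divr_gt0// mulr_gt0.
have t1 : 0 < 1 + t^-1 by rewrite addr_gt0// invr_gt0.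
have [del del0 h] := expint_continuous mOm bOm (divr_gt0 e0 (mulr_gt0 (ltr0n R 2) t1)).
exists del => // l l' /h; set z := expint Om l; set w := expint Om l' => zw.
have wv : sqnorm w <= v ^+ 2 := sqnorm_expint_le mOm bOm l'.
have key : sqnorm z <= (1 + t) * sqnorm w + (1 + t^-1) * sqnorm (z - w).
  move: (z) (w) => [a b] [a' b']; rewrite /sqnorm /= -subr_ge0.
  rewrite [leRHS](_ : _ = t^-1 * ((t * a' - (a - a')) ^+ 2 + (t * b' - (b - b')) ^+ 2)).
    by rewrite mulr_ge0 ?invr_ge0 ?(ltW t0)// addr_ge0// sqr_ge0.
  by field; rewrite gt_eqF.
apply: (le_trans key); rewrite mulrDl mul1r -addrA lerD2l.
have k1 : t * sqnorm w <= e / 2.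
  apply: (le_trans (ler_wpM2l (ltW t0) wv)).
  by rewrite /t le_eqVlt; apply/orP; left; apply/eqP; field; rewrite gt_eqF.
have k2 : (1 + t^-1) * sqnorm (z - w) <= e / 2.
  by rewrite mulrC -ler_pdivlMr// -mulrA -invfM ltW.
lra.
Qed.

Context (G : set_system nat) (UG : UltraFilter G) (a : nat -> 'rV[R]_d).

Definition weak_limit Lam : set 'rV[R]_d :=
  [set x | forall e : R, 0 < e -> G [set k | exists2 l, Lam l & `|l - a k - x| < e]].

(** Translations cancel in differences, so a closed condition on the differences of a spectrum
    passes to its weak limit. This preserves the relations won for earlier edges while the next edge
    is treated. *)
Lemma weak_limit_pairs Lam (P : set 'rV[R]_d) :
  (forall x, (forall e : R, 0 < e -> exists2 y, P y & `|y - x| < e) -> P x) ->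
  (forall l l', Lam l -> Lam l' -> P (l - l')) ->
  forall x x', weak_limit Lam x -> weak_limit Lam x' -> P (x - x').
Proof.
move=> cP hP x x' lx lx'; apply: cP => e e0; have e2 : 0 < e / 2 by lra.
have [k [[l Ll lk] [l' Ll' lk']]] := filter_ex (filterI (lx _ e2) (lx' _ e2)).
exists (l - l'); first exact: hP.
rewrite (_ : _ - _ = (l - a k - x) - (l' - a k - x')); last first.
  by apply/rowP => i; rewrite !mxE; ring.
by apply: (le_lt_trans (ler_normB _ _)); rewrite [ltRHS]splitr ltrD.
Qed.

Lemma weak_limit_orthogonal Lam : orthogonal_exponentials Lam Om ->
  orthogonal_exponentials (weak_limit Lam) Om.
Proof.
move=> oL x x' lx lx' xx'; rewrite L2_dot_exponential; have [bOm mOm v0] := dOm.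
apply/eqP; rewrite -sqnorm_eq0 eq_le sqnorm_ge0 andbT; apply/ler_addgt0Pr => e e0; rewrite add0r.
have [del del0 h] := sqnorm_expint_continuous e0.
(* The second bound forces the two approximating frequencies to be distinct. *)
pose r := Num.min del `|x - x'|.
have r0 : 0 < r by rewrite lt_min del0 normr_gt0 subr_eq0; apply/eqP.
have r2 : 0 < r / 2 by lra.
have [k [[l Ll lk] [l' Ll' lk']]] := filter_ex (filterI (lx _ r2) (lx' _ r2)).
have close : `|(x - x') - (l - l')| < r.
  rewrite distrC (_ : _ - _ = (l - a k - x) - (l' - a k - x')); last first.
    by apply/rowP => i; rewrite !mxE; ring.
  by apply: (le_lt_trans (ler_normB _ _)); rewrite [ltRHS]splitr ltrD.
move: close; rewrite lt_min => /andP[cd cx].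
have ll' : l <> l' by move=> e'; move: cx; rewrite e' subrr subr0 ltxx.
by have := h _ _ cd; rewrite -(L2_dot_exponential Om l l') oL// sqnorm0 add0r.
Qed.

(** Parseval for [exponential (b + a k)] passes to the limit because the uniform tail bound leaves
    only a bounded number of frequencies near [b + a k]; these converge along [G] and stay distinct
    by separation. The three thirds of [e] pay for Parseval, for the tail and for the limit of a
    finite sum. *)
Lemma weak_limit_complete Lam : orthogonal_exponentials Lam Om ->
  complete_exponentials Lam Om -> complete_exponentials (weak_limit Lam) Om.
Proof.
move=> oL cL; have [bOm mOm v0] := dOm; have oW := weak_limit_orthogonal oL.
have hd := domain_semi_inner dOm; have LW := fun l (_ : weak_limit Lam l) => domain_exponential l dOm.
have nW := fun l (_ : weak_limit Lam l) => nsq_exponential mOm bOm l.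
have LL := fun l (_ : Lam l) => domain_exponential l dOm.
have nL := fun l (_ : Lam l) => nsq_exponential mOm bOm l.
apply: (complete_of_total dOm cL) => b _.
apply: (cspan_parseval hd v0 LW nW oW (@subset_refl _ _) (domain_exponential b dOm)) => e e0.
have e3 : 0 < e / 3 by lra.
have [r r0 tail] := exponential_tail dOm oL e3.
have [del del0 sep] := orthogonal_separated; have [N cnt] := separated_count del0 r (sep _ oL).
have P k : exists s, [/\ uniq s, (forall l, l \in s -> Lam l /\ `|l - (b + a k)| < r) &
    volume Om * volume Om - e / 3 - e / 3 < \sum_(l <- s) sqnorm (expint Om (b + a k - l))].
  have Lb := domain_exponential (b + a k) dOm.
  have [s [us sL]] := parseval hd v0 LL nL oL (@subset_refl _ _) Lb
    ((complete_exponentialsP Lam dOm).1 cL _ Lb) e3.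
  rewrite nsq_exponential// => hs.
  exists [seq l <- s | `|l - (b + a k)| < r]; split; first exact: filter_uniq.
    by move=> l; rewrite mem_filter => /andP[lr /sL Ll].
  rewrite big_filter ltrBlDr; apply: (lt_le_trans hs).
  rewrite (bigID (fun l => `|l - (b + a k)| < r)) /=.
  rewrite (eq_bigr _ (fun l _ => congr1 (@sqnorm R) (L2_dot_exponential Om (b + a k) l))) lerD2l.
  rewrite (eq_bigr _ (fun l _ => congr1 (@sqnorm R) (L2_dot_exponential Om (b + a k) l))).
  rewrite -big_filter; apply: tail; first exact: filter_uniq.
    by move=> l; rewrite mem_filter => /andP[_ /sL].
  by move=> l; rewrite mem_filter -leNgt distrC => /andP[].
have [s hs] := choice P.
(* The number of nearby frequencies is bounded, hence constant on a set of [G]; their [i]-th ones,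
   translated back, then have a limit [x i]. *)
have [n Gn] : exists n, G [set k | size (s k) = n].
  apply: (@ultra_pigeonhole _ UG _ N); apply: (filterS _ filterT) => k _ /=.
  by have [us sL _] := hs k; exact: cnt us sL.
pose u i k := nth 0 (s k) i - a k.
have sn i k : (i < n)%N -> size (s k) = n -> Lam (nth 0 (s k) i) /\ `|nth 0 (s k) i - (b + a k)| < r.
  by move=> ilt sk; have [_ sL _] := hs k; apply: sL; rewrite mem_nth ?sk.
have /choice[x hx] i : exists x, (i < n)%N -> forall e : R, 0 < e -> G [set k | `|u i k - x| < e].
  case: (ltnP i n) => [ilt|_]; last by exists 0.
  have [|x hx] := ultra_bounded_cvg UG (u := u i) (M := `|b| + r); last by exists x.
  apply: filterS Gn => k /= sk; have [_ hr] := sn i k ilt sk.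
  rewrite /u (_ : _ - a k = b + (nth 0 (s k) i - (b + a k))); last first.
    by apply/rowP => j; rewrite !mxE; ring.
  by apply: (le_trans (ler_normD _ _)); rewrite lerD2l ltW.
exists [seq x i | i <- iota 0 n]; split.
(* Equal limits would put two distinct frequencies of some [s k] closer than [del]. *)
- rewrite map_inj_in_uniq ?iota_uniq// => i j; rewrite !mem_iota !add0n /= => ilt jlt xij.
  have d2 : 0 < del / 2 by lra.
  have [k [[/= sk hi] hj]] := filter_ex (filterI (filterI Gn (hx i ilt _ d2)) (hx j jlt _ d2)).
  have [us _ _] := hs k; apply/eqP; rewrite -(nth_uniq 0 _ _ us) ?sk//; apply/eqP.
  apply: (sep _ oL _ _ (sn i k ilt sk).1 (sn j k jlt sk).1).
  rewrite (_ : _ - _ = (u i k - x i) - (u j k - x j)); last first.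
    by rewrite xij /u; apply/rowP => m; rewrite !mxE; ring.
  by apply: (le_lt_trans (ler_normB _ _)); rewrite [ltRHS]splitr ltrD.
- move=> _ /mapP[i + ->]; rewrite mem_iota add0n /= => ilt e' e'0.
  apply: filterS2 Gn (hx i ilt _ e'0) => k /= sk hk.
  by exists (nth 0 (s k) i) => //; exact: (sn i k ilt sk).1.
have en : 0 < e / 3 / (n%:R + 1) by rewrite divr_gt0// ltr_wpDl.
have [del' del'0 hc] := sqnorm_expint_continuous en.
have near_all m : (m <= n)%N -> G [set k | forall i, (i < m)%N -> `|u i k - x i| < del'].
  elim: m => [_|m IH mn]; first by apply: (filterS _ filterT) => k _ i.
  apply: filterS2 (IH (ltnW mn)) (hx m mn _ del'0) => k /= h1 h2 i.
  by rewrite ltnS leq_eqVlt => /predU1P[->|/h1].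
have [k [/= sk hk]] := filter_ex (filterI Gn (near_all n (leqnn n))).
have [_ _] := hs k; rewrite (big_nth 0) sk /index_iota subn0 => hsum.
rewrite nsq_exponential// big_map.
apply: (@lt_le_trans _ _ (\sum_(i <- iota 0 n) (sqnorm (expint Om (b + a k - nth 0 (s k) i)) - e / 3 / (n%:R + 1)))).
  rewrite big_split /= sumrN big_const_seq count_predT size_iota iter_addr_0.
  have : (e / 3 / (n%:R + 1)) *+ n <= e / 3.
    rewrite -[leLHS]mulr_natr mulrAC ler_pdivrMr; last by rewrite ltr_wpDl.
    by rewrite mulrDr mulr1 lerDl ltW.
  by move: (_ *+ n) => t ht; move: hsum; lra.
rewrite big_seq [leRHS]big_seq; apply: ler_sum => i; rewrite mem_iota add0n /= => ilt.
rewrite L2_dot_exponential lerBlDr; apply: hc.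
rewrite (_ : _ - _ = - (u i k - x i)) ?normrN; first exact: hk.
by rewrite /u; apply/rowP => j; rewrite !mxE; ring.
Qed.

Lemma weak_limit_spectrum Lam : is_spectrum Lam Om -> is_spectrum (weak_limit Lam) Om.
Proof.
move=> [_ oL cL]; have oW := weak_limit_orthogonal oL.
have [del del0 sep] := orthogonal_separated.
split=> //; first exact: (separated_countable del0 (sep _ oW)).
exact: weak_limit_complete.
Qed.

End weak_limit.

(** * Linear maps of the plane and parallelograms *)

Section additive.
Context (R : realType) (f : R -> R).

(** Cauchy's functional equation: nonnegativity makes [f] monotone, and enclosing [n a] between
    consecutive integers bounds [n |f a - a f 1|] by [f 1] for every [n]. *)
Lemma nonneg_additive_linear :
  (forall a b, 0 <= a -> 0 <= b -> f (a + b) = f a + f b) -> (forall a, 0 <= a -> 0 <= f a) ->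
  forall a, 0 <= a -> f a = a * f 1.
Proof.
move=> fD f0 a a0.
have fn n b : 0 <= b -> f (n%:R * b) = n%:R * f b.
  move=> b0; elim: n => [|n IH].
    by have := fD 0 0 (lexx _) (lexx _); rewrite addr0 !mul0r; lra.
  by rewrite -natr1 !mulrDl !mul1r fD ?mulr_ge0// IH.
have fmono x y : 0 <= x -> x <= y -> f x <= f y.
  by move=> x0 xy; rewrite -(subrK x y) [y - x + x]addrC fD ?subr_ge0// lerDl f0// subr_ge0.
have f10 : 0 <= f 1 by exact: f0.
have close n : `|n%:R * (f a - a * f 1)| <= f 1.
  have na0 : 0 <= n%:R * a by rewrite mulr_ge0.
  pose k := Num.truncn (n%:R * a).
  have /andP[k1 k2] : k%:R <= n%:R * a < k.+1%:R by exact: truncn_itv.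
  have h1 := fmono _ _ (ler0n _ k) k1; have h2 := fmono _ _ na0 (ltW k2).
  move: h1 h2; rewrite fn// -[k%:R]mulr1 -[k.+1%:R]mulr1 !fn// -natr1 => h1 h2.
  have h3 := ler_wpM2r f10 k1; have h4 := ler_wpM2r f10 (ltW k2); rewrite -natr1 in h4.
  by rewrite ler_norml; apply/andP; split; lra.
apply/eqP; rewrite -subr_eq0; apply/negPn/negP; rewrite -normr_gt0 => d0.
have := close (Num.truncn (f 1 / `|f a - a * f 1|)).+1.
rewrite normrM ger0_norm//; apply/negP; rewrite -ltNge -ltr_pdivrMr//.
by have /andP[] := truncn_itv (divr_ge0 f10 (ltW d0)).
Qed.

End additive.

Section linear_image.
Context (R : realType).
Local Notation mu := (@lebesgue_measure_Rn R 2).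
Implicit Types (M : 'M[R]_2) (E F : set 'rV[R]_2) (x z : 'rV[R]_2).

Definition linear_image M E : set 'rV[R]_2 := [set x | E (x *m invmx M)].

Lemma linear_imageK M E : M \in unitmx -> linear_image (invmx M) (linear_image M E) = E.
Proof. by move=> uM; apply/seteqP; split=> x; rewrite /linear_image /= invmxK mulmxK. Qed.

Lemma linear_image_shift M z E : M \in unitmx ->
  linear_image M (shift_set z E) = shift_set (z *m M) (linear_image M E).
Proof. by move=> uM; apply/seteqP; split=> x; rewrite /linear_image /shift_set /= mulmxBl mulmxK. Qed.

Lemma linear_image_bounded M E : M \in unitmx -> bounded_set E -> bounded_set (linear_image M E).
Proof.
move=> uM /bounded_setP[T [T0 hT]]; pose K := \sum_i `|row i M|.
exists (T * K); split=> [|S KS x Ex]; first exact: num_real.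
apply: (le_trans _ (ltW KS)); rewrite -[x in leLHS](mulmxKV uM) mulmx_sum_row.
apply: (le_trans (ler_norm_sum _ _ _)); rewrite mulr_sumr; apply: ler_sum => i _.
rewrite normrZ ler_wpM2r//; exact: le_trans (coord_le_norm _ _) (hT _ Ex).
Qed.

Lemma measurable_linear_box M p : measurable (linear_image M (box p) : set (lebesgueRn R 2)).
Proof.
have -> : linear_image M (box p) = \bigcap_(i in [set: 'I_2])
    (euclid_dot (\row_j invmx M j i) @^-1` `]p.1 ord0 i, p.2 ord0 i]%classic).
  have dE x i : euclid_dot (\row_j invmx M j i) x = (x *m invmx M) ord0 i.
    by rewrite mxE; apply: eq_bigr => j _; rewrite mxE mulrC.
  by apply/seteqP; split=> x h i; have := h i; rewrite /= in_itv/= dE => // /(_ I).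
apply: fin_bigcap_measurable => [|i _]; first exact: finite_finset.
by rewrite -[X in measurable X]setTI; apply: measurable_euclid_dot.
Qed.

Definition origin_box (a b : R) : 'rV[R]_2 * 'rV[R]_2 := (0, \row_i (if i == 0 then a else b)).

(** For invertible [M], the absolute value of the determinant. Only its positivity and its role as a
    scaling factor matter, so it is taken directly as a measure. *)
Definition linear_scale M := volume (linear_image M (box (origin_box 1 1))).

Lemma ord2P (P : 'I_2 -> Prop) : P 0 -> P 1 -> forall i, P i.
Proof.
move=> P0 P1 i; have [->//|->//] : i = 0 \/ i = 1.
by case: i => -[|[|//]] i; [left|right]; exact/val_inj.
Qed.

Lemma bounded_box d (p : 'rV[R]_d * 'rV[R]_d) : bounded_set (box p).
Proof.
exists (`|p.1| + `|p.2|); split=> [|S hS x px]; first exact: num_real.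
apply: (le_trans _ (ltW hS)); rewrite [leLHS]mx_normrE; apply/bigmax_leP; split.
  by rewrite addr_ge0.
move=> [j i] _ /=; rewrite (ord1 j); have /andP[h1 h2] := px i.
have := coord_le_norm p.1 i; have := coord_le_norm p.2 i.
have := normr_ge0 p.1; have := normr_ge0 p.2.
move: (`|p.1|) (`|p.2|) => m1 m2 m20 m10; rewrite !ler_norml => /andP[h3 h4] /andP[h5 h6].
by apply/andP; split; lra.
Qed.

Context (M : 'M[R]_2) (uM : M \in unitmx).

Lemma in_origin_box a b x : box (origin_box a b) x <-> 0 < x ord0 0 <= a /\ 0 < x ord0 1 <= b.
Proof.
split=> [h|[h0 h1]]; first by have := h 0; have := h 1; rewrite !mxE.
by apply: ord2P; rewrite !mxE.
Qed.

Lemma volume_linear_box_split p q r z : (forall x, box p x <-> box q x \/ box r (x - z)) ->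
  (forall x, box q x -> ~ box r (x - z)) ->
  volume (linear_image M (box p)) = volume (linear_image M (box q)) + volume (linear_image M (box r)).
Proof.
move=> pE qr; have bo p' := linear_image_bounded uM (@bounded_box _ p').
have fin p' : mu (linear_image M (box p')) \is a fin_num.
  by rewrite ge0_fin_numE ?lebesgue_outer_ge0//; exact: (bounded_lty (bo _)).
have mo p' := measurable_linear_box M p'.
have rE : mu (linear_image M (box r)) = mu (shift_set (z *m M) (linear_image M (box r))).
  by rewrite [RHS]lebesgue_outer_shift.
rewrite /volume -fineD//; congr fine; rewrite [X in (_ + X)%E]rE.
rewrite -(measureU _ (mo q) (measurable_shift_set (z *m M) (mo r))); last first.
  apply/seteqP; split=> x // [h1]; rewrite -linear_image_shift// => h2.
  exact: qr h1 h2.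
congr (mu _); rewrite -linear_image_shift//.
by apply/seteqP; split=> x; rewrite /linear_image /shift_set /=; [move/(pE _)|move=> h; apply/pE].
Qed.

(** As a function of one side, the measure is additive, by cutting the rectangle, and nonnegative,
    hence linear. *)
Lemma volume_linear_origin_box a b : 0 <= a -> 0 <= b ->
  volume (linear_image M (box (origin_box a b))) = a * b * linear_scale M.
Proof.
move=> a0 b0; pose f a b := volume (linear_image M (box (origin_box a b))).
have f0 c e : 0 <= f c e by apply: fine_ge0; exact: lebesgue_outer_ge0.
have f1 c : 0 <= c -> f c b = c * f 1 b.
  apply: (@nonneg_additive_linear _ (f^~ b)) => // s t s0 t0.
  apply: (@volume_linear_box_split _ _ _ (s *: delta_mx 0 0)) => x.
    rewrite !in_origin_box !mxE /= mulr1 mulr0 subr0; split; last by move=> [|] [/andP[? ?] ?]; split=> //; lra.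
    move=> [/andP[? ?] ?]; case: (lerP (x ord0 0) s) => h; [left|right]; split=> //; lra.
  rewrite !in_origin_box !mxE /= mulr1 => -[/andP[? ?] _] [/andP[? ?] _]; lra.
have f2 c : 0 <= c -> f 1 c = c * f 1 1.
  apply: (@nonneg_additive_linear _ (f 1)) => // s t s0 t0.
  apply: (@volume_linear_box_split _ _ _ (s *: delta_mx 0 1)) => x.
    rewrite !in_origin_box !mxE /= mulr1 mulr0 subr0; split; last by move=> [|] [? /andP[? ?]]; split=> //; lra.
    move=> [? /andP[? ?]]; case: (lerP (x ord0 1) s) => h; [left|right]; split=> //; lra.
  rewrite !in_origin_box !mxE /= mulr1 => -[_ /andP[? ?]] [_ /andP[? ?]]; lra.
by rewrite -/(f a b) f1// f2// mulrA.
Qed.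

Lemma lebesgue_outer_linear_box p :
  mu (linear_image M (box p)) = (linear_scale M * box_volume p)%:E.
Proof.
have fin : mu (linear_image M (box p)) = (volume (linear_image M (box p)))%:E.
  by rewrite (volumeE (linear_image_bounded uM (@bounded_box _ p))).
rewrite fin; congr (_%:E).
have [[i hi]|h] := pselect (exists i, p.2 ord0 i <= p.1 ord0 i).
  have -> : box p = set0 by apply/seteqP; split=> // x /(_ i) /andP[h1 h2]; have := lt_le_trans h1 h2; rewrite ltNge hi.
  rewrite /volume [X in fine X]lebesgue_outer0 /box_volume (bigD1 i)//= maxEle.
  by rewrite subr_ge0 leNgt lt_neqAle hi andbT; case: eqP => [->|]; rewrite ?subrr ?mul0r ?mulr0.
have lt i : p.1 ord0 i < p.2 ord0 i by rewrite ltNge; apply/negP => h'; apply: h; exists i.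
pose a := p.2 ord0 0 - p.1 ord0 0; pose b := p.2 ord0 1 - p.1 ord0 1.
have -> : box p = shift_set p.1 (box (origin_box a b)).
  apply/seteqP; split=> x; last first.
    move=> /in_origin_box; rewrite !mxE /a /b => -[/andP[? ?] /andP[? ?]].
    by apply: ord2P; apply/andP; split; lra.
  move=> px; apply/in_origin_box; rewrite !mxE /a /b.
  have /andP[? ?] := px 0; have /andP[? ?] := px 1.
  by split; apply/andP; split; lra.
rewrite linear_image_shift// /volume [X in fine X]lebesgue_outer_shift.
rewrite -/(volume _) volume_linear_origin_box ?subr_ge0 ?ltW//.
rewrite /box_volume big_ord_recl big_ord1 mulrC; congr (_ * (_ * _)).
  by rewrite max_r// subr_ge0 ltW.
rewrite (_ : lift _ _ = 1); last exact/val_inj.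
by rewrite max_r// subr_ge0 ltW.
Qed.

Lemma linear_scale_ge0 : 0 <= linear_scale M.
Proof. by apply: fine_ge0; exact: lebesgue_outer_ge0. Qed.

Lemma le_lebesgue_outer_linear E :
  (mu (linear_image M E) <= (linear_scale M)%:E * mu E)%E.
Proof.
apply: (le_mul_lebesgue_outer linear_scale_ge0) => C [cC EC].
apply: (@le_trans _ _ (mu (\bigcup_(p in C) linear_image M (box p)))).
  by apply: le_lebesgue_outer => x /EC[p Cp px]; exists p.
apply: (le_trans (lebesgue_outer_bigcup _ cC)).
rewrite (eq_esum (fun p _ => lebesgue_outer_linear_box p)).
rewrite (eq_esum (fun p _ => EFinM _ _)).
by apply: (esum_mulr_le _ linear_scale_ge0) => p; exact: box_volume_ge0.
Qed.

(** The covering bound holds for [E] and for its complement in a cube, while the cube attains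
    equality; so both bounds are equalities. This case fixes the scale of the inverse map, from
    which the statement for all sets follows. *)
Lemma lebesgue_outer_linear_bounded E : measurable (E : set (lebesgueRn R 2)) -> bounded_set E ->
  mu (linear_image M E) = ((linear_scale M)%:E * mu E)%E.
Proof.
move=> mE /bounded_setP[T [T0 hT]]; apply/eqP; rewrite eq_le le_lebesgue_outer_linear /=.
pose Q := (cube (T + 1) : set 'rV[R]_2).
have [p pQ] : exists p, Q = box p by exists (const_mx (- (T + 1)), const_mx (T + 1)).
have EQ : E `<=` Q by move=> x /hT xT; apply: in_cube; lra.
have bQ : bounded_set Q by rewrite pQ; exact: bounded_box.
have mQ : measurable (Q : set (lebesgueRn R 2)) by rewrite pQ; exact: box_measurable.
have mD := measurableD mQ mE.
have c0 := linear_scale_ge0; set c := linear_scale M in c0 *.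
have bl := linear_image_bounded uM bQ.
have EQl : linear_image M E `<=` linear_image M Q by move=> x; exact: EQ.
have DQl : linear_image M (Q `\` E) `<=` linear_image M Q by move=> x [].
have h1 := le_lebesgue_outer_linear (Q `\` E); rewrite -/c in h1.
have h2 : (mu (linear_image M Q) <= mu (linear_image M E) + mu (linear_image M (Q `\` E)))%E.
  apply: (le_trans _ (outer_measureU2 (@lebesgue_outer R 2) _ _)); apply: le_lebesgue_outer => x Qx.
  by have [Ex|nEx] := pselect (linear_image M E x); [left|right; split].
have h3 : mu (linear_image M Q) = (c%:E * mu Q)%E.
  rewrite pQ lebesgue_outer_linear_box EFinM; congr (_ * _)%E; symmetry.
  exact: lebesgue_outer_box.
have h4 : mu Q = (mu E + mu (Q `\` E))%E.
  rewrite -[in LHS](setDUK EQ) measureU//; last by rewrite setDIK.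
have DQ : Q `\` E `<=` Q by move=> x [].
move: h1 h2; rewrite h3 h4 -(volumeE bQ EQ) -(volumeE bQ DQ).
rewrite -(volumeE bl EQl) -(volumeE bl DQl) -EFinD -!EFinM -EFinD !lee_fin.
by move=> h1 h2; lra.
Qed.

End linear_image.

Section linear_measure.
Context (R : realType) (M : 'M[R]_2) (uM : M \in unitmx).
Local Notation mu := (@lebesgue_measure_Rn R 2).
Implicit Types (E : set 'rV[R]_2).

(** The inverse image of the unit square is mapped back onto the unit square, of measure 1. *)
Lemma linear_scaleV : linear_scale (invmx M) * linear_scale M = 1.
Proof.
have uM' : invmx M \in unitmx by rewrite unitmx_inv.
pose U := box (origin_box (1 : R) 1).
have mU : measurable (linear_image (invmx M) U : set (lebesgueRn R 2)) by exact: measurable_linear_box.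
have bU : bounded_set (linear_image (invmx M) U) by apply: linear_image_bounded => //; exact: bounded_box.
have := lebesgue_outer_linear_bounded uM mU bU.
have -> : linear_image M (linear_image (invmx M) U) = U.
  by rewrite -[X in linear_image X (linear_image _ _)]invmxK linear_imageK.
rewrite -(volumeE bU (@subset_refl _ _)) -EFinM [X in X = _](lebesgue_outer_box (ltn0Sn 1)) => -[].
rewrite /box_volume big_ord_recl big_ord1 !mxE /= !subr0 max_r// mulr1 => e.
by rewrite mulrC [RHS]e.
Qed.

Lemma linear_scale_gt0 : 0 < linear_scale M.
Proof.
rewrite lt_neqAle linear_scale_ge0 andbT; apply/eqP => h.
by have := linear_scaleV; rewrite -h mulr0 => /eqP; rewrite eq_sym oner_eq0.
Qed.

Lemma lebesgue_outer_linear E : mu (linear_image M E) = ((linear_scale M)%:E * mu E)%E.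
Proof.
apply/eqP; rewrite eq_le le_lebesgue_outer_linear//=.
have uM' : invmx M \in unitmx by rewrite unitmx_inv.
have := le_lebesgue_outer_linear uM' (linear_image M E); rewrite linear_imageK// => h.
have c0 := linear_scale_ge0 M.
apply: (le_trans (lee_wpmul2l _ h)); first by rewrite lee_fin.
by rewrite muleA -EFinM mulrC linear_scaleV mul1e.
Qed.

Lemma measurable_linear_image E : measurable (E : set (lebesgueRn R 2)) ->
  measurable (linear_image M E : set (lebesgueRn R 2)).
Proof.
move=> mE; apply: le_caratheodory_measurable => X; pose Y := linear_image (invmx M) X.
have sh F : X `&` linear_image M F = linear_image M (Y `&` F).
  by apply/seteqP; split=> x; rewrite /Y /linear_image /= invmxK mulmxKV.
rewrite (sh E) (_ : ~` linear_image M E = linear_image M (~` E)); last by [].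
rewrite sh [X in (X + _)%E]lebesgue_outer_linear [X in (_ + X)%E]lebesgue_outer_linear.
rewrite [leRHS](_ : _ = ((linear_scale M)%:E * lebesgue_outer Y)%E); last first.
  rewrite -lebesgue_outer_linear; congr (lebesgue_outer _).
  by apply/seteqP; split=> x; rewrite /Y /linear_image /= invmxK mulmxKV.
rewrite [lebesgue_outer Y](mE Y) muleDr//.
by rewrite ge0_adde_def// inE; exact: lebesgue_outer_ge0.
Qed.

End linear_measure.

Section change_of_variables.
Context (R : realType) (M : 'M[R]_2) (uM : M \in unitmx).
Local Notation mu := (@lebesgue_measure_Rn R 2).
Implicit Types (E : set 'rV[R]_2).

Lemma Rintegral_linear E (g : 'rV[R]_2 -> R) : measurable (E : set (lebesgueRn R 2)) ->
  measurable_fun [set: lebesgueRn R 2] g -> mu.-integrable E (EFin \o (fun x => g (x *m M))) ->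
  \int[mu]_(x in E) g (x *m M) = linear_scale (invmx M) * \int[mu]_(x in linear_image M E) g x.
Proof.
move=> mE mg ig; have uM' : invmx M \in unitmx by rewrite unitmx_inv.
have c0 := linear_scale_gt0 uM'; set c := linear_scale (invmx M) in c0 *.
have mT : measurable_fun [set: lebesgueRn R 2] (fun x : lebesgueRn R 2 => x *m M : lebesgueRn R 2).
  by move=> _ Y mY; rewrite setTI; have := measurable_linear_image uM' mY; rewrite /linear_image invmxK.
have mL := measurable_linear_image uM mE.
have pre : (fun x => x *m M) @^-1` (linear_image M E) = E.
  by apply/seteqP; split=> x; rewrite /linear_image /= mulmxK.
have mg' : measurable_fun [set: lebesgueRn R 2] (EFin \o g) := (measurable_EFinP _ _).2 mg.
rewrite /Rintegral; have := @integral_pushforward _ _ _ _ R _ mT mu (linear_image M E) (EFin \o g).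
rewrite pre => /(_ mg') /(_ ig) /(_ mL) <-.
(* The image of the measure under multiplication by [M] is the measure scaled by [c]. *)
rewrite (_ : (\int[_]_(y in _) _)%E = (\int[mscale (NngNum (ltW c0)) mu]_(x in linear_image M E) (EFin \o g) x)%E); last first.
  apply: eq_measure_integral => Y mY _.
  have := lebesgue_outer_linear uM' Y; rewrite /linear_image invmxK => h.
  exact: h.
have mgL : measurable_fun (linear_image M E : set (lebesgueRn R 2)) (EFin \o g) :=
  measurable_funS measurableT (@subsetT _ _) mg'.
rewrite [X in fine X = _]integralE [X in _ = _ * fine X]integralE.
have mp := measurable_funepos mgL; have mn := measurable_funeneg mgL.
rewrite (ge0_integral_mscale mu mL (NngNum (ltW c0)) mp (fun x _ => funepos_ge0 _ x)).
rewrite (ge0_integral_mscale mu mL (NngNum (ltW c0)) mn (fun x _ => funeneg_ge0 _ x)) /=.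
move: (integral _ _ _) (integral _ _ _) => a b; case: a => [a| |]; case: b => [b| |];
  rewrite ?gt0_muley ?gt0_muleNy ?lte_fin//= ?mulr0// -?mulrBr//.
Qed.

Lemma complex_integral_linear E (f : 'rV[R]_2 -> R[i]) : measurable (E : set (lebesgueRn R 2)) ->
  complex_measurable_fun setT f -> cintegrable E (fun x => f (x *m M)) ->
  complex_integral (linear_image M E) f =
  (linear_scale M)%:C%C * complex_integral E (fun x => f (x *m M)).
Proof.
move=> mE [mr mi] [ir ii]; have := linear_scaleV uM; rewrite mulrC => e.
rewrite /complex_integral (Rintegral_linear mE mr ir) (Rintegral_linear mE mi ii).
by rewrite /GRing.mul /= !mul0r subr0 addr0 !mulrA e !mul1r.
Qed.

Lemma expint_linear E l : measurable (E : set (lebesgueRn R 2)) -> bounded_set E ->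
  expint (linear_image M E) l = (linear_scale M)%:C%C * expint E (l *m M^T).
Proof.
move=> mE bE.
have eE x : exponential l (x *m M) = exponential (l *m M^T) x.
  rewrite !exponentialE; congr cis; rewrite /euclid_dot.
  under eq_bigr do rewrite mxE mulr_sumr.
  rewrite exchange_big /=; apply: eq_bigr => i _; rewrite mxE mulr_suml.
  by apply: eq_bigr => j _; rewrite mxE; ring.
have eE' : (fun x => exponential l (x *m M)) = exponential (l *m M^T) by apply/funext.
have ci := cintegrable_L2 mE bE (L2_exponential mE bE (l *m M^T)); rewrite -eE' in ci.
by rewrite /expint (complex_integral_linear mE (measurable_exponential l measurableT) ci) eE'.
Qed.

End change_of_variables.

Section parallelogram.
Context (R : realType).
Implicit Types (e w p x l : 'rV[R]_2) (s t : R).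

Definition unit_segment : set 'rV[R]_1 := box (0, const_mx 1).

(** The integral of [cis (t s)] over [0 < s <= 1]. Written as a transform it inherits continuity and
    the bound 1; its zeros and decay come from [segint_scale]. *)
Definition segint t : R[i] := expint unit_segment (const_mx t).

Lemma measurable_unit_segment : measurable (unit_segment : set (lebesgueRn R 1)).
Proof. exact: box_measurable. Qed.

Lemma bounded_unit_segment : bounded_set unit_segment.
Proof. exact: bounded_box. Qed.

Lemma volume_unit_segment : volume unit_segment = 1.
Proof.
by rewrite /volume [X in fine X](lebesgue_outer_box (ltn0Sn 0)) /box_volume big_ord1 !mxE /= subr0 max_r.
Qed.

Lemma segint0 : segint 0 = 1.
Proof.
rewrite /segint (_ : const_mx 0 = 0) ?expint0 ?volume_unit_segment//; first exact: measurable_unit_segment.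
exact: (bounded_lty bounded_unit_segment).
Qed.

Lemma sqnorm_segint_le t : sqnorm (segint t) <= 1.
Proof.
have := sqnorm_expint_le measurable_unit_segment bounded_unit_segment (const_mx t).
by rewrite volume_unit_segment expr1n.
Qed.

Lemma expint_unit_box l : expint (box (origin_box (1 : R) 1)) l = segint (l ord0 0) * segint (l ord0 1).
Proof.
have mU := measurable_unit_segment; have bU := bounded_unit_segment.
have l0 : lshift 1 (0 : 'I_1) = (0 : 'I_2) by exact/val_inj.
have r1 : rshift 1 (0 : 'I_1) = (1 : 'I_2) by exact/val_inj.
have -> : box (origin_box (1 : R) 1) = cartesian unit_segment unit_segment :> set 'rV[R]_(1 + 1).
  rewrite cartesianE; apply/seteqP; split=> x /=.
    move=> h; have h0 := h 0; have h1 := h 1; rewrite !mxE /= in h0 h1.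
    by split=> i; rewrite (ord1 i) !mxE ?l0 ?r1.
  move=> [/(_ 0) h0 /(_ 0) h1]; rewrite !mxE ?l0 ?r1 in h0 h1.
  by apply: ord2P; rewrite !mxE.
have := expint_cartesian (ltn0Sn 0) (ltn0Sn 0) mU mU (l : 'rV_(1 + 1)) bU bU.
rewrite (_ : lsubmx _ = const_mx (l ord0 0)); last by apply/rowP => i; rewrite (ord1 i) !mxE l0.
by rewrite (_ : rsubmx _ = const_mx (l ord0 1)) //; apply/rowP => i; rewrite (ord1 i) !mxE r1.
Qed.

Definition det2 e w : R := e ord0 0 * w ord0 1 - e ord0 1 * w ord0 0.

Definition pair_mx e w : 'M[R]_2 := \matrix_(i, j) (if i == 0 then e else w) ord0 j.

Lemma mul_pair_mx x e w : x *m pair_mx e w = x ord0 0 *: e + x ord0 1 *: w.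
Proof.
apply/rowP => j; rewrite !mxE big_ord_recl big_ord1 !mxE /=.
by rewrite (_ : lift _ _ = 1)//; exact/val_inj.
Qed.

Lemma unit_pair_mx e w : (pair_mx e w \in unitmx) = (det2 e w != 0).
Proof.
have l1 : lift 0 (0 : 'I_1) = (1 : 'I_2) by exact/val_inj.
have l2 : lift 1 (0 : 'I_1) = (0 : 'I_2) by exact/val_inj.
rewrite unitmxE unitfE; congr (_ != 0).
rewrite (expand_det_row _ 0) big_ord_recl big_ord1 /cofactor !det_mx11 !mxE /= ?l1 ?l2 /det2.
by rewrite expr0 expr1; ring.
Qed.

(** Half-open: for independent [e] and [w] it consists of the points [p + s e + t w] with
    [0 < s, t <= 1], so that cutting it along a side gives sets of the same form. *)
Definition parallelogram p e w : set 'rV[R]_2 :=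
  shift_set p (linear_image (pair_mx e w) (box (origin_box 1 1))).

Definition area e w : R := linear_scale (pair_mx e w).

Lemma cramer e w x : det2 e w != 0 ->
  x = (det2 x w / det2 e w) *: e + (det2 e x / det2 e w) *: w.
Proof.
by move=> n0; apply/rowP; apply: ord2P; rewrite !mxE; rewrite /det2 in n0 *; field.
Qed.

Lemma in_parallelogram p e w x : det2 e w != 0 -> parallelogram p e w x <->
  0 < det2 (x - p) w / det2 e w <= 1 /\ 0 < det2 e (x - p) / det2 e w <= 1.
Proof.
move=> n0; rewrite /parallelogram /shift_set /linear_image /= in_origin_box.
suff -> : (x - p) *m invmx (pair_mx e w) = \row_i (if i == 0 then det2 (x - p) w / det2 e w
    else det2 e (x - p) / det2 e w) by rewrite !mxE.
have um : pair_mx e w \in unitmx by rewrite unit_pair_mx.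
rewrite -[RHS](mulmxK um) mul_pair_mx !mxE /=; congr (_ *m _).
exact: cramer.
Qed.

Lemma parallelogramP p e w x : det2 e w != 0 -> parallelogram p e w x <->
  exists s t, [/\ 0 < s <= 1, 0 < t <= 1 & x = p + s *: e + t *: w].
Proof.
move=> n0; rewrite in_parallelogram//; split=> [[h1 h2]|[s [t [h1 h2 ->]]]].
  exists (det2 (x - p) w / det2 e w), (det2 e (x - p) / det2 e w); split=> //.
  by rewrite -addrA -cramer// addrC subrK.
rewrite (_ : p + s *: e + t *: w - p = s *: e + t *: w); last by rewrite -(addrA p) [LHS]addrC addKr.
rewrite (_ : det2 (s *: e + t *: w) w = s * det2 e w); last by rewrite /det2 !mxE; ring.
rewrite (_ : det2 e (s *: e + t *: w) = t * det2 e w); last by rewrite /det2 !mxE; ring.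
by rewrite !mulfK.
Qed.

Lemma measurable_parallelogram p e w : measurable (parallelogram p e w : set (lebesgueRn R 2)).
Proof. exact/measurable_shift_set/measurable_linear_box. Qed.

Lemma bounded_shift d (E : set 'rV[R]_d) z : bounded_set E -> bounded_set (shift_set z E).
Proof.
move=> /bounded_setP[T [T0 hT]]; exists (T + `|z|); split=> [|M TM x Ex]; first exact: num_real.
apply: le_trans (ltW TM); rewrite -[x in leLHS](subrK z).
exact: le_trans (ler_normD _ _) (lerD (hT _ Ex) (lexx _)).
Qed.

Lemma bounded_parallelogram p e w : det2 e w != 0 -> bounded_set (parallelogram p e w).
Proof.
move=> n0; apply/bounded_shift/linear_image_bounded; last exact: bounded_box.
by rewrite unit_pair_mx.
Qed.

Lemma area_gt0 e w : det2 e w != 0 -> 0 < area e w.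
Proof. by move=> n0; apply: linear_scale_gt0; rewrite unit_pair_mx. Qed.

Lemma expint_parallelogram p e w l : det2 e w != 0 ->
  expint (parallelogram p e w) l =
  (area e w)%:C%C * cis (euclid_dot l p) * segint (euclid_dot l e) * segint (euclid_dot l w).
Proof.
move=> n0; have um : pair_mx e w \in unitmx by rewrite unit_pair_mx.
have mb := @box_measurable R 2 (origin_box 1 1); have bb := @bounded_box R 2 (origin_box 1 1).
rewrite /parallelogram expint_shift; last 2 first.
- exact: measurable_linear_box.
- exact: linear_image_bounded.
rewrite (expint_linear um l mb bb) expint_unit_box.
have eE i : (l *m (pair_mx e w)^T) ord0 i = euclid_dot l (if i == 0 then e else w).
  by rewrite mxE; apply: eq_bigr => j _; rewrite !mxE.
by rewrite !eE /= /area; ring.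
Qed.

Lemma area_scale e w s t : det2 e w != 0 -> 0 < s -> 0 < t -> area (s *: e) (t *: w) = s * t * area e w.
Proof.
move=> n0 s0 t0; have um : pair_mx e w \in unitmx by rewrite unit_pair_mx.
have um' : pair_mx (s *: e) (t *: w) \in unitmx.
  rewrite unit_pair_mx (_ : det2 _ _ = s * t * det2 e w); last by rewrite /det2 !mxE; ring.
  by rewrite !mulf_neq0 ?(gt_eqF s0) ?(gt_eqF t0).
rewrite /area -(volume_linear_origin_box um (ltW s0) (ltW t0)) /linear_scale; congr volume.
apply/seteqP; split=> x; rewrite /linear_image /= => /in_origin_box[h1 h2].
  have -> : x *m invmx (pair_mx e w) = \row_i ((if i == 0 then s else t) * (x *m invmx (pair_mx (s *: e) (t *: w))) ord0 i).
    rewrite -[RHS](mulmxK um) mul_pair_mx; congr (_ *m _); rewrite !mxE /=.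
    by rewrite -[LHS](mulmxKV um') mul_pair_mx !scalerA !mxE; congr (_ *: _ + _ *: _); rewrite mulrC.
  move: (x *m _) h1 h2 => y /andP[h1 h2] /andP[h3 h4]; apply/in_origin_box; rewrite !mxE /=.
  by rewrite (ger_pMr _ s0) (ger_pMr _ t0) (pmulr_rgt0 _ s0) (pmulr_rgt0 _ t0) h2 h4 ?h1 ?h3.
have -> : x *m invmx (pair_mx (s *: e) (t *: w)) = \row_i ((if i == 0 then s^-1 else t^-1) * (x *m invmx (pair_mx e w)) ord0 i).
  rewrite -[RHS](mulmxK um') mul_pair_mx; congr (_ *m _); rewrite !mxE /= !scalerA.
  rewrite -[LHS](mulmxKV um) mul_pair_mx !mxE; congr (_ *: _ + _ *: _); rewrite mulrAC mulVf ?mul1r// gt_eqF//.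
move: (x *m _) h1 h2 => y /andP[h1 h2] /andP[h3 h4]; apply/in_origin_box; rewrite !mxE /=.
rewrite (ler_pdivrMl _ _ s0) (ler_pdivrMl _ _ t0) !mulr1 h2 h4 !andbT.
by rewrite (pmulr_rgt0 (y ord0 0)) ?invr_gt0// (pmulr_rgt0 (y ord0 1)) ?invr_gt0.
Qed.

End parallelogram.

(** * Zeros and decay of the transform of a segment *)

Section segint_theory.
Context (R : realType).
Implicit Types (x y s t : R).

Definition is_integer x := exists k : int, x = k%:~R.

Lemma is_integerB x y : is_integer x -> is_integer y -> is_integer (x - y).
Proof. by move=> [k ->] [l ->]; exists (k - l); rewrite rmorphB. Qed.

Lemma is_integer0 : is_integer 0. Proof. by exists 0. Qed.

Lemma is_integerN x : is_integer x -> is_integer (- x).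
Proof. by move=> h; rewrite -sub0r; exact: is_integerB is_integer0 h. Qed.

Lemma is_integerD x y : is_integer x -> is_integer y -> is_integer (x + y).
Proof. by move=> hx hy; rewrite -[y]opprK; apply: is_integerB => //; exact: is_integerN. Qed.

Lemma cis_integer x : is_integer x <-> cis x = 1.
Proof. by split=> [[k ->]|]; [exact: cis_int|exact: cis_eq1]. Qed.

Lemma segint_continuous (e : R) : 0 < e -> exists2 del : R, 0 < del &
  forall x y, `|x - y| < del -> sqnorm (segint x - segint y) < e.
Proof.
move=> e0; have [del del0 h] := expint_continuous (@measurable_unit_segment R) (@bounded_unit_segment R) e0.
exists del => // x y xy; apply: h; rewrite [ltLHS]mx_normrE; apply/bigmax_ltP; split=> // i _.
by rewrite !mxE.
Qed.

(** Translating the unit square by [t] along a side uncovers a strip of width [t] at either end,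
    according to the sign of the translation; comparing transforms through [expint_difference] gives
    this functional equation. *)
Lemma segint_scale x t : 0 < t -> t <= 1 ->
  segint x * (1 - cis (t * x)) = t%:C%C * segint (t * x) * (1 - cis x).
Proof.
move=> t0; rewrite le_eqVlt => /predU1P[->|t1]; first by rewrite !mul1r.
pose e : 'rV[R]_2 := delta_mx 0 0; pose w : 'rV[R]_2 := delta_mx 0 1.
have n0 : det2 e w != 0 by rewrite /det2 !mxE /= mulr0 subr0 mulr1 oner_eq0.
have n0t : det2 (t *: e) w != 0 by rewrite /det2 !mxE /= mulr0 subr0 !mulr1 gt_eqF.
pose P := parallelogram 0 e w; pose l : 'rV[R]_2 := x *: e.
have dotl r i : euclid_dot l (r *: delta_mx 0 i) = r * l ord0 i by rewrite euclid_dot_delta.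
have lE : euclid_dot l e = x by rewrite -[e]scale1r dotl !mxE /= !mul1r mulr1.
have lw : euclid_dot l w = 0 by rewrite -[w]scale1r dotl !mxE /= mul1r mulr0.
have lt r : euclid_dot l (r *: e) = r * x by rewrite euclid_dotZr lE.
have mP : measurable (P : set (lebesgueRn R 2)) by exact: measurable_parallelogram.
have bP : bounded_set P by exact: bounded_parallelogram.
have inP q r (y : 'rV[R]_2) : det2 (r *: e) w != 0 -> 0 < r -> parallelogram (q *: e) (r *: e) w y <->
    q < y ord0 0 <= q + r /\ 0 < y ord0 1 <= 1.
  move=> nr r0; rewrite in_parallelogram//.
  have -> : det2 (y - q *: e) w = y ord0 0 - q by rewrite /det2 !mxE /=; ring.
  have -> : det2 (r *: e) w = r by rewrite /det2 !mxE /=; ring.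
  have -> : det2 (r *: e) (y - q *: e) = r * y ord0 1 by rewrite /det2 !mxE /=; ring.
  rewrite [r * _]mulrC mulfK ?gt_eqF// ltr_pdivlMr// ler_pdivrMr// mul0r mul1r.
  by rewrite subr_gt0 lerBlDl.
have inP0 (y : 'rV[R]_2) : P y <-> 0 < y ord0 0 <= 1 /\ 0 < y ord0 1 <= 1.
  by have := inP 0 1 y; rewrite scale1r scale0r add0r; apply.
have := expint_difference (t *: e) l mP bP.
have -> : P `\` shift_set (t *: e) P = parallelogram 0 (t *: e) w.
  rewrite -[X in parallelogram X](scale0r e); apply/seteqP; split=> y.
    move=> [/inP0[/andP[h1 h2] h3]]; rewrite /shift_set /= => h; apply/inP => //; split=> //.
    rewrite h1 /= add0r leNgt; apply/negP => ty; apply: h; apply/inP0; rewrite !mxE /=.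
    by rewrite mulr0 subr0 mulr1; split=> //; apply/andP; split; lra.
  move=> /(inP _ _ _ n0t t0)[/andP[h1 h2] h3]; split; first by apply/inP0; split=> //; apply/andP; split; lra.
  by rewrite /shift_set /= => /inP0[]; rewrite !mxE /= mulr1 => /andP[? ?]; lra.
have -> : P `\` shift_set (- (t *: e)) P = parallelogram ((1 - t) *: e) (t *: e) w.
  apply/seteqP; split=> y.
    move=> [/inP0[/andP[h1 h2] h3]]; rewrite /shift_set /= => h; apply/inP => //; split=> //.
    rewrite subrK h2 andbT ltNge; apply/negP => ty; apply: h; apply/inP0; rewrite !mxE /=.
    by rewrite mulr0 oppr0 subr0 mulr1 opprK; split=> //; apply/andP; split; lra.
  move=> /(inP _ _ _ n0t t0)[/andP[h1 h2] h3]; split; first by apply/inP0; split=> //; apply/andP; split; lra.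
  by rewrite /shift_set /= => /inP0[]; rewrite !mxE /= mulr1 => /andP[? ?]; lra.
rewrite !expint_parallelogram// lw segint0 !lt lE.
rewrite [area (t *: e) w](_ : _ = t * area e w); last first.
  by rewrite -[w in LHS]scale1r area_scale// mulr1.
have l0 : euclid_dot l 0 = 0 by rewrite -(scale0r e) lt mul0r.
rewrite l0 cis0 mulrBl mul1r cisD cisN !mulr1.
have V0 : (area e w)%:C%C != 0 by rewrite -sqnorm_gt0 sqnorm_real exprn_gt0// area_gt0.
rewrite (rmorphM (real_complex R)) => h; apply: (mulfI V0).
have ct : cis (t * x) * conjc (cis (t * x)) = 1 by rewrite mulr_conjc sqnorm_cis.
rewrite mulrA h; set a := (area e w)%:C%C; set c := cis (t * x) in ct *; set cc := conjc c in ct *.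
transitivity (t%:C%C * a * segint (t * x) * (1 - cis x * (c * cc))); first by ring.
by rewrite ct; ring.
Qed.

Lemma cis_half : cis (2^-1 : R) = -1.
Proof.
by rewrite /cis (_ : 2 * pi * 2^-1 = pi); [rewrite cospi sinpi; apply/eqP; rewrite eq_complex /= oppr0 !eqxx|field].
Qed.

(** In the functional equation with [t = 1 / (2 |x|)] the angle [t x] is half a turn in either
    sense, so [1 - cis (t x)] is 2. *)
Lemma segint_half x : 2^-1 <= `|x| -> 2 * segint x = ((2 * `|x|)^-1)%:C%C *
  segint ((2 * `|x|)^-1 * x) * (1 - cis x).
Proof.
move=> x1; have x0 : 0 < `|x| by apply: lt_le_trans x1; rewrite invr_gt0.
have t0 : 0 < (2 * `|x|)^-1 by rewrite invr_gt0 mulr_gt0.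
rewrite -segint_scale//; last by rewrite invf_le1 ?mulr_gt0//; lra.
suff -> : cis ((2 * `|x|)^-1 * x) = -1 by ring.
have [xp|xn] := ger0P x.
  by rewrite (_ : _ * x = 2^-1) ?cis_half//; field; rewrite gt_eqF// -(ger0_norm xp).
rewrite (_ : _ * x = - 2^-1); last by field; rewrite lt_eqF.
by rewrite cisN cis_half rmorphN rmorph1.
Qed.

Lemma segint_decay x : 1 <= `|x| -> sqnorm (segint x) <= `|x|^-1 ^+ 2.
Proof.
move=> x1; have x0 : 0 < `|x| by lra.
have xh : 2^-1 <= `|x| by lra.
have := congr1 (@sqnorm R) (segint_half xh).
rewrite !sqnormM sqnorm_real -(ler_pM2l (x := 4)) ?ltr0n//.
rewrite (_ : sqnorm 2 = 4); last by rewrite /sqnorm /= !addr0 expr0n /=; ring.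
move=> ->; have s1 := sqnorm_segint_le ((2 * `|x|)^-1 * x).
have s2 : sqnorm (1 - cis x) <= 4.
  apply: (le_trans (sqnormD_le _ _)); rewrite -mulN1r sqnormM sqnorm_cis.
  by rewrite /sqnorm /=; lra.
have i0 : 0 <= (2 * `|x|)^-1 ^+ 2 by rewrite sqr_ge0.
apply: (@le_trans _ _ ((2 * `|x|)^-1 ^+ 2 * 1 * 4)).
  by apply: ler_pM => //; [rewrite mulr_ge0 ?sqnorm_ge0|exact: sqnorm_ge0|rewrite ler_wpM2l].
rewrite mulr1 mulrC ler_wpM2l// invfM exprMn ger_pMl ?exprn_gt0 ?invr_gt0//.
by rewrite expr2; lra.
Qed.

Lemma segint_eq0 x : segint x = 0 <-> is_integer x /\ x <> 0.
Proof.
have h1 : (1 : R[i]) != 0 := oner_neq0 _.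
split=> [s0|[[k xk] xn0]].
  have x0 : x <> 0 by move=> x0; move: s0; rewrite x0 segint0 => /eqP; rewrite oner_eq0.
  split=> //; apply/cis_integer/eqP; rewrite eq_sym -subr_eq0.
  have [del del0 h] := segint_continuous (ltr01 : 0 < (1 : R)).
  (* For this small [t], [segint (t x)] is close to [segint 0 = 1], so the functional equation
     forces [1 - cis x] to vanish. *)
  pose t := Num.min 1 (del / (2 * `|x|)).
  have xx : 0 < `|x| by rewrite normr_gt0; apply/eqP.
  have t0 : 0 < t by rewrite lt_min ltr01 divr_gt0// mulr_gt0.
  have t1 : t <= 1 by rewrite ge_min lexx.
  have := segint_scale x t0 t1; rewrite s0 mul0r => /esym/eqP; rewrite !mulf_eq0.
  have /negPf-> : t%:C%C != 0 by rewrite -sqnorm_gt0 sqnorm_real exprn_gt0.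
  rewrite orFb => /orP[/eqP s1|//].
  have := h (t * x) 0; rewrite s1 segint0 sub0r subr0 -mulN1r mulr1.
  rewrite (_ : sqnorm (-1) = 1) ?ltxx; last by rewrite /sqnorm /= sqrrN expr1n oppr0 expr0n addr0.
  have tx : `|t * x| < del.
    rewrite normrM ger0_norm ?ltW//; apply: (@le_lt_trans _ _ (del / (2 * `|x|) * `|x|)).
      by rewrite ler_wpM2r// ge_min lexx orbT.
    rewrite (_ : del / (2 * `|x|) * `|x| = del / 2); last by field; rewrite gt_eqF.
    lra.
  by move=> /(_ tx).
have x1 : 1 <= `|x|.
  have k0 : k != 0 by apply/eqP => k0; apply: xn0; rewrite xk k0.
  by rewrite xk -intr_norm -[1](mulr1z 1) ler_int; lia.
have xh : 2^-1 <= `|x| by lra.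
have cx : cis x = 1 by rewrite xk cis_int.
have := segint_half xh; rewrite cx subrr mulr0.
by move/eqP; rewrite mulf_eq0 (pnatr_eq0 R[i] 2) => /eqP.
Qed.

End segint_theory.

Section det2_theory.
Context (R : realType).
Implicit Types (u v w : 'rV[R]_2).

Lemma det2Dl u v w : det2 (u + v) w = det2 u w + det2 v w.
Proof. by rewrite /det2 !mxE; ring. Qed.
Lemma det2Dr u v w : det2 w (u + v) = det2 w u + det2 w v.
Proof. by rewrite /det2 !mxE; ring. Qed.
Lemma det2Bl u v w : det2 (u - v) w = det2 u w - det2 v w.
Proof. by rewrite /det2 !mxE; ring. Qed.
Lemma det2Br u v w : det2 w (u - v) = det2 w u - det2 w v.
Proof. by rewrite /det2 !mxE; ring. Qed.
Lemma det2Zl (a : R) u v : det2 (a *: u) v = a * det2 u v.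
Proof. by rewrite /det2 !mxE; ring. Qed.
Lemma det2Zr (a : R) u v : det2 u (a *: v) = a * det2 u v.
Proof. by rewrite /det2 !mxE; ring. Qed.
Lemma det2Nl u v : det2 (- u) v = - det2 u v.
Proof. by rewrite /det2 !mxE; ring. Qed.
Lemma det2Nr u v : det2 u (- v) = - det2 u v.
Proof. by rewrite /det2 !mxE; ring. Qed.
Lemma det2vv u : det2 u u = 0.
Proof. by rewrite /det2; ring. Qed.
Lemma det2C u v : det2 u v = - det2 v u.
Proof. by rewrite /det2; ring. Qed.
Lemma det20l u : det2 0 u = 0.
Proof. by rewrite /det2 !mxE; ring. Qed.
Lemma det20r u : det2 u 0 = 0.
Proof. by rewrite /det2 !mxE; ring. Qed.

Definition det2E := (det2Dl, det2Dr, det2Bl, det2Br, det2Zl, det2Zr, det2Nl, det2Nr).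

End det2_theory.

(** * Edges of a polygon and its Fourier transform *)

Section convex_hull.
Context (R : realType) (d : nat) (V : set 'rV[R]_d).

Lemma convex_hull_segment (x y : 'rV[R]_d) (s : R) : convex_hull V x -> convex_hull V y ->
  0 <= s -> s <= 1 -> convex_hull V (x + s *: (y - x)).
Proof.
move=> hx hy s0 s1 C [cC VC]; have Cx := hx C (conj cC VC); have Cy := hy C (conj cC VC).
have h := set_mem (cC y x (Itv01 s0 s1) (mem_set Cy) (mem_set Cx)).
rewrite (_ : x + s *: (y - x) = s *: y + (1 - s) *: x); first exact: h.
by rewrite scalerBr scalerBl scale1r addrCA.
Qed.

Lemma convex_hull_halfspace (f : 'rV[R]_d -> R) (c : R) :
  (forall x y (s t : R), f (s *: x + t *: y) = s * f x + t * f y) ->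
  (forall r, V r -> f r <= c) -> forall x, convex_hull V x -> f x <= c.
Proof.
move=> fl Vc x; apply: (smallest_sub (X := [set y | f y <= c])) => // y z t /set_mem /= yc /set_mem /= zc.
apply: mem_set; rewrite /= [X in f X](_ : _ = t%:num *: y + (1 - t%:num) *: z)// fl.
have t0 : 0 <= t%:num by []. have t1 : t%:num <= 1 by [].
by move: (t%:num) t0 t1 => s s0 s1; nra.
Qed.

End convex_hull.

Lemma seq_argmin (R : realType) (T : eqType) (f : T -> R) (s : seq T) x : x \in s ->
  exists2 m, m \in s & forall y, y \in s -> f m <= f y.
Proof.
elim: s x => // a [_ x|b s IH x _].
  by exists a; rewrite ?mem_head// => y; rewrite inE => /eqP->.
have [m ms hm] := IH b (mem_head _ _).
have [am|ma] := lerP (f a) (f m).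
  exists a; first exact: mem_head.
  by move=> y; rewrite inE => /predU1P[->//|/hm]; exact: le_trans.
exists m; first by rewrite inE ms orbT.
by move=> y; rewrite inE => /predU1P[->|/hm//]; exact: ltW.
Qed.

Section polygon_edges.
Context (R : realType) (V : seq 'rV[R]_2).
Implicit Types (p q r x y w : 'rV[R]_2).
Local Notation A := (convex_hull [set` V]).

(* The polygon lies to the right of the oriented edges. *)
Definition is_edge p q := [/\ p \in V, q \in V, p <> q &
  forall r, r \in V -> det2 (q - p) (r - p) <= 0 /\
    (det2 (q - p) (r - p) = 0 -> exists s, [/\ 0 <= s, s <= 1 & r = p + s *: (q - p)])].

(** [det2 _ w] is a coordinate constant along [w]: the line through [x] in direction [w] meets the
    open segment from [p] to [q], oriented so that [det2 (q - p) w] is positive. *)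
Definition crosses w p q x := det2 p w < det2 x w < det2 q w.

Lemma hull_det2 u c x : (forall r, r \in V -> det2 u r <= c) -> A x -> det2 u x <= c.
Proof.
move=> h; apply: (@convex_hull_halfspace _ _ [set` V] (det2 u) c) => // y z s t.
by rewrite det2Dr !det2Zr.
Qed.

Lemma edge_halfplane p q x : is_edge p q -> A x -> det2 (q - p) (x - p) <= 0.
Proof.
move=> [_ _ _ h] Ax; rewrite det2Br subr_le0; apply: hull_det2 Ax => r /h[+ _].
by rewrite det2Br subr_le0.
Qed.

(** The multiple of [w] to subtract from [x] in order to reach the line through [p] and [q], see
    [crossing_point]. A smaller height means a line further along [w]. *)
Definition height w p q x := det2 (q - p) (x - p) / det2 (q - p) w.

Lemma crosses_det2 w p q x : crosses w p q x -> 0 < det2 (q - p) w.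
Proof. by rewrite /crosses det2Bl => /andP[h1 h2]; rewrite subr_gt0; exact: lt_trans h1 h2. Qed.

Lemma crossing_point w p q x : crosses w p q x ->
  x - height w p q x *: w = p + (det2 (x - p) w / det2 (q - p) w) *: (q - p).
Proof.
move=> /crosses_det2 h0; have := cramer (x - p) (lt0r_neq0 h0); rewrite -/(height w p q x) => e.
set a := _ / _ in e *; set h := height w p q x in e *; rewrite -[x in LHS](subrK p) e.
by rewrite addrAC addrK addrC.
Qed.

Lemma crossing_coef w p q x : crosses w p q x -> 0 < det2 (x - p) w / det2 (q - p) w < 1.
Proof.
move=> h; have h0 := crosses_det2 h; case/andP: h => h1 h2.
rewrite ltr_pdivrMr// mul1r ltr_pdivlMr// mul0r !det2Bl.
by apply/andP; split; lra.
Qed.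

Lemma crossing_in_hull w p q x : p \in V -> q \in V -> crosses w p q x -> A (x - height w p q x *: w).
Proof.
move=> pV qV h; rewrite crossing_point//; have /andP[h1 h2] := crossing_coef h.
by apply: convex_hull_segment; [exact: sub_gen_smallest|exact: sub_gen_smallest|exact: ltW|exact: ltW].
Qed.

Lemma height_le w p q p' q' x : is_edge p q -> crosses w p q x -> p' \in V -> q' \in V ->
  crosses w p' q' x -> height w p q x <= height w p' q' x.
Proof.
move=> e h pV' qV' h'; have := edge_halfplane e (crossing_in_hull pV' qV' h').
have h0 := crosses_det2 h; set hh := height w p' q' x; rewrite /height ler_pdivrMr//.
rewrite (_ : x - hh *: w - p = (x - p) - hh *: w); last by rewrite addrAC.
by rewrite (det2Br (x - p)) det2Zr subr_le0.
Qed.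

Lemma collinear w p q r : det2 (q - p) w != 0 -> det2 (q - p) (r - p) = 0 ->
  r = p + (det2 (r - p) w / det2 (q - p) w) *: (q - p).
Proof. by move=> n0 h; have := cramer (r - p) n0; rewrite h mul0r scale0r addr0 => <-; rewrite addrC subrK. Qed.

(** Both edges have the least height over [x], so the crossing point of one lies on the line of the
    other. Being interior to its own segment, it pulls both endpoints onto that line, and the last
    clause of [is_edge] then places each segment inside the other. *)
Lemma top_edge_unique w p q p' q' x : is_edge p q -> is_edge p' q' ->
  crosses w p q x -> crosses w p' q' x -> p = p' /\ q = q'.
Proof.
have half a b a' b' : is_edge a b -> is_edge a' b' -> crosses w a b x -> crosses w a' b' x ->
    det2 a w <= det2 a' w /\ det2 b' w <= det2 b w /\ (exists s, a' = a + s *: (b - a)) /\ (exists s, b' = a + s *: (b - a)).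
  move=> e e' h h'; have [aV bV _ he] := e; have [aV' bV' _ he'] := e'.
  have hh : height w a b x = height w a' b' x by apply/eqP; rewrite eq_le !height_le.
  have [da ea] := he _ aV'; have [db eb] := he _ bV'.
  have : det2 (b - a) (x - height w a' b' x *: w - a) = 0.
    by rewrite -hh crossing_point// addrAC subrr add0r det2Zr det2vv mulr0.
  rewrite crossing_point//; have /andP[s0 s1] := crossing_coef h'; move: (_ / _) s0 s1 => s s0 s1.
  rewrite (_ : a' + s *: (b' - a') - a = (1 - s) *: (a' - a) + s *: (b' - a)); last first.
    by apply/rowP => i; rewrite !mxE; ring.
  rewrite det2Dr !det2Zr => E.
  have da0 : det2 (b - a) (a' - a) = 0 by nra.
  have db0 : det2 (b - a) (b' - a) = 0 by nra.
  have h0 := crosses_det2 h.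
  have [t [t0 t1 ->]] := ea da0; have [t' [t0' t1' ->]] := eb db0.
  rewrite det2Bl in h0; rewrite !det2E; split; first by nra.
  by split; [nra|split; [exists t|exists t']].
move=> e e' h h'; have [l1 [l2 [[s1 a1] [s2 b1]]]] := half _ _ _ _ e e' h h'.
have [l3 [l4 _]] := half _ _ _ _ e' e h' h.
have h0 := crosses_det2 h; have u1 : det2 p' w = det2 p w by apply/eqP; rewrite eq_le l3 l1.
have u2 : det2 q' w = det2 q w by apply/eqP; rewrite eq_le l2 l4.
move: u1 u2; rewrite a1 b1 !det2E; rewrite det2Bl in h0 => u1 u2.
have -> : s1 = 0 by nra.
have -> : s2 = 1 by nra.
by rewrite scale0r addr0 scale1r addrC subrK.
Qed.

(** Among the crossed pairs of vertices, one of least height spans a supporting line: a vertex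
    beyond the line could replace an endpoint and lower the height. *)
Lemma top_edge_exists w x : (forall r, r \in V -> det2 r w <> det2 x w) ->
  (exists p q, [/\ p \in V, q \in V & crosses w p q x]) ->
  exists p q, is_edge p q /\ crosses w p q x.
Proof.
move=> gen [p0 [q0 [pV0 qV0 h0]]].
pose S := [seq pq <- [seq (p, q) | p <- V, q <- V] | crosses w pq.1 pq.2 x].
have inS p q : ((p, q) \in S) = [&& p \in V, q \in V & crosses w p q x].
  rewrite mem_filter /= andbC andbA; congr (_ && _).
  by apply/allpairsP/andP => [[[a b] /= [? ? [-> ->]]]|[? ?]]; [|exists (p, q)].
have [[p q]] := seq_argmin (fun pq => height w pq.1 pq.2 x)
  (etrans (inS p0 q0) (introT and3P (And3 pV0 qV0 h0))).
rewrite inS => /and3P[pV qV h] hmin; have hpq := crosses_det2 h; have /andP[hp hq] := h.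
have below r : r \in V -> det2 (q - p) (r - p) <= 0.
  move=> rV; rewrite leNgt; apply/negP => rpos.
  have /eqP : det2 r w <> det2 x w by exact: gen.
  rewrite neq_lt => /orP[rx|xr].
    have hr : crosses w r q x by rewrite /crosses rx hq.
    have := hmin (r, q); rewrite inS rV qV hr => /(_ isT); rewrite /= leNgt => /negP; apply.
    have hrq := crosses_det2 hr; rewrite /height ltr_pdivrMr// mulrAC ltr_pdivlMr// -subr_gt0.
    rewrite (_ : _ - _ = det2 (q - p) (r - p) * (det2 q w - det2 x w)); last first.
      by rewrite /det2 !mxE; ring.
    by rewrite mulr_gt0// subr_gt0.
  have hr : crosses w p r x by rewrite /crosses hp xr.
  have := hmin (p, r); rewrite inS rV pV hr => /(_ isT); rewrite /= leNgt => /negP; apply.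
  have hrq := crosses_det2 hr; rewrite /height ltr_pdivrMr// mulrAC ltr_pdivlMr// -subr_gt0.
  rewrite (_ : _ - _ = det2 (q - p) (r - p) * (det2 x w - det2 p w)); last first.
    by rewrite /det2 !mxE; ring.
  by rewrite mulr_gt0// subr_gt0.
(* Further vertices may lie on the supporting line; the extreme ones for [det2 _ w] are the
   endpoints that [is_edge] asks for. *)
pose L := [seq r <- V | det2 (q - p) (r - p) == 0].
have pL : p \in L by rewrite mem_filter subrr det20r eqxx.
have qL : q \in L by rewrite mem_filter det2vv eqxx.
have [a aL amin] := seq_argmin (fun r => det2 r w) pL.
have [b bL bmin] := seq_argmin (fun r => - det2 r w) qL.
have ap := amin _ pL; have qb := bmin _ qL; rewrite lerN2 in qb.
move: (aL) (bL); rewrite !mem_filter => /andP[/eqP a0 aV] /andP[/eqP b0 bV].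
have ca := collinear (lt0r_neq0 hpq) a0; have cb := collinear (lt0r_neq0 hpq) b0.
set s := _ / _ in ca; set t := _ / _ in cb.
have hab : crosses w a b x by apply/andP; split; [exact: le_lt_trans ap hp|exact: lt_le_trans hq qb].
have ba : b - a = (t - s) *: (q - p) by rewrite ca cb; apply/rowP => i; rewrite !mxE; ring.
have st : 0 < t - s by have := crosses_det2 hab; rewrite ba det2Zl pmulr_lgt0.
exists a, b; split=> //; split=> // [ab|r rV].
  by have := crosses_det2 hab; rewrite ab subrr det20l ltxx.
have -> : det2 (b - a) (r - a) = (t - s) * det2 (q - p) (r - p).
  by rewrite ba det2Zl det2Br -[det2 _ a](subrK (det2 (q - p) p)) -det2Br a0 add0r -det2Br.
split=> [|/eqP]; first by rewrite pmulr_rle0// below.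
rewrite mulf_eq0 (gt_eqF st) orFb => /eqP r0; have cr := collinear (lt0r_neq0 hpq) r0.
have rL : r \in L by rewrite mem_filter r0 eqxx.
have ar := amin _ rL; have rb := bmin _ rL; rewrite lerN2 in rb.
set m := _ / _ in cr; clearbody s t m; exists ((m - s) / (t - s)).
move: ar rb; rewrite ca cb cr !(det2Dl p) !det2Zl !lerD2l !(ler_pM2r hpq) => sm mt.
split; [by apply: divr_ge0; [rewrite subr_ge0|exact: ltW]|by rewrite ler_pdivrMr// mul1r lerD2r|].
by rewrite opprD addrACA subrr add0r -scalerBl scalerA divfK ?gt_eqF// -addrA -scalerDl [s + _]addrC subrK.
Qed.

End polygon_edges.

Section null_lines.
Context (R : realType).
Local Notation mu := (@lebesgue_measure_Rn R 2).

Lemma null_bigcup d (F : nat -> set 'rV[R]_d) : (forall n, lebesgue_outer (F n) = 0%E) ->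
  lebesgue_outer (\bigcup_n F n) = 0%E.
Proof.
move=> F0; apply/eqP; rewrite eq_le lebesgue_outer_ge0 andbT.
have /le_trans := lebesgue_outer_bigcup F (card_lexx _); apply.
by rewrite esum1.
Qed.

Lemma null_le d (E F : set 'rV[R]_d) : E `<=` F -> lebesgue_outer F = 0%E -> lebesgue_outer E = 0%E.
Proof.
move=> EF F0; apply/eqP; rewrite eq_le lebesgue_outer_ge0 andbT -F0; exact: le_lebesgue_outer.
Qed.

Lemma null_setU d (E F : set 'rV[R]_d) : lebesgue_outer E = 0%E -> lebesgue_outer F = 0%E ->
  lebesgue_outer (E `|` F) = 0%E.
Proof.
move=> E0 F0; apply/eqP; rewrite eq_le lebesgue_outer_ge0 andbT.
by apply: (le_trans (outer_measureU2 (@lebesgue_outer R d) _ _)); rewrite [X in (X + _)%E]E0 [X in (_ + X)%E]F0 adde0.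
Qed.

Lemma null_bigcup_seq d (T : eqType) (s : seq T) (F : T -> set 'rV[R]_d) :
  (forall i, i \in s -> lebesgue_outer (F i) = 0%E) ->
  lebesgue_outer [set x | exists2 i, i \in s & F i x] = 0%E.
Proof.
elim: s => [|i s IH] h.
  by apply: (null_le _ (lebesgue_outer0 R d)) => x [].
apply: (@null_le _ _ (F i `|` [set x | exists2 i, i \in s & F i x])).
  by move=> x [j]; rewrite inE => /predU1P[->|js] Fx; [left|right; exists j].
apply: null_setU; first by apply: h; rewrite mem_head.
by apply: IH => j js; apply: h; rewrite inE js orbT.
Qed.

Lemma null_measurable d (E : set 'rV[R]_d) : lebesgue_outer E = 0%E ->
  measurable (E : set (lebesgueRn R d)).
Proof.
move=> E0; apply: le_caratheodory_measurable => X.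
rewrite [X in (X + _)%E](_ : _ = 0%E) ?add0e; first by apply: le_lebesgue_outer => x [].
by apply: null_le E0 => x [].
Qed.

Lemma null_horizontal (c : R) : lebesgue_outer [set y : 'rV[R]_2 | y ord0 1 = c] = 0%E.
Proof.
pose F n := [set y : 'rV[R]_2 | y ord0 1 = c /\ `|y ord0 0| < n%:R].
apply: (@null_le _ _ (\bigcup_n F n)).
  move=> y yc; exists (Num.truncn `|y ord0 0|).+1 => //; split=> //.
  exact: truncnS_gt.
apply: null_bigcup => n; apply/eqP; rewrite eq_le lebesgue_outer_ge0 andbT.
apply/lee_addgt0Pr => h h0; rewrite add0e.
(* The thin box has width [2 n]; the added 1 keeps the denominator positive for [n = 0]. *)
pose h' := h / (2 * n%:R + 1).
have n1 : 0 < 2 * n%:R + 1 :> R by rewrite ltr_wpDl// mulr_ge0.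
have h'0 : 0 < h' by rewrite divr_gt0.
pose p : 'rV[R]_2 * 'rV[R]_2 := (\row_i (if i == 0 then - n%:R else c - h'), \row_i (if i == 0 then n%:R else c)).
apply: (@le_trans _ _ (lebesgue_outer (box p))).
  apply: le_lebesgue_outer => y [yc yn]; apply: ord2P; rewrite !mxE /=.
    by move: yn; rewrite ltr_norml => /andP[-> /ltW].
  by rewrite yc lexx andbT; lra.
apply: (le_trans (lebesgue_outer_box_le _)); rewrite lee_fin /box_volume big_ord_recl big_ord1 !mxE /=.
rewrite (_ : c - (c - h') = h'); last by ring.
rewrite !max_r; [|exact: ltW|by rewrite opprK addr_ge0].
apply: (@le_trans _ _ ((2 * n%:R + 1) * h')); last by rewrite /h' mulrC divfK ?gt_eqF.
by rewrite ler_wpM2r ?ltW//; lra.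
Qed.

Lemma null_line (u : 'rV[R]_2) (c : R) : u != 0 -> lebesgue_outer [set x | det2 u x = c] = 0%E.
Proof.
move=> u0; pose w : 'rV[R]_2 := \row_i (if i == 0 then - u ord0 1 else u ord0 0).
have D0 : det2 u w != 0.
  rewrite /det2 !mxE /= mulrN opprK -!expr2 paddr_eq0 ?sqr_ge0// !sqrf_eq0.
  apply: contra u0 => /andP[/eqP h0 /eqP h1]; apply/eqP/rowP; apply: ord2P; rewrite !mxE; [exact: h0|exact: h1].
have um : pair_mx u w \in unitmx by rewrite unit_pair_mx.
apply: (@null_le _ _ (linear_image (pair_mx u w) [set y | y ord0 1 = c / det2 u w])).
  move=> x /= xc; rewrite /linear_image /=.
  suff -> : x *m invmx (pair_mx u w) =
    \row_i (if i == 0 then det2 x w / det2 u w else det2 u x / det2 u w) by rewrite mxE /= xc.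
  by rewrite -[RHS](mulmxK um) mul_pair_mx !mxE /=; congr (_ *m _); exact: cramer.
rewrite [LHS](lebesgue_outer_linear um) [X in (_ * X)%E]null_horizontal mule0//.
Qed.

End null_lines.

Section polygon_fourier.
Context (R : realType) (V : seq 'rV[R]_2) (uV : uniq V).
Implicit Types (p q x w : 'rV[R]_2).
Local Notation A := (convex_hull [set` V]).
Local Notation mu := (@lebesgue_measure_Rn R 2).

Definition edges := [seq pq <- [seq (p, q) | p <- V, q <- V] | `[< is_edge V pq.1 pq.2 >]].

Lemma mem_edges pq : pq \in edges <-> is_edge V pq.1 pq.2.
Proof.
rewrite mem_filter; split=> [/andP[/asboolP]//|e]; apply/andP; split; first exact/asboolP.
by case: pq e => p q [pV qV _ _]; apply/allpairsP; exists (p, q).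
Qed.

Lemma uniq_edges : uniq edges.
Proof. by apply/filter_uniq/allpairs_uniq => // -[p q] [p' q'] _ _ /= [-> ->]. Qed.

Definition edge_vector (pq : 'rV[R]_2 * 'rV[R]_2) := pq.2 - pq.1.

(* The edge is oriented so that [det2 _ w] is positive. *)
Definition edge_base w (pq : 'rV[R]_2 * 'rV[R]_2) := if 0 < det2 (edge_vector pq) w then pq.1 else pq.2.

Definition edge_dir w (pq : 'rV[R]_2 * 'rV[R]_2) :=
  if 0 < det2 (edge_vector pq) w then edge_vector pq else - edge_vector pq.

(** The region swept by the edge when it is moved by [w]. *)
Definition edge_strip w pq := parallelogram (edge_base w pq) (edge_dir w pq) w.

Lemma det2_edge_dir w pq : det2 (edge_vector pq) w != 0 -> 0 < det2 (edge_dir w pq) w.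
Proof.
move=> n0; rewrite /edge_dir; case: ifPn => //; rewrite -leNgt => h.
by rewrite det2Nl oppr_gt0 lt_neqAle n0.
Qed.

(** Excludes finitely many lines, a null set when [w] is nonzero, so that no boundary case arises
    when the indicators of the polygon, of its translate and of the strips are compared at [x]. *)
Definition generic w x := (forall r, r \in V -> det2 r w <> det2 x w) /\
  forall pq, pq \in edges -> det2 (edge_vector pq) w != 0 ->
    det2 (edge_vector pq) (x - pq.1) <> 0 /\
    det2 (edge_vector pq) (x - pq.1) <> det2 (edge_vector pq) w.

Lemma null_not_generic w : w != 0 -> lebesgue_outer [set x | ~ generic w x] = 0%E.
Proof.
move=> w0; pose N1 := [set x | exists2 r, r \in V & det2 w x = det2 w r].
pose N2 c := [set x | exists2 pq, pq \in [seq pq <- edges | det2 (edge_vector pq) w != 0] &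
  det2 (edge_vector pq) x = c pq].
have z2 c : lebesgue_outer (N2 c) = 0%E.
  apply: null_bigcup_seq => pq; rewrite mem_filter => /andP[n0 _]; apply: null_line.
  by apply: contra n0 => /eqP->; rewrite det20l.
apply: (@null_le _ _ _ (N1 `|` (N2 (fun pq => det2 (edge_vector pq) pq.1) `|`
  N2 (fun pq => det2 (edge_vector pq) pq.1 + det2 (edge_vector pq) w)))); last first.
  by apply: null_setU; [apply: null_bigcup_seq => r _; exact: null_line|exact: null_setU].
move=> x ng; apply: contrapT => nN; apply: ng; split=> [r rV e|pq epq n0].
  by apply: nN; left; exists r => //; rewrite det2C -e -det2C.
have pqf : pq \in [seq pq <- edges | det2 (edge_vector pq) w != 0] by rewrite mem_filter n0.
split=> e; apply: nN; right; [left|right]; exists pq => //.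
  by move: e => /eqP; rewrite det2Br subr_eq0 => /eqP.
by rewrite -e det2Br addrC subrK.
Qed.

Lemma crossesN w p q x : crosses (- w) p q x = crosses w q p x.
Proof. by rewrite /crosses !det2Nr !ltrN2 andbC. Qed.

Lemma heightN w p q x : height (- w) p q x = - height w p q x.
Proof. by rewrite /height det2Nr invrN mulrN. Qed.

Lemma crosses_shift w p q x : crosses w p q (x - w) = crosses w p q x.
Proof. by rewrite /crosses det2Bl det2vv subr0. Qed.

Lemma height_shift w p q x (s : R) : det2 (q - p) w != 0 ->
  height w p q (x + s *: w) = height w p q x + s.
Proof.
move=> n0; rewrite /height (_ : x + s *: w - p = (x - p) + s *: w); last by rewrite addrAC.
by rewrite (det2Dr (x - p)) det2Zr mulrDl mulfK.
Qed.

Lemma hull_crossed w x : (forall r, r \in V -> det2 r w <> det2 x w) -> A x ->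
  exists p q, [/\ p \in V, q \in V & crosses w p q x].
Proof.
move=> gen Ax.
have above z : (forall r, r \in V -> det2 r z <> det2 x z) -> exists2 q, q \in V & det2 x z < det2 q z.
  move=> gz; apply: contrapT => no.
  have [v vV vmax] : exists2 v, v \in V & forall r, r \in V -> - det2 v z <= - det2 r z.
    case: (pselect (exists r, r \in V)) => [[r rV]|nV].
      exact: (seq_argmin (fun r => - det2 r z) rV).
    (* Without vertices every half-plane contains the hull, even an empty one. *)
    have : det2 0 x <= -1 by apply: (hull_det2 (V := V)) Ax => r rV; case: nV; exists r.
    by rewrite det20l; lra.
  have : det2 (- z) x <= det2 v z.
    by apply: (hull_det2 (V := V)) Ax => r /vmax; rewrite lerN2 det2Nl (det2C z) opprK.
  rewrite det2Nl (det2C z) opprK => xv; apply: no; exists v => //.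
  by rewrite lt_neqAle xv andbT eq_sym; apply/eqP; exact: gz.
have [q qV hq] := above w gen.
have [|p pV hp] := above (- w); first by move=> r /gen h; rewrite !det2Nr => /oppr_inj.
by exists p, q; split=> //; rewrite /crosses hq andbT; move: hp; rewrite !det2Nr ltrN2.
Qed.

Lemma in_strip_crosses w p q x : 0 < det2 (q - p) w -> parallelogram p (q - p) w x ->
  det2 p w <> det2 x w -> det2 q w <> det2 x w -> crosses w p q x.
Proof.
move=> n0; rewrite in_parallelogram ?gt_eqF// => -[/andP[h1 h2] _] /eqP hp /eqP hq.
move: h1 h2; rewrite ltr_pdivlMr// ler_pdivrMr// mul0r mul1r !det2Bl => h1 h2.
by apply/andP; split; rewrite lt_neqAle ?hp ?(eq_sym _ (det2 q w)) ?hq /=; lra.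
Qed.

Lemma in_edge_strip w pq x : det2 (edge_vector pq) w != 0 -> edge_strip w pq x ->
  (forall r, r \in V -> det2 r w <> det2 x w) -> is_edge V pq.1 pq.2 ->
  crosses w pq.1 pq.2 x \/ crosses (- w) pq.1 pq.2 x.
Proof.
case: pq => p q /det2_edge_dir; rewrite /edge_strip /edge_base /edge_dir /edge_vector /=.
case: ifP => _ n0 st gen [pV qV _ _]; first by left; apply: in_strip_crosses st _ _ => //; exact: gen.
right; rewrite crossesN; rewrite opprB in n0 st.
by apply: in_strip_crosses st _ _ => //; exact: gen.
Qed.

Lemma in_strip_height w p q x : crosses w p q x ->
  parallelogram p (q - p) w x <-> 0 < height w p q x <= 1.
Proof.
move=> h; have h0 := crosses_det2 h; rewrite in_parallelogram ?gt_eqF//.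
have /andP[h1 h2] := crossing_coef h.
by split=> [[]//|h3]; split=> //; rewrite h1 ltW.
Qed.

Lemma in_edge_strip_height w p q x : crosses w p q x ->
  edge_strip w (p, q) x <-> 0 < height w p q x <= 1.
Proof.
move=> h; have h0 := crosses_det2 h; rewrite /edge_strip /edge_base /edge_dir /edge_vector /= h0.
exact: in_strip_height.
Qed.

Lemma heightC w p q x : height w q p x = height w p q x.
Proof.
rewrite /height -(opprB q p) (det2Nl _ w) invrN mulrN -mulNr; congr (_ / _).
by rewrite det2Nl opprK (_ : x - q = (x - p) - (q - p)) ?(det2Br (x - p)) ?det2vv ?subr0//
  opprB addrA subrK.
Qed.

Lemma in_edge_strip_heightN w p q x : crosses (- w) p q x ->
  edge_strip w (p, q) x <-> 0 < height w p q x <= 1.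
Proof.
move=> h; have := crosses_det2 h; rewrite det2Nr oppr_gt0 => h0.
rewrite /edge_strip /edge_base /edge_dir /edge_vector /= ltNge (ltW h0) /= opprB -heightC.
by apply: in_strip_height; rewrite -crossesN.
Qed.

(** On the line through [x] in direction [w] the polygon is the segment between the crossing with
    its upper edge [p q] and the crossing with its lower edge [p' q']. *)
Lemma in_hull_heights w p q p' q' x : is_edge V p q -> is_edge V p' q' ->
  crosses w p q x -> crosses (- w) p' q' x ->
  A x <-> height w p q x <= 0 <= height w p' q' x.
Proof.
move=> e e' h h'; have h0 := crosses_det2 h; have h0' := crosses_det2 h'.
split=> [Ax|/andP[t1 t2]].
  have := edge_halfplane e Ax; have := edge_halfplane e' Ax => a1 a2.
  rewrite {1}/height ler_pdivrMr// mul0r a2 /=.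
  rewrite -oppr_le0 -heightN /height ler_pdivrMr// mul0r a1//.
have [pV qV _ _] := e; have [pV' qV' _ _] := e'.
have y1 := crossing_in_hull pV qV h; have y2 := crossing_in_hull pV' qV' h'.
rewrite heightN scaleNr scalerN opprK in y2.
move: (height w p q x) (height w p' q' x) t1 t2 y1 y2 => a b a0 b0 y1 y2.
have [ab|ab] := eqVneq (b - a) 0.
  have a1 : a = 0 by lra.
  by move: y1; rewrite a1 scale0r subr0.
have ab0 : 0 < b - a by rewrite lt_neqAle eq_sym ab; lra.
have := @convex_hull_segment _ _ _ _ _ (- a / (b - a)) y1 y2.
rewrite (_ : x - a *: w + _ = x); last first.
  rewrite (_ : x - b *: w - (x - a *: w) = (a - b) *: w); last by apply/rowP => i; rewrite !mxE; ring.
  rewrite scalerA (_ : _ * (a - b) = a) ?subrK//; field; exact: lt0r_neq0.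
by apply; [apply: divr_ge0; lra|rewrite ler_pdivrMr//; lra].
Qed.

End polygon_fourier.

Section polygon_indicator.
Context (R : realType) (V : seq 'rV[R]_2) (uV : uniq V).
Implicit Types (p q x w : 'rV[R]_2).
Local Notation A := (convex_hull [set` V]).

Lemma sum_two (T : eqType) (s : seq T) (F : T -> R) a b : uniq s -> a \in s -> b \in s -> a <> b ->
  (forall t, t \in s -> t <> a -> t <> b -> F t = 0) -> \sum_(t <- s) F t = F a + F b.
Proof.
move=> us sa sb /eqP ab h; rewrite (bigD1_seq a)//=; congr (_ + _).
rewrite -big_filter (bigD1_seq b) ?filter_uniq ?mem_filter ?sb ?andbT 1?eq_sym//=.
rewrite big1_seq ?addr0// => t /andP[/eqP tb]; rewrite mem_filter => /andP[/eqP ta ts].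
exact: h.
Qed.

(** Let [a <= b] be the heights of [x] over the upper and the lower edge. Membership of [x] reads
    [a <= 0 <= b], that of [x - w] reads [a <= 1 <= b], and the two strips contribute [0 < a <= 1]
    and [0 < b <= 1] with opposite signs; genericity excludes [b = 0] and [b = 1]. *)
Lemma polygon_indicator w x : generic V w x ->
  \1_A (x - w) - \1_A x = \sum_(pq <- edges V | det2 (edge_vector pq) w != 0)
    Num.sg (det2 (edge_vector pq) w) * \1_(edge_strip w pq) x :> R.
Proof.
move=> [gV gE].
have gN r : r \in V -> det2 r (- w) <> det2 x (- w) by move=> /gV h; rewrite !det2Nr => /oppr_inj.
have ind (E : set 'rV[R]_2) y (b : bool) : (E y <-> b) -> \1_E y = b%:R :> R.
  move=> Eb; rewrite indicE; congr ((nat_of_bool _)%:R); apply/idP/idP; first by move=> /set_mem/Eb.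
  by move=> hb; apply/mem_set/Eb.
pose F (pq : 'rV[R]_2 * 'rV[R]_2) : R := if det2 (edge_vector pq) w != 0 then
  Num.sg (det2 (edge_vector pq) w) * \1_(edge_strip w pq) x else 0.
rewrite big_mkcond -/(\sum_(pq <- edges V) F pq).
(* If the line through [x] separates no pair of vertices, it meets neither the polygon nor a strip,
   and both sides vanish. *)
have [[p0 [q0 [pV0 qV0 h0]]]|no] := pselect (exists p q, [/\ p \in V, q \in V & crosses w p q x]); last first.
  have nA y : (forall r, r \in V -> det2 r w <> det2 y w) -> (forall p q, crosses w p q y = crosses w p q x) -> ~ A y.
    move=> gy cy /(hull_crossed gy)[p [q [pV qV]]]; rewrite cy => h.
    by apply: no; exists p, q.
  rewrite (ind A (x - w) false) ?(ind A x false); last 2 first.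
  - by split=> // /(nA x gV (fun p q => erefl _)).
  - split=> // Axw; case: (nA (x - w) _ _ Axw) => [r /gV|p q]; last exact: crosses_shift.
    by rewrite det2Bl det2vv subr0.
  rewrite subrr big1_seq// => pq /andP[_ epq]; rewrite /F; case: ifPn => // n0.
  rewrite (ind _ _ false) ?mulr0//; split=> // st; have := (mem_edges V pq).1 epq => e.
  have [pV qV _ _] := e; have [h|] := in_edge_strip n0 st gV e; first by case: no; exists pq.1, pq.2.
  by rewrite crossesN => h; case: no; exists pq.2, pq.1.
have [p [q [e h]]] := top_edge_exists gV (ex_intro _ p0 (ex_intro _ q0 (And3 pV0 qV0 h0))).
have hN0 : crosses (- w) q0 p0 x by rewrite crossesN.
have [p' [q' [e' h']]] := top_edge_exists gN (ex_intro _ q0 (ex_intro _ p0 (And3 qV0 pV0 hN0))).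
have s1 := crosses_det2 h; have s2 := crosses_det2 h'; rewrite det2Nr oppr_gt0 in s2.
rewrite (@sum_two _ _ F (p, q) (p', q')); last first.
- move=> [a b] eab nab nab'; rewrite /F; case: ifPn => // n0; rewrite (ind _ _ false) ?mulr0//; split=> // st.
  have eab' := (mem_edges V (a, b)).1 eab.
  have [hab|hab] := in_edge_strip n0 st gV eab'.
    by have [ap bq] := top_edge_unique eab' e hab h; case: nab; rewrite /= in ap bq; rewrite ap bq.
  by have [ap bq] := top_edge_unique eab' e' hab h'; case: nab'; rewrite /= in ap bq; rewrite ap bq.
- by move=> [ab1 ab2]; move: s1 s2; rewrite ab1 ab2; lra.
- by apply/mem_edges.
- by apply/mem_edges.
- exact: uniq_edges.
rewrite /F /edge_vector /= gt_eqF// lt_eqF//= gtr0_sg// ltr0_sg// mul1r mulN1r.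
have n2 : det2 (q' - p') w != 0 by rewrite lt_eqF.
have [_ g2] := gE (p', q') ((mem_edges V (p', q')).2 e') n2.
have [g1 _] := gE (p', q') ((mem_edges V (p', q')).2 e') n2.
rewrite /edge_vector /= in g1 g2.
have t20 : height w p' q' x != 0 by rewrite mulf_neq0 ?invr_neq0//; exact/eqP.
have t21 : height w p' q' x != 1.
  by apply/eqP => t1; apply: g2; rewrite -[RHS]mul1r -t1 /height divfK.
have hs : crosses w p q (x - w) by rewrite crosses_shift.
have hs' : crosses (- w) p' q' (x - w) by rewrite crossesN crosses_shift -crossesN.
have shift a b : det2 (b - a) w != 0 -> height w a b (x - w) = height w a b x - 1.
  by move=> n0; have := @height_shift _ w a b x (-1) n0; rewrite scaleN1r.
rewrite (ind _ _ _ (in_hull_heights e e' h h')) (ind _ _ _ (in_hull_heights e e' hs hs')).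
rewrite (ind _ _ _ (in_edge_strip_height h)) (ind _ _ _ (in_edge_strip_heightN h')).
rewrite !shift ?n2 ?(gt_eqF s1)//.
have ab : height w p q x <= height w p' q' x.
  have [pV' qV' _ _] := e'; have y2 := crossing_in_hull pV' qV' h'.
  have := edge_halfplane e y2; rewrite heightN scaleNr scalerN opprK => hh.
  move: hh; set t := height w p' q' x; rewrite (_ : x - t *: w - p = (x - p) - t *: w); last by rewrite addrAC.
  by rewrite (det2Br (x - p)) det2Zr subr_le0 /height ler_pdivrMr.
move: (height w p q x) (height w p' q' x) t20 t21 ab => a b b0 b1 ab.
rewrite subr_le0 subr_ge0; case: (ltgtP b 0) b0 => // b0 _; case: (ltgtP b 1) b1 => // b1 _;
  case: (lerP a 0) => a0; case: (lerP a 1) => a1 /=; lra.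
Qed.

End polygon_indicator.

Section closed_measurable.
Context (R : realType) (d : nat).

Lemma measurable_open_set (U : set 'rV[R]_d) : open U -> measurable (U : set (lebesgueRn R d)).
Proof.
move=> oU; pose q (ab : 'rV[rat]_d * 'rV[rat]_d) : 'rV[R]_d * 'rV[R]_d :=
  (map_mx ratr ab.1, map_mx ratr ab.2).
have -> : U = \bigcup_(ab in [set ab | box (q ab) `<=` U]) box (q ab).
  apply/seteqP; split=> x; last by move=> [ab h]; exact: h.
  move=> Ux; have /nbhs_ballP[e /= e0 he] : nbhs x U by exact: open_nbhs_nbhs.
  have e2 : 0 < e / 2 by lra.
  have /choice[a ha] (i : 'I_d) : exists a : rat, x ord0 i - e / 2 < ratr a < x ord0 i.
    have [|a] := @rat_in_itvoo R (x ord0 i - e / 2) (x ord0 i); first lra.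
    by rewrite in_itv /= => h; exists a.
  have /choice[b hb] (i : 'I_d) : exists b : rat, x ord0 i < ratr b < x ord0 i + e / 2.
    have [|b] := @rat_in_itvoo R (x ord0 i) (x ord0 i + e / 2); first lra.
    by rewrite in_itv /= => h; exists b.
  exists (\row_i a i, \row_i b i).
    move=> y hy; apply: he; rewrite -ball_normE /= [ltLHS]mx_normrE.
    apply/bigmax_ltP; split=> // -[j i] _ /=; rewrite (ord1 j) !mxE.
    have := hy i; rewrite !mxE; have := ha i; have := hb i => /andP[? ?] /andP[? ?] /andP[? ?].
    by rewrite ltr_norml; apply/andP; split; lra.
  move=> i; rewrite !mxE; have /andP[_ ->] := ha i; have /andP[h _] := hb i.
  exact: ltW.
apply: countable_bigcup_measurable => [|ab]; last exact: box_measurable.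
exact: countableP.
Qed.

Lemma measurable_closed_set (F : set 'rV[R]_d) : closed F -> measurable (F : set (lebesgueRn R d)).
Proof.
by move=> cF; rewrite -[F]setCK; apply: measurableC; apply: measurable_open_set; exact: closed_openC.
Qed.

End closed_measurable.

Section almost_everywhere.
Context (R : realType).

(** The difference has zero seminorm, and Cauchy-Schwarz annihilates its products. *)
Lemma dot_ae_eq d (Om N : set 'rV[R]_d) (f g h : 'rV[R]_d -> R[i]^o) : domain Om ->
  in_L2 Om f -> in_L2 Om g -> in_L2 Om h -> lebesgue_outer N = 0%E ->
  (forall x, ~ N x -> f x = g x) -> L2_dot Om f h = L2_dot Om g h.
Proof.
move=> dOm f2 g2 h2 N0 fg; have hd := domain_semi_inner dOm; have [bOm mOm _] := dOm.
have fg2 := subspaceB hd f2 g2; have mN := null_measurable N0.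
have n0 : nsq (@L2_dot R d Om) (f - g) = 0.
  apply: EFin_inj; rewrite -(L2_dotE mOm fg2) L2_normsqE.
  have [mfg _] := (in_L2P _ _).1 fg2.
  have ms := (measurable_EFinP _ _).2 (measurable_sqnorm mfg).
  rewrite (ge0_negligible_integral mN mOm ms); last 2 first.
  - by move=> x _; rewrite lee_fin sqnorm_ge0.
  - exact: N0.
  rewrite (eq_integral (fun=> 0%E)) ?integral0// => x /set_mem[_ nNx].
  by rewrite !fctE fg// subrr sqnorm0.
apply/eqP; rewrite -subr_eq0 -(dotBl hd)// -sqnorm_eq0 eq_le sqnorm_ge0 andbT.
by have := cauchy_schwarz hd fg2 h2; rewrite n0 mul0r.
Qed.

End almost_everywhere.

Section polygon_expint.
Context (R : realType) (V : seq 'rV[R]_2) (uV : uniq V).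
Implicit Types (p q x w l : 'rV[R]_2).
Local Notation A := (convex_hull [set` V]).
Local Notation mu := (@lebesgue_measure_Rn R 2).
Hypothesis mA : measurable (A : set (lebesgueRn R 2)).
Hypothesis bA : bounded_set A.

(** The identity between indicators, multiplied by an exponential and integrated over a cube that
    contains all the sets involved. *)
Lemma polygon_expint w l : w != 0 ->
  (cis (euclid_dot l w) - 1) * expint A l =
  \sum_(pq <- edges V | det2 (edge_vector pq) w != 0)
    (Num.sg (det2 (edge_vector pq) w))%:C%C * expint (edge_strip w pq) l.
Proof.
move=> w0; pose E := [seq pq <- edges V | det2 (edge_vector pq) w != 0].
rewrite -big_filter -/E.
have bP pq : pq \in E -> bounded_set (edge_strip w pq).
  by rewrite mem_filter => /andP[n0 _]; apply: bounded_parallelogram; rewrite gt_eqF// det2_edge_dir.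
have mP pq : measurable (edge_strip w pq : set (lebesgueRn R 2)) by exact: measurable_parallelogram.
have bS := bounded_shift w bA; have mS := measurable_shift_set w mA.
have [T [T0 hT]] : exists T : R, 0 < T /\ forall x, A x \/ shift_set w A x \/
    (exists2 pq, pq \in E & edge_strip w pq x) -> `|x| <= T.
  have [T1 [T10 h1]] := bounded_setP bA; have [T2 [T20 h2]] := bounded_setP bS.
  have [T3 [T30 h3]] : exists T : R, 0 < T /\ forall x pq, pq \in E -> edge_strip w pq x -> `|x| <= T.
    elim: E bP => [|pq s IH] hb; first by exists 1.
    have [|T [T0' hT]] := IH; first by move=> pq' h; apply: hb; rewrite inE h orbT.
    have [T' [T'0 hT']] := bounded_setP (hb pq (mem_head _ _)).
    exists (T + T'); split=> [|x pq']; first lra.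
    rewrite inE => /predU1P[->|h] hx; first by have := hT' x hx; lra.
    by have := hT x pq' h hx; lra.
  exists (T1 + T2 + T3); split; first lra.
  move=> x [/h1|[/h2|[pq h /(h3 _ _ h)]]] hx; lra.
pose Om : set 'rV[R]_2 := cube (T + 1).
have AO x : A x \/ shift_set w A x \/ (exists2 pq, pq \in E & edge_strip w pq x) -> Om x.
  by move=> /hT xT; apply: in_cube; lra.
have dOm : domain Om.
  split; [exact: bounded_box|exact: box_measurable|].
  rewrite /volume [X in fine X](lebesgue_outer_box (ltn0Sn 1)) /= /box_volume.
  apply: prodr_gt0 => i _; rewrite !mxE lt_max; apply/orP; right; lra.
have hd := domain_semi_inner dOm.
have L2c (F : set 'rV[R]_2) : measurable (F : set (lebesgueRn R 2)) -> in_L2 Om (cutoff F l) := L2_cutoff dOm l.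
have dotc (F : set 'rV[R]_2) : measurable (F : set (lebesgueRn R 2)) -> F `<=` Om ->
    L2_dot Om (cutoff F l) (exponential 0) = expint F l.
  by move=> mF FO; rewrite (dot_cutoff_exponential l 0 mF FO) subr0.
have L20 := domain_exponential (0 : 'rV[R]_2) dOm.
pose g : 'rV[R]_2 -> R[i]^o := \sum_(pq <- E) (Num.sg (det2 (edge_vector pq) w))%:C%C *: (cutoff (edge_strip w pq) l).
have term2 pq : in_L2 Om ((Num.sg (det2 (edge_vector pq) w))%:C%C *: (cutoff (edge_strip w pq) l)).
  exact: (subspaceZ hd _ (L2c _ (mP pq))).
have g2 : in_L2 Om g by apply: (subspace_sum hd) => pq _; exact: term2.
have dotg : L2_dot Om g (exponential 0) =
    \sum_(pq <- E) (Num.sg (det2 (edge_vector pq) w))%:C%C * expint (edge_strip w pq) l.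
  rewrite /g (dot_suml hd (fun pq _ => term2 pq) L20).
  rewrite big_seq [RHS]big_seq; apply: eq_bigr => pq epq.
  rewrite (dotZl hd _ (L2c _ (mP pq)) L20) (dotc _ (mP pq)) // => x hx.
  by apply: AO; right; right; exists pq.
have f2 := subspaceB hd (L2c _ mS) (L2c _ mA).
have := dot_ae_eq dOm f2 g2 L20 (null_not_generic V w0) _.
rewrite dotg (dotBl hd (L2c _ mS) (L2c _ mA) L20).
have AO1 : A `<=` Om by move=> x hx; apply: AO; left.
have AO2 : shift_set w A `<=` Om by move=> x hx; apply: AO; right; left.
rewrite (dotc _ mS AO2) (dotc _ mA AO1).
rewrite (expint_shift w l mA bA) => <-; first by ring.
move=> x /contrapT gx; have := polygon_indicator uV gx; rewrite -big_filter -/E => pi.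
rewrite /g fct_sumE !fctE /cutoff /cindic -mulrBl -rmorphB/= (_ : \1_(shift_set w A) x = \1_A (x - w)); last first.
  by rewrite !indicE; congr ((nat_of_bool _)%:R).
rewrite pi rmorph_sum mulr_suml; apply: eq_bigr => pq _.
by rewrite rmorphM/= -mulrA.
Qed.

(** Rescaling [w] by [h > 0] changes neither bases nor directions of the edges. With the pairing of
    [l] and [h w] equal to plus or minus 1/2, the factor [segint] common to all strips is nonzero
    and cancels. *)
Lemma zero_edge_sum w l : expint A l = 0 -> euclid_dot l w != 0 ->
  \sum_(pq <- edges V | det2 (edge_vector pq) w != 0)
    (Num.sg (det2 (edge_vector pq) w) * area (edge_dir w pq) w)%:C%C *
    (cis (euclid_dot l (edge_base w pq)) * segint (euclid_dot l (edge_dir w pq))) = 0.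
Proof.
move=> l0 lw; have lw0 : 0 < `|euclid_dot l w| by rewrite normr_gt0.
have w0 : w != 0 by apply: contra lw => /eqP->; rewrite euclid_dotC euclid_dot0l.
pose h := (2 * `|euclid_dot l w|)^-1; have h0 : 0 < h by rewrite invr_gt0 mulr_gt0.
have hw0 : h *: w != 0 by rewrite scaler_eq0 negb_or gt_eqF.
have := polygon_expint l hw0; rewrite l0 mulr0 => /esym.
have dh pq : det2 (edge_vector pq) (h *: w) = h * det2 (edge_vector pq) w by rewrite det2Zr.
have baseE pq : edge_base (h *: w) pq = edge_base w pq by rewrite /edge_base dh pmulr_rgt0.
have dirE pq : edge_dir (h *: w) pq = edge_dir w pq by rewrite /edge_dir dh pmulr_rgt0.
set S := \sum_(_ <- _ | _) _ => S0.
have s1 : segint (euclid_dot l (h *: w)) <> 0.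
  rewrite euclid_dotZr => /segint_eq0[[k kE] _].
  have : `|h * euclid_dot l w| = 2^-1.
    by rewrite normrM (gtr0_norm h0) /h; field; rewrite gt_eqF.
  rewrite kE -intr_norm => k2; have : (2 * `|k|)%:~R = 1%:~R :> R by rewrite intrM k2; field.
  by move/intr_inj; lia.
have : h%:C%C * segint (euclid_dot l (h *: w)) * (\sum_(pq <- edges V | det2 (edge_vector pq) w != 0)
    (Num.sg (det2 (edge_vector pq) w) * area (edge_dir w pq) w)%:C%C *
    (cis (euclid_dot l (edge_base w pq)) * segint (euclid_dot l (edge_dir w pq)))) = 0.
  rewrite -[RHS]S0 /S mulr_sumr; apply: eq_big => [pq|pq n0]; first by rewrite dh mulf_eq0 (gt_eqF h0).
  have dp := det2_edge_dir n0.
  rewrite /edge_strip baseE dirE expint_parallelogram; last by rewrite det2Zr mulf_neq0// gt_eqF.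
  have ae : area (edge_dir w pq) (h *: w) = h * area (edge_dir w pq) w.
    by have := area_scale (lt0r_neq0 dp) ltr01 h0; rewrite scale1r mul1r.
  by rewrite dh sgrM (gtr0_sg h0) mul1r ae !(rmorphM (real_complex R)); ring.
move/eqP; rewrite !mulf_eq0 => /orP[/orP[|]/eqP|/eqP//].
  by move=> /(congr1 (@complex.Re R)) /= h00; rewrite h00 ltxx in h0.
by [].
Qed.

End polygon_expint.

(** * Spectra of the factors from a group of frequencies *)

Section group_reduction.
Context (R : realType) (n m : nat) (n0 : (0 < n)%N) (m0 : (0 < m)%N).
Context (A : set 'rV[R]_n) (B : set 'rV[R]_m) (dA : domain A) (dB : domain B).
Context (G : set 'rV[R]_n).
Hypothesis G0 : G 0.
Hypothesis GB : forall x y, G x -> G y -> G (x - y).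
Hypothesis GA : forall x, G x -> x <> 0 -> expint A x = 0.
Context (Lam : set 'rV[R]_(n + m)).
Hypothesis sL : is_spectrum Lam (cartesian A B).
Hypothesis pairs : forall l k, Lam l -> Lam k ->
  G (lsubmx (l - k)) \/ expint B (rsubmx (l - k)) = 0.

Let mA : measurable (A : set (lebesgueRn R n)). Proof. by case: dA. Qed.
Let mB : measurable (B : set (lebesgueRn R m)). Proof. by case: dB. Qed.
Let dAB : domain (cartesian A B). Proof. exact: domain_cartesian. Qed.

Let GN x : G x -> G (- x).
Proof. by move=> Gx; rewrite -sub0r; exact: GB. Qed.

Let GD x y : G x -> G y -> G (x + y).
Proof. by move=> Gx Gy; rewrite -[y]opprK; apply: GB => //; exact: GN. Qed.

Let span f : in_L2 (cartesian A B) f -> ecspan (cartesian A B) Lam f.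
Proof. by case: sL => _ _ cL; exact: (complete_exponentialsP Lam dAB).1 cL f. Qed.

Let LeA z := domain_exponential z dA.
Let LeB z := domain_exponential z dB.

Let dotr (f : 'rV[R]_n -> R[i]^o) z k : in_L2 A f ->
  L2_dot (cartesian A B) (tensor f (exponential z)) (exponential k) =
  L2_dot A f (exponential (lsubmx k)) * expint B (z - rsubmx k).
Proof.
by move=> f2; rewrite [exponential k]exponential_tensor
  (L2_dot_tensor n0 m0 mA mB f2 (LeB z) (LeA _) (LeB _)) L2_dot_exponential.
Qed.

(** The tensor of [f] with the exponential of the second component of [l] is orthogonal to all
    frequencies outside the class of [l], since there the factor over [B] vanishes. So the class
    alone spans it, and the span projects to [A]. *)
Lemma spectrum_left l : Lam l ->
  is_spectrum (@lsubmx R 1 n m @` (Lam `&` [set k | G (lsubmx (l - k))])) A.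
Proof.
move=> Ll; have [cL oL _] := sL; split.
- by apply: sub_countable (card_image_le _ _) _; apply: sub_countable (subset_card_le _) cL => x [].
- move=> _ _ [k [Lk Gk] <-] [k' [Lk' Gk'] <-] kk'; rewrite L2_dot_exponential; apply: GA.
    have := GB Gk' Gk; rewrite (_ : _ - _ = lsubmx k - lsubmx k')//.
    by apply/rowP => i; rewrite !mxE; ring.
  by move=> /eqP; rewrite subr_eq0 => /eqP.
apply/(complete_exponentialsP _ dA) => f f2.
have LB := LeB (rsubmx l); have T2 := L2_tensor n0 m0 mA mB f2 LB.
have h : ecspan (cartesian A B) (Lam `&` [set k | G (lsubmx (l - k))]) (tensor f (exponential (rsubmx l))).
  apply: (ecspan_restrict dAB oL (@subset_refl _ Lam) T2 (span T2)) => k Lk /= nG.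
  rewrite dotr//; have [//|] := pairs Ll Lk.
  by rewrite linearB /= => ->; rewrite mulr0.
exact: (ecspan_projl n0 m0 mA mB dA dB f2 h).
Qed.

Definition coset_repr x : 'rV[R]_n := get [set y | G (y - x)].

Lemma coset_reprP x : G (coset_repr x - x).
Proof. by apply: (@getPex _ [set y | G (y - x)]); exists x; rewrite /= subrr. Qed.

Lemma coset_repr_eq x y : G (x - y) -> coset_repr x = coset_repr y.
Proof.
move=> h; congr get; apply/seteqP; split=> z /= Gz.
  by have := GD Gz h; rewrite addrA subrK.
by have := GB Gz h; rewrite opprB addrA subrK.
Qed.

(** Chosen frequencies of one class share their first component, so their orthogonality falls to
    [B]. For completeness, the tensor of the class representative with the second component of [l]
    is orthogonal to every frequency not chosen: either the factor over [B] vanishes, or the first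
    components differ by a nonzero element of [G]. *)
Lemma spectrum_right :
  is_spectrum (@rsubmx R 1 n m @` (Lam `&` [set k | lsubmx k = coset_repr (lsubmx k)])) B.
Proof.
have [cL oL _] := sL; have [bA _ _] := dA; have [bB _ _] := dB; split.
- by apply: sub_countable (card_image_le _ _) _; apply: sub_countable (subset_card_le _) cL => x [].
- move=> _ _ [k [Lk /= rk] <-] [k' [Lk' /= rk'] <-] kk'; rewrite L2_dot_exponential.
  have [Gk|] := pairs Lk Lk'; last by rewrite linearB.
  have e : lsubmx k = lsubmx k'.
    by rewrite rk rk'; apply: coset_repr_eq; rewrite -linearB.
  have kneq : k <> k' by move=> kk; apply: kk'; rewrite kk.
  have := oL _ _ Lk Lk' kneq; rewrite L2_dot_exponential (expint_cartesian n0 m0 mA mB)// !linearB /= e subrr.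
  by move=> /eqP; rewrite mulf_eq0 (negPf (domain_expint0_neq0 dA)) => /eqP.
have cB : complete_exponentials (@rsubmx R 1 n m @` Lam) B.
  apply/(complete_exponentialsP _ dB) => g g2.
  exact: (ecspan_projr n0 m0 mA mB dA dB g2 (span (L2_tensor n0 m0 mA mB (LeA 0) g2))).
apply: (complete_of_total dB cB) => _ [l Ll <-].
pose r := coset_repr (lsubmx l).
have T2 := L2_tensor n0 m0 mA mB (LeA r) (LeB (rsubmx l)).
have h : ecspan (cartesian A B) (Lam `&` [set k | lsubmx k = coset_repr (lsubmx k)])
    (tensor (exponential r) (exponential (rsubmx l))).
  apply: (ecspan_restrict dAB oL (@subset_refl _ Lam) T2 (span T2)) => k Lk /= nk.
  rewrite dotr// L2_dot_exponential; have [Gk|] := pairs Ll Lk; last first.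
    by rewrite linearB /= => ->; rewrite mulr0.
  rewrite linearB /= in Gk; rewrite GA ?mul0r//.
    by have := GD (coset_reprP (lsubmx l)) Gk; rewrite addrA subrK.
  move=> /eqP; rewrite subr_eq0 => /eqP rk; apply: nk; rewrite -rk.
  by rewrite rk -(coset_repr_eq Gk).
exact: (ecspan_projr n0 m0 mA mB dA dB (LeB _) h).
Qed.

End group_reduction.

(** * Straightening a spectrum along one direction *)

Section integer_reduction.
Context (R : realType) (d : nat) (Om : set 'rV[R]_d) (dOm : domain Om).
Context (chi : 'rV[R]_d -> R) (eps : 'rV[R]_d) (K : 'rV[R]_d -> R).
Hypothesis chiB : forall x y, chi (x - y) = chi x - chi y.
Hypothesis chiZ : forall (t : R) x, chi (x + t *: eps) = chi x + t.
Hypothesis KZ : forall (t : R) x, K (x + t *: eps) = K x.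
Hypothesis expintE : forall x, sqnorm (expint Om x) = sqnorm (segint (chi x)) * K x.
Context (Lam : set 'rV[R]_d) (sL : is_spectrum Lam Om).

Let bOm : bounded_set Om. Proof. by case: dOm. Qed.
Let mOm : measurable (Om : set (lebesgueRn R d)). Proof. by case: dOm. Qed.
Let v0 : 0 < volume Om. Proof. by case: dOm. Qed.
Let oL : orthogonal_exponentials Lam Om. Proof. by case: sL. Qed.
Let cL : complete_exponentials Lam Om. Proof. by case: sL. Qed.
Let hd := domain_semi_inner dOm.
Let He l := domain_exponential l dOm.
Let ne l : nsq (@L2_dot R d Om) (exponential l) = volume Om.
Proof. exact: nsq_exponential. Qed.
Let span l : ecspan Om Lam (exponential l).
Proof. exact: (complete_exponentialsP Lam dOm).1 cL _ (He l). Qed.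

Let chi0 : chi 0 = 0.
Proof. by rewrite -[in LHS](subrr 0) chiB subrr. Qed.

Let expint_eq0 x : expint Om x = 0 <-> segint (chi x) = 0 \/ K x = 0.
Proof.
split=> [h|h]; last first.
  by apply/eqP; rewrite -sqnorm_eq0 expintE; case: h => ->; rewrite ?sqnorm0 ?mul0r ?mulr0.
have := expintE x; rewrite h sqnorm0 => /esym/eqP; rewrite mulf_eq0 sqnorm_eq0.
by move=> /orP[/eqP|/eqP]; [left|right].
Qed.

Let orth l k : Lam l -> Lam k -> l <> k ->
  (is_integer (chi l - chi k) /\ chi l - chi k <> 0) \/ K (l - k) = 0.
Proof.
move=> Ll Lk lk; have := oL Ll Lk lk; rewrite L2_dot_exponential => /expint_eq0.
by rewrite chiB => -[/segint_eq0|]; [left|right].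
Qed.

(** If orthogonality of [l] and [k] comes from [segint], an integer shift of [chi] keeps the zero
    unless the difference becomes 0; if it comes from [K], the shift does not matter. So only the
    frequencies with the stated [chi] contribute. *)
Let fibre_span l (r : R) : Lam l -> is_integer r ->
  ecspan Om [set k | Lam k /\ chi k = chi l + r] (exponential (l + r *: eps)).
Proof.
move=> Ll ri; apply: (@ecspan_sub _ _ _ (Lam `&` [set k | chi k = chi l + r])) => //.
apply: (ecspan_restrict dOm oL (@subset_refl _ Lam) (He _) (span _)) => k Lk nk.
rewrite L2_dot_exponential; apply/expint_eq0; rewrite chiB chiZ.
rewrite (_ : l + r *: eps - k = (l - k) + r *: eps) ?KZ; last by rewrite addrAC.
have [lk|/eqP lk] := eqVneq l k.
  left; apply/segint_eq0; rewrite -lk addrAC subrr add0r; split=> // r0.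
  by apply: nk; rewrite /= -lk r0 addr0.
have [[i _]|] := orth Ll Lk lk; last by right.
left; apply/segint_eq0; split; first by rewrite addrAC; exact: is_integerD.
by move=> /eqP; rewrite subr_eq0 => /eqP h; apply: nk => /=; rewrite h.
Qed.

(** Multiplication by [exponential v] is an isometry of L^2. *)
Lemma ecspan_shift v S l : ecspan Om S (exponential l) ->
  ecspan Om [set k + v | k in S] (exponential (l + v)).
Proof.
move=> Sl e e0; have [_ [ps [Sps ->]] hv] := Sl e e0.
exists (\sum_(p <- ps) p.1 *: (exponential (p.2 + v) : 'rV[R]_d -> R[i]^o)).
  exists [seq (p.1, p.2 + v) | p <- ps]; split; last by rewrite big_map.
  by move=> q /mapP[p /Sps Sp ->]; exists p.2.
move: hv; congr (_ < _); rewrite /nsq /L2_dot; congr (complex.Re (complex_integral _ _)).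
apply/funext => x; rewrite (_ : (exponential (l + v) - _) x = (exponential l - \sum_(p <- ps) p.1 *: (exponential p.2 : _ -> R[i]^o)) x * exponential v x).
  by rewrite conjcM mulrACA [exponential v x * _]mulr_conjc sqnorm_exponential mulr1.
rewrite !fctE !fct_sumE mulrBl exponentialD; congr (_ - _); rewrite mulr_suml.
by apply: eq_bigr => p _; rewrite !fctE exponentialD -!mulrA.
Qed.

Definition eps_line l : set 'rV[R]_d := [set x | exists2 j, is_integer j & x = l + j *: eps].

Let chi_eps l (j : R) : chi (l + j *: eps) = chi l + j. Proof. exact: chiZ. Qed.

Let K0 : K 0 = volume Om ^+ 2.
Proof.
have := expintE 0; rewrite (domain_expint0 dOm) sqnorm_real chi0 segint0 => ->.
by rewrite (_ : sqnorm 1 = 1) ?mul1r// /sqnorm /= expr1n expr0n addr0.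
Qed.

Let line_orthogonal l : orthogonal_exponentials (eps_line l) Om.
Proof.
move=> _ _ [j ji ->] [j' j'i ->] jj'; rewrite L2_dot_exponential; apply/expint_eq0; left.
apply/segint_eq0; rewrite chiB !chi_eps opprD addrACA subrr add0r; split; first exact: is_integerB.
by move=> /eqP; rewrite subr_eq0 => /eqP h; apply: jj'; rewrite h.
Qed.

(** The frequencies [k] of [Lam] that contribute are grouped by the integer [j = chi k - chi l].
    Bessel at [l + j eps], where the [segint] factor is 1, bounds the sum of [K (l - k)] in each
    group by [K 0], the value along the line; so the sum over the line is at least the one over
    [Lam], which reaches the norm. *)
Let line_span l (s : R) : Lam l -> ecspan Om (eps_line l) (exponential (l + s *: eps)).
Proof.
move=> Ll; apply: (cspan_parseval hd v0 (fun k (_ : eps_line l k) => He k) (fun k _ => ne k)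
  (@line_orthogonal l) (@subset_refl _ _) (He _)) => e e0.
pose Lam' := Lam `&` [set k | is_integer (chi k - chi l)].
have span' : ecspan Om Lam' (exponential (l + s *: eps)).
  apply: (ecspan_restrict dOm oL (@subset_refl _ Lam) (He _) (span _)) => k Lk nk.
  rewrite L2_dot_exponential; apply/expint_eq0; right.
  rewrite (_ : l + s *: eps - k = (l - k) + s *: eps) ?KZ; last by rewrite addrAC.
  have [lk|/eqP lk] := eqVneq l k; first by case: nk; rewrite /= lk subrr; exact: is_integer0.
  by have [[i _]|//] := orth Ll Lk lk; case: nk; rewrite /= -opprB; exact: is_integerN.
have [t [ut tL ht]] := parseval hd v0 (fun k (_ : Lam k) => He k) (fun k _ => ne k) oL
  (@subIsetl _ Lam [set k | is_integer (chi k - chi l)]) (He _) span' e0.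
pose g k := chi k - chi l; pose J := undup [seq g k | k <- t].
have injJ : {in J &, injective (fun j => l + j *: eps)}.
  by move=> j j' _ _ /(congr1 chi); rewrite !chi_eps => /addrI.
exists [seq l + j *: eps | j <- J]; split.
- by rewrite map_inj_in_uniq ?undup_uniq.
- move=> _ /mapP[j + ->]; rewrite mem_undup => /mapP[k kt ->]; exists (g k) => //.
  by have [_] := tL k kt.
apply: (lt_le_trans ht); rewrite big_map.
have dE k : sqnorm (L2_dot Om (exponential (l + s *: eps)) (exponential k)) = sqnorm (segint (s - g k)) * K (l - k).
  rewrite L2_dot_exponential expintE chiB chi_eps; congr (sqnorm (segint _) * _); first by rewrite /g; ring.
  by rewrite (_ : l + s *: eps - k = (l - k) + s *: eps) ?KZ// addrAC.
rewrite [leLHS](eq_bigr _ (fun k _ => dE k)).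
apply: (@le_trans _ _ (\sum_(j <- J) \sum_(k <- t | g k == j) sqnorm (segint (s - g k)) * K (l - k))).
  rewrite (exchange_big_dep xpredT) //= le_eqVlt; apply/orP; left; apply/eqP.
  rewrite big_seq [RHS]big_seq; apply: eq_bigr => k kt.
  have gJ : g k \in J by rewrite mem_undup map_f.
  rewrite big_mkcond (bigD1_seq (g k)) ?undup_uniq//= eqxx big1 ?addr0// => j jg.
  by rewrite eq_sym (negPf jg).
rewrite big_seq [leRHS]big_seq; apply: ler_sum => j; rewrite mem_undup => /mapP[k0 k0t jE].
have ji : is_integer j by rewrite jE; have [_] := tL k0 k0t.
rewrite L2_dot_exponential expintE (_ : l + s *: eps - (l + j *: eps) = 0 + (s - j) *: eps); last first.
  by rewrite opprD addrACA subrr add0r -scalerBl add0r.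
rewrite chi_eps chi0 add0r KZ K0 (eq_bigr (fun k => sqnorm (segint (s - j)) * K (l - k))); last first.
  by move=> k /eqP->.
rewrite -mulr_sumr ler_wpM2l ?sqnorm_ge0// -big_filter.
have := bessel hd v0 (fun k (_ : Lam k) => He k) (fun k _ => ne k) oL (He (l + j *: eps))
  (filter_uniq (fun k => g k == j) ut).
rewrite ne -expr2; set F := [seq _ <- _ | _] => bs; apply: (le_trans _ (bs _)); last first.
  by move=> k; rewrite mem_filter => /andP[_ /tL[]].
rewrite big_seq [leRHS]big_seq; apply: ler_sum => k; rewrite mem_filter => /andP[/eqP gk _].
rewrite L2_dot_exponential expintE chiB chi_eps (_ : chi l + j - chi k = 0) ?segint0; last first.
  by rewrite -gk /g; ring.
rewrite (_ : l + j *: eps - k = (l - k) + j *: eps) ?KZ; last by rewrite addrAC.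
by rewrite (_ : sqnorm 1 = 1) ?mul1r// /sqnorm /= expr1n expr0n addr0.
Qed.

(** Each frequency with [chi] in [[0, 1)] is replaced by all the points with integer [chi] on its
    line in direction [eps]. *)
Definition integer_reduction : set 'rV[R]_d := [set x | exists l r,
  [/\ Lam l, 0 <= chi l < 1, is_integer (chi l + r) & x = l + r *: eps]].

(** For distinct base points the values of [chi] differ by less than 1, so their orthogonality must
    come from [K], which is constant along [eps]. *)
Let reduction_orthogonal : orthogonal_exponentials integer_reduction Om.
Proof.
move=> _ _ [l [r [Ll cl ir ->]]] [l' [r' [Ll' cl' ir' ->]]] xx'.
rewrite L2_dot_exponential; apply/expint_eq0.
have [ll|/eqP ll] := eqVneq l l'.
  left; apply/segint_eq0; rewrite chiB !chi_eps; split; first exact: is_integerB.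
  rewrite ll opprD addrACA subrr add0r => /eqP; rewrite subr_eq0 => /eqP rr.
  by apply: xx'; rewrite ll rr.
right; rewrite (_ : _ - _ = (l - l') + (r - r') *: eps); last first.
  by rewrite scalerBl opprD addrACA.
rewrite KZ; have [[[k kE] kn0]|//] := orth Ll Ll' ll; exfalso; apply: kn0.
have : `|chi l - chi l'| < 1 by rewrite ltr_norml; lra.
rewrite kE -intr_norm -[1](mulr1z 1) ltr_int => k1.
by have -> : k = 0 by lia.
Qed.

(** With [k] the integer part of [chi l], an exponential of [Lam] is spanned by shifts by [k] of
    frequencies [m] with [chi m] in [[0, 1)]. Each of these is spanned by the integer points of its
    line, since by [ecspan_shift] the sampling of a line may start at any offset, here [- chi m]. *)
Lemma integer_reduction_spectrum : is_spectrum integer_reduction Om.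
Proof.
have [del del0 sep] := orthogonal_separated dOm.
split; [exact: (separated_countable del0 (sep _ reduction_orthogonal))|exact: reduction_orthogonal|].
apply: (complete_of_total dOm cL) => l Ll; pose k : R := (Num.floor (chi l))%:~R.
have ki : is_integer k by exists (Num.floor (chi l)).
have /andP[k1 k2] : k <= chi l < k + 1.
  by have /andP[h1 h2] := floor_itv (chi l); rewrite h1; move: h2; rewrite intrD.
have h := ecspan_shift (k *: eps) (fibre_span Ll (is_integerN ki)).
rewrite scaleNr subrK in h; apply: (ecspan_trans dOm (He l) _ h) => _ [m [Lm cm] <-].
pose th := chi m.
have := ecspan_shift (- (th *: eps)) (line_span (k + th) Lm).
rewrite (_ : m + (k + th) *: eps - th *: eps = m + k *: eps); last first.
  by rewrite scalerDl addrA addrK.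
apply: ecspan_sub => _ [_ [j ji ->] <-]; exists m, (j - th); split=> //.
- by rewrite cm; apply/andP; split; lra.
- by rewrite /th addrC subrK.
- by rewrite scalerBl addrA.
Qed.

End integer_reduction.

(** * Asymptotics along the normal of an edge *)

Section sums.
Context (R : realType).

Lemma sqnorm_sum_le (I : eqType) (s : seq I) (F : I -> R[i]) (D : R) : 0 <= D ->
  (forall i, i \in s -> sqnorm (F i) <= D) -> sqnorm (\sum_(i <- s) F i) <= 4 ^+ size s * D.
Proof.
move=> D0; elim: s => [|i s IH] h; first by rewrite big_nil sqnorm0 expr0 mul1r.
rewrite big_cons; apply: (le_trans (sqnormD_le _ _)).
have h1 := h i (mem_head _ _); have h2 : sqnorm (\sum_(j <- s) F j) <= 4 ^+ size s * D.
  by apply: IH => j js; apply: h; rewrite inE js orbT.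
have h3 : D <= 4 ^+ size s * D by rewrite ler_peMl// exprn_ege1// ler1n.
rewrite /= exprS -mulrA; lra.
Qed.

Lemma sqnormN (z : R[i]) : sqnorm (- z) = sqnorm z.
Proof. by case: z => a b; rewrite /sqnorm /= !sqrrN. Qed.

Lemma sqnorm_mulB_le (a b a' b' : R[i]) : sqnorm a <= 1 -> sqnorm b' <= 1 ->
  sqnorm (a * b - a' * b') <= 2 * (sqnorm (b - b') + sqnorm (a - a')).
Proof.
move=> a1 b1; rewrite (_ : a * b - a' * b' = a * (b - b') + (a - a') * b'); last by ring.
apply: (le_trans (sqnormD_le _ _)); rewrite !sqnormM ler_wpM2l//; apply: lerD.
  by rewrite ler_piMl// sqnorm_ge0.
by rewrite ler_piMr// sqnorm_ge0.
Qed.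

End sums.

Section parallel_edges.
Context (R : realType) (V : seq 'rV[R]_2).
Implicit Types (p q : 'rV[R]_2).

(** Each edge has the other on its right, which puts both on one line; there each segment contains
    the other. *)
Lemma parallel_edge_eq p q p' q' (t : R) : is_edge V p q -> is_edge V p' q' -> 0 < t ->
  q' - p' = t *: (q - p) -> p = p' /\ q = q'.
Proof.
move=> [pV qV pq e] [pV' qV' _ e'] t0 h; have t1 : t != 0 by rewrite gt_eqF.
have [a1 a2] := e _ pV'; have [b1 b2] := e' _ pV.
have opp : det2 (q' - p') (p - p') = - (t * det2 (q - p) (p' - p)).
  by rewrite h det2Zl -[p - p']opprB det2Nr mulrN.
have z : det2 (q - p) (p' - p) = 0 by rewrite opp in b1; nra.
have [s [s0 s1 ps]] := a2 z; have [r [r0 r1 pr]] := b2 ltac:(by rewrite opp z mulr0 oppr0).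
have d0 : q - p != 0 by rewrite subr_eq0; apply/eqP => qp; apply: pq.
have sr : (s + r * t) *: (q - p) = 0.
  rewrite h scalerA in pr; rewrite scalerDl; move: ps pr => -> /eqP.
  by rewrite -addrA -subr_eq0 opprD addNKr oppr_eq0 => /eqP.
have sz : s = 0 by move: sr => /eqP; rewrite scaler_eq0 (negPf d0) orbF => /eqP; nra.
have pp : p' = p by rewrite ps sz scale0r addr0.
split=> //; have qE : q' = p + t *: (q - p) by rewrite -h pp addrC subrK.
have [c1 c2] := e _ qV'.
have [s' [_ s'1 qs]] := c2 ltac:(by rewrite qE addrAC subrr add0r det2Zr det2vv mulr0).
have [_ d2] := e' _ qV.
have [r' [_ r'1 qr]] := d2 ltac:(by rewrite h pp det2Zl det2vv mulr0).
have ts : (t - s') *: (q - p) = 0.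
  by rewrite scalerBl; apply/eqP; rewrite subr_eq0; apply/eqP/(addrI p); rewrite -qE.
have rt : (1 - r' * t) *: (q - p) = 0.
  rewrite scalerBl scale1r -scalerA -h; apply/eqP; rewrite subr_eq0; apply/eqP/(addrI p).
  by rewrite [LHS]addrC subrK {1}qr pp.
move: ts rt => /eqP + /eqP; rewrite !scaler_eq0 (negPf d0) !orbF => /eqP ts /eqP rt.
have t11 : t = 1 by nra.
by rewrite qE t11 scale1r addrC subrK.
Qed.

End parallel_edges.

Section asymptotics.
Context (R : realType).

Lemma large_multiple (dl X : R) : dl != 0 -> exists K, forall k : nat, (K <= k)%N ->
  X <= `|k%:R * dl|.
Proof.
move=> d0; have d1 : 0 < `|dl| by rewrite normr_gt0.
exists (Num.truncn (`|X| / `|dl|)).+1 => k Kk; apply: (le_trans (ler_norm X)).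
rewrite normrM ger0_norm// -ler_pdivrMr//; apply: (@le_trans _ _ (Num.truncn (`|X| / `|dl|)).+1%:R).
  exact/ltW/truncnS_gt.
by rewrite ler_nat.
Qed.

Lemma segint_far (dl H al e : R) : dl != 0 -> 0 < e -> exists K, forall k : nat, (K <= k)%N ->
  forall y z, `|y| <= H -> sqnorm z = 1 -> sqnorm (al%:C%C * (z * segint (k%:R * dl + y))) <= e.
Proof.
(* [segint_decay] bounds the term by [al ^ 2 / X ^ 2], and [X] is at least 1 and at least
   [al ^ 2 / e]. *)
move=> d0 e0; pose X := 1 + al ^+ 2 / e.
have q0 : 0 <= al ^+ 2 / e by rewrite divr_ge0 ?sqr_ge0 ?ltW.
have X1 : 1 <= X by rewrite /X; lra.
have [K hK] := large_multiple (X + H) d0; exists K => k /hK Xk y z yH z1.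
have far : X <= `|k%:R * dl + y|.
  have := ler_normB (k%:R * dl + y) y; rewrite addrK; lra.
rewrite !sqnormM z1 mul1r sqnorm_real; have x1 := le_trans X1 far.
apply: (le_trans (ler_wpM2l (sqr_ge0 _) (segint_decay x1))).
have x0 : 0 < `|k%:R * dl + y| by lra.
rewrite exprVn ler_pdivrMr ?exprn_gt0// mulrC -ler_pdivrMr//.
by apply: (@le_trans _ _ X); [rewrite /X; lra|rewrite expr2; nra].
Qed.

Lemma uniform_threshold (T : eqType) (s : seq T) (P : T -> nat -> Prop) :
  (forall t, t \in s -> exists K, forall k, (K <= k)%N -> P t k) ->
  exists K, forall t, t \in s -> forall k, (K <= k)%N -> P t k.
Proof.
elim: s => [|t s IH] h; first by exists 0%N.
have [K1 h1] := h t (mem_head _ _); have [|K2 h2] := IH; first by move=> u us; apply: h; rewrite inE us orbT.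
exists (maxn K1 K2) => u; rewrite inE => /predU1P[->|us] k; rewrite geq_max => /andP[k1 k2].
  exact: h1.
exact: h2.
Qed.

Definition normal (d : 'rV[R]_2) : 'rV[R]_2 := \row_i (if i == 0 then - d ord0 1 else d ord0 0).

Lemma euclid_dot2 (u v : 'rV[R]_2) : euclid_dot u v = u ord0 0 * v ord0 0 + u ord0 1 * v ord0 1.
Proof.
by rewrite /euclid_dot big_ord_recl big_ord1 (_ : lift _ _ = 1)//; exact/val_inj.
Qed.

Lemma euclid_dot_normal d u : euclid_dot (normal d) u = det2 d u.
Proof. by rewrite euclid_dot2 !mxE /= /det2; ring. Qed.

Lemma det2_normal_gt0 d : d != 0 -> 0 < det2 d (normal d).
Proof.
move=> d0; rewrite /det2 !mxE /= mulrN opprK -!expr2 lt_neqAle addr_ge0 ?sqr_ge0// andbT.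
rewrite eq_sym paddr_eq0 ?sqr_ge0// !sqrf_eq0; apply: contra d0 => /andP[/eqP h0 /eqP h1].
by apply/eqP/rowP; apply: ord2P; rewrite !mxE.
Qed.

Context (V : seq 'rV[R]_2) (uV : uniq V).
Local Notation A := (convex_hull [set` V]).
Hypothesis mA : measurable (A : set (lebesgueRn R 2)).
Hypothesis bA : bounded_set A.

(** In [zero_edge_sum] with [w = n], the terms of edges not parallel to [d] decay as [k] grows,
    while pairings with [d] do not depend on [k]. At most one other edge is parallel, with opposite
    direction and length ratio [c]; [b = 0] encodes its absence. Dividing by the phase at [p0]
    leaves the phase at [tau]. *)
Lemma edge_asymptotics p0 q0 : is_edge V p0 q0 -> let d := q0 - p0 in let n := normal d in
  exists (b c : R) (tau : 'rV[R]_2),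
  [/\ b <> 0 -> exists p q, [/\ is_edge V p q, 0 < c, q - p = - (c *: d), tau = q - p0 & b = c * area d n] &
    forall H e : R, 0 < e -> exists K, forall k : nat, (K <= k)%N -> forall eta : 'rV[R]_2, `|eta| <= H ->
      expint A (k%:R *: n + eta) = 0 ->
      sqnorm ((area d n)%:C%C * segint (euclid_dot eta d) -
        b%:C%C * (cis (euclid_dot (k%:R *: n + eta) tau) * segint (c * euclid_dot eta d))) <= e].
Proof.
move=> e0 d n; have [pV qV pq _] := e0.
have d0 : d != 0 by rewrite subr_eq0; apply/eqP => qp; apply: pq.
clear pq; have dn := det2_normal_gt0 d0; rewrite -/n in dn.
pose E := [seq pq <- edges V | det2 (edge_vector pq) n != 0].
pose rest := [seq pq <- E | det2 d (edge_vector pq) != 0].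
pose par := [seq pq <- [seq pq <- E | det2 d (edge_vector pq) == 0] | pq != (p0, q0)].
have uE : uniq E by apply: filter_uniq; exact: uniq_edges.
have e0E : (p0, q0) \in [seq pq <- E | det2 d (edge_vector pq) == 0].
  have m0 : (p0, q0) \in edges V by apply/mem_edges.
  by rewrite 2!mem_filter m0 /edge_vector /= det2vv eqxx gt_eqF.
have sumE (F : 'rV[R]_2 * 'rV[R]_2 -> R[i]) : \sum_(pq <- E) F pq =
    F (p0, q0) + \sum_(pq <- par) F pq + \sum_(pq <- rest) F pq.
  rewrite (bigID (fun pq => det2 d (edge_vector pq) == 0)) /= /rest.
  rewrite [X in _ = _ + X]big_filter; congr (_ + _); rewrite /par big_filter -big_filter.
  by rewrite (bigD1_seq (p0, q0)) //= filter_uniq.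
have parP pq' : pq' \in par -> exists c, [/\ 0 < c, is_edge V pq'.1 pq'.2 & edge_vector pq' = - (c *: d)].
  rewrite 3!mem_filter => /andP[ne /andP[/eqP h /andP[h' /mem_edges e]]].
  have hc := cramer (edge_vector pq') (lt0r_neq0 dn); rewrite h mul0r scale0r addr0 in hc.
  set t := _ / _ in hc; have t0 : t != 0 by rewrite mulf_neq0// invr_neq0// gt_eqF.
  exists (- t); split=> //; last by rewrite scaleNr opprK.
  rewrite oppr_gt0 lt_neqAle t0 leNgt; apply/negP => tp.
  have [h1 h2] := parallel_edge_eq e0 e tp hc; move: ne; rewrite h1 h2; case: (pq') => a b /=.
  by rewrite eqxx.
have par1 : par = [::] \/ exists pq', par = [:: pq'].
  have upar : uniq par by apply: filter_uniq; apply: filter_uniq.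
  case E1 : par => [|a [|b s]]; [by left|by right; exists a|exfalso].
  have [a0 [c1 ea ha]] := parP a ltac:(by rewrite E1 mem_head).
  have [b0 [c2 eb hb]] := parP b ltac:(by rewrite E1 !inE eqxx orbT).
  have [h1 h2] : a.1 = b.1 /\ a.2 = b.2.
    apply: (parallel_edge_eq (t := b0 / a0) ea eb); first by rewrite divr_gt0.
    by rewrite -/(edge_vector b) -/(edge_vector a) hb ha scalerN scalerA divfK ?gt_eqF.
  move: upar; rewrite E1 /= inE; case: (a) (b) h1 h2 => a1 a2 [b1 b2] /= -> ->.
  by rewrite eqxx.
have restP H e : 0 < e -> exists K, forall k : nat, (K <= k)%N -> forall eta : 'rV[R]_2, `|eta| <= H ->
    expint A (k%:R *: n + eta) = 0 ->
    sqnorm ((area d n)%:C%C * (cis (euclid_dot (k%:R *: n + eta) p0) * segint (euclid_dot eta d)) +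
      \sum_(pq <- par) (Num.sg (det2 (edge_vector pq) n) * area (edge_dir n pq) n)%:C%C *
      (cis (euclid_dot (k%:R *: n + eta) (edge_base n pq)) *
       segint (euclid_dot (k%:R *: n + eta) (edge_dir n pq)))) <= e.
  move=> e_gt0; have f0 : 0 < 4 ^+ size rest :> R by rewrite exprn_gt0.
  (* For large [k] the pairing with [n] is nonzero, as [zero_edge_sum] requires. *)
  have [K1 hK1] : exists K, forall k : nat, (K <= k)%N -> forall eta : 'rV[R]_2, `|eta| <= H ->
      euclid_dot (k%:R *: n + eta) n != 0.
    have [K hK] := large_multiple (2 * (H * `|n|) + 1) (lt0r_neq0 dn); exists K => k /hK hk eta etaH.
    rewrite euclid_dotDl euclid_dotZl euclid_dot_normal.
    have h2 : `|euclid_dot eta n| <= 2 * (H * `|n|).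
      by apply: (le_trans (euclid_dot_le _ _)); rewrite ler_wpM2l// ler_wpM2r.
    apply/eqP => z; have : `|k%:R * det2 d n| = `|euclid_dot eta n|.
      by rewrite -[RHS]normrN; congr (`|_|); apply/eqP; rewrite -subr_eq0 opprK z.
    by move=> ee; have := hk; rewrite ee => /le_trans/(_ h2); rewrite gerDl ler10.
  have [K2 hK2] : exists K, forall pq, pq \in rest -> forall k, (K <= k)%N -> forall eta : 'rV[R]_2, `|eta| <= H ->
      sqnorm ((Num.sg (det2 (edge_vector pq) n) * area (edge_dir n pq) n)%:C%C *
      (cis (euclid_dot (k%:R *: n + eta) (edge_base n pq)) *
       segint (euclid_dot (k%:R *: n + eta) (edge_dir n pq)))) <= e / 4 ^+ size rest.
    apply: uniform_threshold => pq; rewrite mem_filter => /andP[hpq _].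
    have dd : det2 d (edge_dir n pq) != 0.
      by rewrite /edge_dir; case: ifP => _; rewrite ?det2Nr ?oppr_eq0.
    have [K hK] := segint_far (2 * (H * `|edge_dir n pq|)) (Num.sg (det2 (edge_vector pq) n) * area (edge_dir n pq) n)
      dd (divr_gt0 e_gt0 f0).
    exists K => k /hK hk eta etaH; rewrite [euclid_dot _ (edge_dir n pq)]euclid_dotDl euclid_dotZl euclid_dot_normal.
    apply: hk; last exact: sqnorm_cis.
    by apply: (le_trans (euclid_dot_le _ _)); rewrite ler_wpM2l// ler_wpM2r.
  exists (maxn K1 K2) => k; rewrite geq_max => /andP[k1 k2] eta etaH z.
  have := zero_edge_sum uV mA bA z (hK1 k k1 eta etaH); rewrite -big_filter -/E sumE.
  have -> : edge_dir n (p0, q0) = d by rewrite /edge_dir /edge_vector /= dn.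
  have -> : edge_base n (p0, q0) = p0 by rewrite /edge_base /edge_vector /= dn.
  rewrite gtr0_sg// mul1r [euclid_dot _ d]euclid_dotDl euclid_dotZl euclid_dot_normal det2vv mulr0 add0r.
  move/eqP; rewrite addr_eq0 => /eqP ->; rewrite sqnormN.
  apply: (le_trans (sqnorm_sum_le (D := e / 4 ^+ size rest) _ _)).
  - by rewrite divr_ge0 ?ltW.
  - by move=> pq pqr; exact: (hK2 pq pqr k k2 eta etaH).
  - by rewrite mulrC divfK ?gt_eqF.
have phase l (z w : R[i]) : sqnorm z = sqnorm (cis l * z) by rewrite sqnormM sqnorm_cis mul1r.
case: par1 => [p_nil|[[p q] pE]].
  exists 0, 0, 0; split=> // H e e_gt0; have [K hK] := restP H e e_gt0; exists K => k Kk eta etaH z.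
  have := hK k Kk eta etaH z; rewrite p_nil big_nil addr0 mul0r subr0 => h.
  by rewrite (phase (euclid_dot (k%:R *: n + eta) p0) _ 0) mulrCA.
have [c [c0 e hpq]] := parP (p, q) ltac:(by rewrite pE mem_head).
have dneg : det2 (edge_vector (p, q)) n < 0 by rewrite hpq det2Nl det2Zl oppr_lt0 mulr_gt0.
exists (c * area d n), c, (q - p0); split=> [_|H e' e_gt0]; first by exists p, q.
have [K hK] := restP H e' e_gt0; exists K => k Kk eta etaH z.
have := hK k Kk eta etaH z; rewrite pE big_seq1 ltr0_sg//.
have -> : edge_dir n (p, q) = c *: d by rewrite /edge_dir ltNge (ltW dneg) /= hpq opprK.
have -> : edge_base n (p, q) = q by rewrite /edge_base ltNge (ltW dneg).
have -> : area (c *: d) n = c * area d n.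
  by have := area_scale (lt0r_neq0 dn) c0 ltr01; rewrite scale1r mulr1.
have ld : euclid_dot (k%:R *: n + eta) d = euclid_dot eta d.
  by rewrite euclid_dotDl euclid_dotZl euclid_dot_normal det2vv mulr0 add0r.
rewrite mulN1r euclid_dotZr ld.
rewrite (phase (euclid_dot (k%:R *: n + eta) p0) (_ - _) 0) mulrBr mulrCA; congr (sqnorm (_ + _) <= _).
rewrite (rmorphN (real_complex R)) mulNr; congr (- _).
have -> : cis (euclid_dot (k%:R *: n + eta) q) =
    cis (euclid_dot (k%:R *: n + eta) p0) * cis (euclid_dot (k%:R *: n + eta) (q - p0)).
  by rewrite -cisD -euclid_dotDr [p0 + _]addrC subrK.
by ring.
Qed.

End asymptotics.

Section spectrum_nonempty.
Context (R : realType) (d : nat) (Om : set 'rV[R]_d) (dOm : domain Om).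

Lemma spectrum_nonempty Lam : is_spectrum Lam Om -> exists l, Lam l.
Proof.
move=> [_ oL cL]; have [bOm mOm v0] := dOm; have L0 := domain_exponential (0 : 'rV[R]_d) dOm.
have e0 : 0 < volume Om * volume Om / 2 by rewrite divr_gt0// mulr_gt0.
have [s [us sL]] := parseval (domain_semi_inner dOm) v0 (fun l (_ : Lam l) => domain_exponential l dOm)
  (fun l _ => nsq_exponential mOm bOm l) oL (@subset_refl _ Lam) L0
  ((complete_exponentialsP Lam dOm).1 cL _ L0) e0.
rewrite nsq_exponential//; case: s us sL => [_ _|l s _ sL _]; last by exists l; apply: sL; rewrite mem_head.
by rewrite big_nil; lra.
Qed.

End spectrum_nonempty.

Section edge_relation.
Context (R : realType) (m : nat).
Implicit Types (u : 'rV[R]_(2 + m)) (d tau : 'rV[R]_2).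

Lemma lsubmx_norm_le u : `|lsubmx u| <= `|u|.
Proof.
rewrite [leLHS]mx_normrE; apply/bigmax_leP; split=> // -[j i] _ /=; rewrite (ord1 j) mxE.
exact: coord_le_norm.
Qed.

Lemma rsubmx_norm_le u : `|rsubmx u| <= `|u|.
Proof.
rewrite [leLHS]mx_normrE; apply/bigmax_leP; split=> // -[j i] _ /=; rewrite (ord1 j) mxE.
exact: coord_le_norm.
Qed.

(** The combined terms of two antiparallel edges; [th] is the phase contributed by the translation
    along the normal. *)
Definition edge_gap (a b c : R) d tau (th : R) u : R[i] :=
  a%:C%C * segint (euclid_dot (lsubmx u) d) -
  b%:C%C * (cis (th + euclid_dot (lsubmx u) tau) * segint (c * euclid_dot (lsubmx u) d)).

Lemma edge_gap_continuous a b c d tau (e : R) : 0 < e -> exists2 del : R, 0 < del &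
  forall u u' th th', `|u - u'| < del -> `|th - th'| < del ->
  sqnorm (edge_gap a b c d tau th u) <= 2 * sqnorm (edge_gap a b c d tau th' u') + e.
Proof.
move=> e0; pose M := a ^+ 2 + b ^+ 2 + 1; have M0 : 0 < M by rewrite ltr_wpDl// addr_ge0 ?sqr_ge0.
(* The 16 absorbs the constants of the successive uses of [sqnormD_le]. *)
pose e1 := e / (16 * M); have e10 : 0 < e1 by rewrite divr_gt0// mulr_gt0.
have [ds ds0 hs] := segint_continuous e10; have pi0 := pi_gt0 R.
pose r := Num.min ds (e1 / (4 * pi)).
have r0 : 0 < r by rewrite lt_min ds0 divr_gt0// mulr_gt0.
have ds_r : r <= ds by rewrite /r ge_min lexx.
have e1_r : 4 * pi * r <= e1.
  by rewrite mulrC -ler_pdivlMr ?mulr_gt0// /r ge_min lexx orbT.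
pose L := 1 + 2 * `|d| + 2 * (`|c| * `|d|) + 2 * `|tau|.
have nd := normr_ge0 d; have nt := normr_ge0 tau; have nc := mulr_ge0 (normr_ge0 c) nd.
have L1 : 1 <= L by rewrite /L; lra.
have L0 : 0 < L by lra.
exists (r / L) => [|u u' th th' uu tt]; first by rewrite divr_gt0.
have dot_le v : `|euclid_dot (lsubmx u) v - euclid_dot (lsubmx u') v| <= `|u - u'| * (2 * `|v|).
  rewrite -euclid_dotBl -linearB /=; apply: (le_trans (euclid_dot_le _ _)).
  by rewrite mulrCA ler_wpM2r ?mulr_ge0// lsubmx_norm_le.
have rL : r / L * L = r by rewrite divfK// gt_eqF.
have rL0 : 0 < r / L by rewrite divr_gt0.
have dk (k : R) : 0 <= k -> k + 1 <= L -> `|u - u'| * k < r.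
  move=> k0 kL; apply: (@le_lt_trans _ _ (r / L * k)); first by rewrite ler_wpM2r// ltW.
  by have := ltr_pM2l rL0 k L; rewrite rL => ->; lra.
set x := euclid_dot (lsubmx u) d; set x' := euclid_dot (lsubmx u') d.
set y := euclid_dot (lsubmx u) tau; set y' := euclid_dot (lsubmx u') tau.
have hx : sqnorm (segint x - segint x') < e1.
  apply: hs; apply: lt_le_trans ds_r; apply: (le_lt_trans (dot_le d)); apply: dk; rewrite /L; lra.
have hcx : sqnorm (segint (c * x) - segint (c * x')) < e1.
  apply: hs; apply: lt_le_trans ds_r; rewrite -mulrBr normrM.
  apply: (@le_lt_trans _ _ (`|u - u'| * (2 * (`|c| * `|d|)))); last by apply: dk; rewrite /L; lra.
  rewrite (_ : _ * (2 * _) = `|c| * (`|u - u'| * (2 * `|d|))); last by ring.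
  by rewrite ler_wpM2l//; exact: dot_le.
have hy : sqnorm (cis (th + y) - cis (th' + y')) <= e1.
  apply: (le_trans (sqnorm_cisB_le _ _)); apply: le_trans e1_r; rewrite (ler_wpM2l (mulr_ge0 (ler0n _ 4) (ltW pi0)))//.
  rewrite opprD addrACA; apply: (le_trans (ler_normD _ _)).
  have h1 := dot_le tau; rewrite -/y -/y' in h1.
  have h2 : `|u - u'| * (2 * `|tau|) <= r / L * (2 * `|tau|) by rewrite ler_wpM2r ?mulr_ge0// ltW.
  have h3 : r / L * (1 + 2 * `|tau|) <= r / L * L by rewrite ler_pM2l// /L; lra.
  by move: h3; rewrite rL mulrDr mulr1 => h3; lra.
have h4 := sqnorm_mulB_le (segint (c * x)) (cis (th' + y')) (_ : sqnorm (cis (th + y)) <= 1) (sqnorm_segint_le (c * x')).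
have {}h4 := h4 ltac:(by rewrite sqnorm_cis).
rewrite /edge_gap -/x -/x' -/y -/y'.
set z := _ - _; set z' := a%:C%C * segint x' - _.
rewrite -[z](subrK z') addrC; apply: (le_trans (sqnormD_le _ _)); rewrite mulrDr lerD2l.
rewrite (_ : z - z' = a%:C%C * (segint x - segint x') +
  (- (b%:C%C * (cis (th + y) * segint (c * x) - cis (th' + y') * segint (c * x'))))); last first.
  by rewrite /z /z'; ring.
have := sqnormD_le (a%:C%C * (segint x - segint x')) (- (b%:C%C * (cis (th + y) * segint (c * x) - cis (th' + y') * segint (c * x')))).
rewrite sqnormN !(sqnormM _ (_ - _)) !sqnorm_real => h5.
have a20 := sqr_ge0 a; have b20 := sqr_ge0 b.
have h6 := ler_wpM2l a20 (ltW hx).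
have h7 : b ^+ 2 * sqnorm (cis (th + y) * segint (c * x) - cis (th' + y') * segint (c * x')) <= b ^+ 2 * (4 * e1).
  by rewrite ler_wpM2l//; lra.
have h8 : 16 * M * e1 = e by rewrite /e1; field; rewrite gt_eqF.
have h9 : 4 * (a ^+ 2 * e1) + 16 * (b ^+ 2 * e1) <= 16 * M * e1.
  have := mulr_ge0 a20 (ltW e10); rewrite /M; nra.
lra.
Qed.

End edge_relation.

(** * The relation between limit frequencies for one edge *)

Section limit_relation.
Context (R : realType) (V : seq 'rV[R]_2) (uV : uniq V) (m : nat) (m0 : (0 < m)%N).
Local Notation A := (convex_hull [set` V]).
Context (B : set 'rV[R]_m) (dA : domain A) (dB : domain B).
Local Notation AB := (cartesian A B).

Let n0 : (0 < 2)%N. Proof. by []. Qed.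
Let mA : measurable (A : set (lebesgueRn R 2)). Proof. by case: dA. Qed.
Let bA : bounded_set A. Proof. by case: dA. Qed.
Let mB : measurable (B : set (lebesgueRn R m)). Proof. by case: dB. Qed.
Let bB : bounded_set B. Proof. by case: dB. Qed.
Let dAB : domain AB. Proof. exact: domain_cartesian. Qed.

Definition edge_rel (d tau : 'rV[R]_2) : set 'rV[R]_(2 + m) :=
  [set u | expint B (rsubmx u) = 0 \/ edge_gap 1 1 1 d tau 0 u = 0].

Lemma edge_gap_limit a b c d tau th u :
  (forall e : R, 0 < e -> exists th' u', [/\ `|u - u'| < e, `|th - th'| < e &
    expint B (rsubmx u') = 0 \/ sqnorm (edge_gap a b c d tau th' u') < e]) ->
  expint B (rsubmx u) = 0 \/ edge_gap a b c d tau th u = 0.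
Proof.
have half1 (t : R) : 0 < t -> t <= t / 2 -> False by lra.
have half2 (s t : R) : 0 < s -> t < s / 8 -> s <= 2 * t + s / 2 -> False by lra.
move=> h; apply: contrapT => /not_orP[/eqP nB /eqP ng].
rewrite -sqnorm_gt0 in nB; rewrite -sqnorm_gt0 in ng.
set g := sqnorm (edge_gap _ _ _ _ _ _ _) in ng.
have nB2 : 0 < sqnorm (expint B (rsubmx u)) / 2 by lra.
have ng2 : 0 < g / 2 by lra.
have [d1 d10 h1] := sqnorm_expint_continuous dB nB2.
have [d2 d20 h2] := edge_gap_continuous m a b c d tau ng2.
have [|th' [u' [uu tt h']]] := h (Num.min (Num.min d1 d2) (g / 8)).
  by rewrite !lt_min d10 d20; lra.
rewrite !lt_min in uu tt.
have /andP[/andP[u1 u2] _] := uu; have /andP[/andP[t1 t2] _] := tt.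
case: h' => [h'|].
  have := h1 (rsubmx u) (rsubmx u'); rewrite -linearB /= => /(_ (le_lt_trans (rsubmx_norm_le _) u1)).
  by rewrite h' sqnorm0 add0r; exact: half1.
rewrite lt_min => /andP[_ g8]; exact: half2 ng g8 (h2 u u' th th' u2 t2).
Qed.

Lemma edge_rel_closed d tau x : (forall e : R, 0 < e -> exists2 y, edge_rel d tau y & `|y - x| < e) ->
  edge_rel d tau x.
Proof.
move=> h; apply: edge_gap_limit => e e0; have [y [yB|yg] xy] := h e e0; exists 0, y;
  rewrite distrC subrr normr0; split=> //; [by left|by right; rewrite yg sqnorm0].
Qed.

(** In the translates by [k n] over the plane, a limit point is first compared with an original
    frequency ([C1]), at the price of a phase [th]; comparing two limit points through this ([C2])
    removes the phase. Taking them equal gives [a = b], hence an opposite edge, and one of equal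
    length. *)
Lemma limit_relation Lam p0 q0 : is_spectrum Lam AB -> is_edge V p0 q0 ->
  exists Lam' p q, [/\ is_spectrum Lam' AB, is_edge V p q, q - p = - (q0 - p0),
    (forall x x', Lam' x -> Lam' x' -> edge_rel (q0 - p0) (q - p0) (x - x')) &
    (forall P : set 'rV[R]_(2 + m),
      (forall x, (forall e : R, 0 < e -> exists2 y, P y & `|y - x| < e) -> P x) ->
      (forall l l', Lam l -> Lam l' -> P (l - l')) ->
      forall x x', Lam' x -> Lam' x' -> P (x - x'))].
Proof.
move=> sL e0; have [b [c [tau [bP asym]]]] := edge_asymptotics uV mA bA e0.
set d := q0 - p0 in bP asym *; set n := normal d in bP asym; set a := area d n in bP asym.
have [pV qV pq _] := e0; have d0 : d != 0 by rewrite subr_eq0; apply/eqP => qp; apply: pq.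
have dn := det2_normal_gt0 d0; rewrite -/n in dn.
have a0 : 0 < a by apply: area_gt0; rewrite gt_eqF.
have [G [UG Goo]] := ultraFilterLemma eventually_filter.
pose sh k : 'rV[R]_(2 + m) := row_mx (k%:R *: n) 0.
pose Lam' := weak_limit G sh Lam; have sL' : is_spectrum Lam' AB := weak_limit_spectrum dAB UG sh sL.
(* Only the phase modulo 1 matters, and fractional parts are bounded, so they converge along [G]. *)
pose f k := euclid_dot (k%:R *: n) tau - (Num.floor (euclid_dot (k%:R *: n) tau))%:~R.
have f01 k : `|f k| <= 1.
  have /andP[h1 h2] := floor_itv (euclid_dot (k%:R *: n) tau); rewrite intrD in h2.
  by rewrite ler_norml /f; apply/andP; split; lra.
have cisf k y : cis (f k + y) = cis (euclid_dot (k%:R *: n) tau + y).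
  by rewrite /f !cisD cisN cis_int rmorph1 mulr1.
have [th hth] : exists th, forall e : R, 0 < e -> G [set k | `|f k - th| < e].
  have [|x hx] := ultra_bounded_cvg UG (u := fun k => const_mx (f k) : 'rV[R]_1) (M := 1).
    apply: (filterS _ filterT) => k _ /=; rewrite [leLHS]mx_normrE; apply/bigmax_leP; split=> // i _.
    by rewrite mxE.
  exists (x ord0 ord0) => e e_gt0; apply: filterS (hx e e_gt0) => k /= h.
  by have := le_lt_trans (coord_le_norm _ ord0) h; rewrite !mxE.
have Gge K : G [set k | (K <= k)%N] by apply: Goo; exists K.
have C1 x l : Lam' x -> Lam l ->
    expint B (rsubmx (x - l)) = 0 \/ edge_gap a b c d tau th (x - l) = 0.
  move=> Lx Ll; apply: edge_gap_limit => e e_gt0; pose H := `|x - l| + 1.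
  have [K1 hK1] := asym H (e / 2) ltac:(lra).
  have [K2 hK2] := large_multiple (2 * (H * `|n|) + 1) (lt0r_neq0 dn).
  have e1 : 0 < Num.min e 1 by rewrite lt_min e_gt0 ltr01.
  have [k [[[k1 k2] hf] [lk Llk hlk]]] := filter_ex (filterI (filterI (filterI (Gge K1) (Gge K2)) (hth e e_gt0)) (Lx _ e1)).
  rewrite /= in k1 k2 hf; move: hlk; rewrite lt_min => /andP[hlk hlk1].
  pose u := lk - sh k - l; have uE : u - (x - l) = lk - sh k - x by rewrite /u opprB addrA subrK.
  exists (f k), u; split; [by rewrite distrC uE|by rewrite distrC|].
  have uH : `|lsubmx u| <= H.
    apply: (le_trans (lsubmx_norm_le _)); rewrite -[u](subrK (x - l)) uE addrC.
    by apply: (le_trans (ler_normD _ _)); rewrite lerD2l ltW.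
  have lu : lsubmx (lk - l) = k%:R *: n + lsubmx u.
    by rewrite /u !linearB /= /sh row_mxKl; apply/rowP => i; rewrite !mxE; ring.
  have ru : rsubmx (lk - l) = rsubmx u.
    by rewrite /u !linearB /= /sh row_mxKr subr0.
  have nlk : lk <> l.
    move=> ll; have := congr1 (fun v => euclid_dot v n) lu; rewrite ll subrr linear0 euclid_dot0l.
    rewrite euclid_dotDl euclid_dotZl euclid_dot_normal => z.
    have h2 : `|euclid_dot (lsubmx u) n| <= 2 * (H * `|n|).
      by apply: (le_trans (euclid_dot_le _ _)); rewrite ler_wpM2l// ler_wpM2r.
    have ee : `|k%:R * det2 d n| = `|euclid_dot (lsubmx u) n|.
      by rewrite -[RHS]normrN; congr (`|_|); apply/eqP; rewrite -subr_eq0 opprK -z.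
    by have := hK2 k k2; rewrite ee => /le_trans/(_ h2); rewrite gerDl ler10.
  have [_ oL _] := sL; have := oL _ _ Llk Ll nlk.
  rewrite L2_dot_exponential (expint_cartesian n0 m0 mA mB)// lu ru => /eqP.
  rewrite mulf_eq0 => /orP[|]/eqP z; [right|by left].
  apply: (le_lt_trans _ (_ : e / 2 < e)); last by lra.
  by have := hK1 k k1 _ uH z; rewrite /edge_gap cisf -euclid_dotDl.
have C2 x x' : Lam' x -> Lam' x' ->
    expint B (rsubmx (x - x')) = 0 \/ edge_gap a b c d tau 0 (x - x') = 0.
  move=> Lx Lx'; apply: edge_gap_limit => e e_gt0.
  have [k [hf [lk Llk hlk]]] := filter_ex (filterI (hth e e_gt0) (Lx' _ e_gt0)).
  (* As [lk - sh k] is close to [x'], [u] is close to [x - x']; undoing the shift along the normal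
     turns the phase [th] into [th - f k], which is small. *)
  pose u := x - lk + sh k; exists (th - f k), u; split.
  - rewrite (_ : x - x' - u = lk - sh k - x')//.
    by rewrite /u; apply/rowP => i; rewrite !mxE; ring.
  - by rewrite sub0r opprB.
  have lu : lsubmx (x - lk) = lsubmx u - k%:R *: n.
    by rewrite /u [lsubmx (_ + sh k)]linearD /= /sh row_mxKl addrK.
  have ru : rsubmx (x - lk) = rsubmx u by rewrite /u [rsubmx (_ + sh k)]linearD /= /sh row_mxKr addr0.
  have := C1 x lk Lx Llk; rewrite ru => -[h|hg]; [by left|right].
  suff -> : edge_gap a b c d tau (th - f k) u = 0 by rewrite sqnorm0.
  move: hg; rewrite /edge_gap lu !euclid_dotBl [euclid_dot (k%:R *: n) d]euclid_dotZl euclid_dot_normal det2vv mulr0 subr0.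
  suff -> : cis (th - f k + euclid_dot (lsubmx u) tau) =
    cis (th + (euclid_dot (lsubmx u) tau - euclid_dot (k%:R *: n) tau)) by [].
  rewrite !cisD -!mulrA; congr (_ * _); rewrite [LHS]mulrC; congr (_ * _).
  by rewrite !cisN; congr conjc; have := cisf k 0; rewrite !addr0.
have [x Lx] := spectrum_nonempty dAB sL'.
(* At difference 0 the values of [segint] and of the phase factor are 1, and the transform of [B] is
   not zero. *)
have ab : a = b.
  have := C2 x x Lx Lx; rewrite subrr /edge_gap !linear0 !euclid_dot0l mulr0 addr0 segint0 cis0 !mulr1.
  case=> [|/eqP]; first by move/eqP; rewrite (negPf (domain_expint0_neq0 dB)).
  by rewrite subr_eq0 => /eqP[].
have [|p [q [e cp pqE tauE bE]]] := bP; first by rewrite -ab; apply/eqP; rewrite gt_eqF.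
have c1 : c = 1 by apply: (mulIf (lt0r_neq0 a0)); rewrite mul1r -bE.
exists Lam', p, q; split=> //; first by rewrite pqE c1 scale1r.
  move=> y y' Ly Ly'; have := C2 y y' Ly Ly'; rewrite -ab c1 tauE => -[h|h]; [by left|right].
  have aC : a%:C%C != 0 by rewrite -sqnorm_gt0 sqnorm_real exprn_gt0.
  apply: (mulfI aC); rewrite mulr0 -h /edge_gap; ring.
exact: weak_limit_pairs.
Qed.

End limit_relation.

(** * Opposite edges and the exclusion of the second alternative *)

Section polygon_product.
Context (R : realType) (V : seq 'rV[R]_2) (uV : uniq V) (m : nat) (m0 : (0 < m)%N).
Local Notation A := (convex_hull [set` V]).
Context (B : set 'rV[R]_m) (dA : domain A) (dB : domain B).
Local Notation AB := (cartesian A B).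
Implicit Types (p q xi tau d : 'rV[R]_2).

Let n0 : (0 < 2)%N. Proof. by []. Qed.
Let mA : measurable (A : set (lebesgueRn R 2)). Proof. by case: dA. Qed.
Let bA : bounded_set A. Proof. by case: dA. Qed.
Let mB : measurable (B : set (lebesgueRn R m)). Proof. by case: dB. Qed.
Let bB : bounded_set B. Proof. by case: dB. Qed.
Let dAB : domain AB. Proof. exact: domain_cartesian. Qed.

Definition opposite p q p' q' := [/\ is_edge V p q, is_edge V p' q' & q' - p' = - (q - p)].

Lemma edge_relP d tau (u : 'rV[R]_(2 + m)) : edge_rel B d tau u <->
  [\/ expint B (rsubmx u) = 0, segint (euclid_dot (lsubmx u) d) = 0 | cis (euclid_dot (lsubmx u) tau) = 1].
Proof.
have E : edge_gap 1 1 1 d tau 0 u = segint (euclid_dot (lsubmx u) d) * (1 - cis (euclid_dot (lsubmx u) tau)).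
  by rewrite /edge_gap add0r mul1r rmorph1; ring.
rewrite /edge_rel /= E; split=> [[h|/eqP]|[h|h|h]]; [exact: Or31| |by left| |].
- by rewrite mulf_eq0 subr_eq0 => /orP[/eqP h|/eqP h]; [exact: Or32|exact: Or33].
- by right; rewrite h mul0r.
- by right; rewrite h subrr mulr0.
Qed.

(** Each edge calls for its own limit; the relations of the edges treated before are closed and pass
    to the new spectrum by the last clause of [limit_relation]. *)
Lemma all_edges_relation Lam : is_spectrum Lam AB -> exists Lam', [/\ is_spectrum Lam' AB,
  (forall p q, is_edge V p q -> exists p' q', opposite p q p' q') &
  (forall p q p' q' x x', opposite p q p' q' -> Lam' x -> Lam' x' -> edge_rel B (q - p) (q' - p) (x - x'))].
Proof.
move=> sL.
have [L [sL' hop hrel]] : exists Lam', [/\ is_spectrum Lam' AB,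
    (forall pq, pq \in edges V -> exists p' q', opposite pq.1 pq.2 p' q') &
    (forall pq, pq \in edges V -> forall p' q' x x', opposite pq.1 pq.2 p' q' -> Lam' x -> Lam' x' ->
      edge_rel B (pq.2 - pq.1) (q' - pq.1) (x - x'))].
  have : forall pq, pq \in edges V -> is_edge V pq.1 pq.2 by move=> pq /mem_edges.
  elim: (edges V) => [_|[p q] s IH hs]; first by exists Lam.
  have [|L [sL1 h1 h2]] := IH; first by move=> pq h; apply: hs; rewrite inE h orbT.
  have e := hs (p, q) (mem_head _ _).
  have [L' [p' [q' [sL2 e' pqE rel cl]]]] := limit_relation uV m0 dA dB sL1 e.
  exists L'; split=> // [pq|pq].
    by rewrite inE => /predU1P[->|/h1//]; exists p', q'.
  rewrite inE => /predU1P[->|pqs] p1 q1 x x' op1 Lx Lx'; have [b1 b2 b3] := op1 => /=.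
    (* The opposite edge is unique, so the relation holds for whichever one is given. *)
    have [_ qq] := parallel_edge_eq (t := 1) e' b2 ltr01 ltac:(by rewrite scale1r b3 pqE).
    by rewrite -qq; exact: rel.
  apply: (cl (edge_rel B (pq.2 - pq.1) (q1 - pq.1))) => //; first exact: edge_rel_closed.
  by move=> l l' Ll Ll'; exact: (h2 pq pqs p1 q1).
exists L; split=> // [p q e|p q p' q' x x' o].
  by apply: (hop (p, q)); apply/mem_edges.
by move=> Lx Lx'; have [e _ _] := o; exact: (hrel (p, q) ((mem_edges V (p, q)).2 e) p' q' x x' o Lx Lx').
Qed.

Section opposite_edges.
Context (p q p' q' : 'rV[R]_2) (op : opposite p q p' q').
Local Notation d := (q - p).
Local Notation tau := (q' - p).
Local Notation P := (parallelogram p d tau).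

Let e : is_edge V p q. Proof. by case: op. Qed.
Let e' : is_edge V p' q'. Proof. by case: op. Qed.
Let pqE : q' - p' = - d. Proof. by case: op. Qed.
Let p'E : p' = q' + d. Proof. by have := pqE => h; rewrite -[d]opprK -h opprB addrC subrK. Qed.

(** Otherwise the two edges lie on one line with opposite directions, and [A], to the right of both,
    would be contained in that line and null. *)
Lemma opposite_det2 : det2 d tau != 0.
Proof.
apply/eqP => z; have [_ _ v0] := dA; have [_ _ pq _] := e.
have d0 : d != 0 by rewrite subr_eq0; apply/eqP => qp; apply: pq.
have : lebesgue_outer A = 0%E; last by move=> A0; move: v0; rewrite /volume [X in fine X]A0 ltxx.
apply: null_le (null_line (det2 d p) d0) => x Ax /=.
have := edge_halfplane e Ax; have := edge_halfplane e' Ax.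
rewrite pqE p'E det2Nl (_ : x - (q' + d) = (x - p) - tau - d); last first.
  by apply/rowP => i; rewrite !mxE; ring.
rewrite (det2Br _ d) det2vv subr0 (det2Br (x - p)) z subr0 (det2Br x) => h1 h2.
by apply/eqP; rewrite -subr_eq0 eq_le h2 /= -oppr_le0.
Qed.

Lemma parallelogram_sub : P `<=` A.
Proof.
move=> x /(parallelogramP _ _ opposite_det2)[s [t [/andP[s0 s1] /andP[t0 t1] ->]]].
have [pV qV _ _] := e; have [pV' qV' _ _] := e'.
have h1 : A (p + s *: d) by apply: convex_hull_segment; [exact: sub_gen_smallest|exact: sub_gen_smallest|exact: ltW|].
have h2 : A (q' + s *: (p' - q')) by apply: convex_hull_segment; [exact: sub_gen_smallest|exact: sub_gen_smallest|exact: ltW|].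
have -> : p + s *: d + t *: tau = (p + s *: d) + t *: (q' + s *: (p' - q') - (p + s *: d)).
  rewrite p'E; congr (_ + _ *: _); rewrite [q' + d]addrC addrK opprD addrACA subrr addr0 //.
by apply: convex_hull_segment h1 h2 _ _ => //; exact: ltW.
Qed.

Let mP : measurable (P : set (lebesgueRn R 2)). Proof. exact: measurable_parallelogram. Qed.

Lemma expint_parallelogram_eq0 xi : expint P xi = 0 <->
  segint (euclid_dot xi d) = 0 \/ segint (euclid_dot xi tau) = 0.
Proof.
have aC : (area d tau)%:C%C != 0 by rewrite -sqnorm_gt0 sqnorm_real exprn_gt0// area_gt0// opposite_det2.
rewrite expint_parallelogram ?opposite_det2//; split=> [/eqP|[->|->]]; rewrite ?mulr0 ?mul0r//.
by rewrite !mulf_eq0 (negPf aC) (negPf (cis_neq0 _)) /= => /orP[/eqP|/eqP]; [left|right].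
Qed.

Lemma euclid_dot_basis_eq0 xi : euclid_dot xi d = 0 -> euclid_dot xi tau = 0 -> xi = 0.
Proof.
move=> h1 h2; have D0 := opposite_det2; apply/rowP => i.
have := cramer (delta_mx 0 i) D0 => /(congr1 (euclid_dot xi)).
by rewrite euclid_dotDr !euclid_dotZr h1 h2 !mulr0 addr0 -[delta_mx 0 i]scale1r euclid_dot_delta mul1r mxE.
Qed.

(* Polarized Parseval for the restrictions of two exponentials to [P x B]:
   the term of index [l] is the only nonzero one. *)
Lemma integer_translation Lam k l : is_spectrum Lam AB -> volume A != volume P ->
  (forall x x', Lam x -> Lam x' -> edge_rel B d tau (x - x')) -> Lam k -> Lam l ->
  cis (euclid_dot (lsubmx (k - l)) tau) = 1 \/ expint B (rsubmx (k - l)) = 0.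
Proof.
move=> [_ oL cL] vAP rel Lk Ll; apply: contrapT => /not_orP[nc nB].
have [_ _ vA0] := dA; have [_ _ vB0] := dB.
have xkl : is_integer (euclid_dot (lsubmx (k - l)) d).
  have /edge_relP[//|/segint_eq0[]//|//] := rel k l Lk Ll.
have LB := fun z => domain_exponential z dB; have LA := fun z => domain_exponential z dA.
have Lc := L2_cutoff dA (lsubmx l) mP.
(* [f] borrows its frequency over [B] from [k], so a nonzero term of index [nu] informs on [nu]
   relative to both [k] and [l]. *)
pose f := tensor (cutoff P (lsubmx l)) (exponential (rsubmx k)).
pose h := tensor (cutoff P (lsubmx l)) (exponential (rsubmx l)).
have f2 : in_L2 AB f := L2_tensor n0 m0 mA mB Lc (LB _).
have h2 : in_L2 AB h := L2_tensor n0 m0 mA mB Lc (LB _).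
have dotE z nu : L2_dot AB (tensor (cutoff P (lsubmx l)) (exponential z)) (exponential nu) =
    expint P (lsubmx l - lsubmx nu) * expint B (z - rsubmx nu).
  rewrite [exponential nu]exponential_tensor (L2_dot_tensor n0 m0 mA mB Lc (LB z) (LA _) (LB _)).
  by rewrite (dot_cutoff_exponential _ _ mP parallelogram_sub) L2_dot_exponential.
have zero nu : Lam nu -> nu <> l -> L2_dot AB f (exponential nu) * conjc (L2_dot AB h (exponential nu)) = 0.
  move=> Ln nl; rewrite !dotE conjcM.
  have [->|nP] := eqVneq (expint P (lsubmx l - lsubmx nu)) 0; first by rewrite !mul0r.
  have [->|nBl] := eqVneq (expint B (rsubmx l - rsubmx nu)) 0; first by rewrite raddf0 !mulr0.
  have [->|nBk] := eqVneq (expint B (rsubmx k - rsubmx nu)) 0; first by rewrite mulr0 mul0r.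
  have nS : segint (euclid_dot (lsubmx l - lsubmx nu) d) <> 0.
    by move=> z; move/eqP: nP; apply; apply/expint_parallelogram_eq0; left.
  have nT : segint (euclid_dot (lsubmx l - lsubmx nu) tau) <> 0.
    by move=> z; move/eqP: nP; apply; apply/expint_parallelogram_eq0; right.
  (* A nonzero coefficient on [P] means that neither pairing of [l - nu] is a nonzero integer, so
     each pairing found to be an integer is 0. The first components of [l] and [nu] then agree, and
     orthogonality in [A x B] contradicts the nonzero factor over [B]. *)
  have y0 : euclid_dot (lsubmx l - lsubmx nu) tau = 0.
    have /edge_relP := rel l nu Ll Ln; rewrite !linearB /= => -[z|//|/cis_integer i].
      by rewrite z eqxx in nBl.
    by apply: contrapT => y0; apply: nT; apply/segint_eq0.
  have xi : is_integer (euclid_dot (lsubmx l - lsubmx nu) d).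
    have /edge_relP := rel k nu Lk Ln; rewrite !linearB /= => -[z|/segint_eq0[i _]|c1].
    - by rewrite z eqxx in nBk.
    - have := is_integerB i xkl; rewrite linearB /= -euclid_dotBl.
      by rewrite opprB addrC addrA subrK.
    - exfalso; apply: nc; rewrite linearB /= (_ : lsubmx k - lsubmx l =
        (lsubmx k - lsubmx nu) - (lsubmx l - lsubmx nu)); last by rewrite opprB addrA subrK.
      by rewrite euclid_dotBl y0 subr0.
  have x0 : euclid_dot (lsubmx l - lsubmx nu) d = 0.
    by apply: contrapT => x0; apply: nS; apply/segint_eq0.
  have ln0 := euclid_dot_basis_eq0 x0 y0.
  have := oL l nu Ll Ln (fun e => nl (esym e)).
  rewrite L2_dot_exponential (expint_cartesian n0 m0 mA mB)// !linearB /= ln0 => /eqP.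
  by rewrite mulf_eq0 (negPf (domain_expint0_neq0 dA)) (negPf nBl).
have [bAB mAB v0] := dAB.
have hspan := (complete_exponentialsP Lam dAB).1 cL h h2.
have := polarized_parseval1 (domain_semi_inner dAB) v0 (fun l (_ : Lam l) => domain_exponential l dAB)
  (fun l _ => nsq_exponential mAB bAB l) oL (@subset_refl _ Lam) f2 h2 hspan Ll zero.
rewrite !dotE (L2_dot_tensor n0 m0 mA mB Lc (LB _) Lc (LB _)) L2_dot_exponential.
have PP : P `&` P `<=` A by move=> x [/parallelogram_sub].
rewrite (dot_cutoff _ _ mP mP PP) setIid !subrr.
rewrite (domain_expint0 dB) (volume_cartesian n0 m0 mA mB bA bB).
have Poo : (@lebesgue_measure_Rn R 2 P < +oo)%E.
  exact: le_lt_trans (le_lebesgue_outer parallelogram_sub) (bounded_lty bA).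
rewrite (expint0 mP Poo) -rmorphM conjc_real => E; move/eqP: vAP; apply.
have bC : expint B (rsubmx k - rsubmx l) != 0 by apply/eqP => z; apply: nB; rewrite linearB.
have vP0 : volume P != 0.
  have : expint P 0 != 0.
    apply/eqP => /expint_parallelogram_eq0; rewrite !euclid_dot0l segint0.
    by case=> /eqP; rewrite oner_eq0.
  by rewrite (expint0 mP Poo) => z; apply: contra z => /eqP->.
(* Cancelling the common factors in the identity with a single term leaves [volume A = volume P]. *)
have : ((volume A * volume B * volume P)%:C%C - (volume P * volume P * volume B)%:C%C) * expint B (rsubmx k - rsubmx l) = 0.
  rewrite mulrBl (rmorphM (real_complex R) (volume A * volume B)) -[X in X - _]mulrA E.
  by rewrite !(rmorphM (real_complex R)); ring.
move/eqP; rewrite mulf_eq0 (negPf bC) orbF subr_eq0 => /eqP[] E2.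
have vB : volume B * volume P != 0 by rewrite mulf_neq0// gt_eqF.
by apply: (mulIf vB); rewrite mulrA E2; ring.
Qed.

End opposite_edges.

End polygon_product.

(** * The dual group of the polygon and the case of a parallelogram *)

Section spectral_factors.
Context (R : realType) (V : seq 'rV[R]_2) (uV : uniq V) (m : nat) (m0 : (0 < m)%N).
Local Notation A := (convex_hull [set` V]).
Context (B : set 'rV[R]_m) (dA : domain A) (dB : domain B).
Local Notation AB := (cartesian A B).
Implicit Types (p q xi tau d : 'rV[R]_2).

Let n0 : (0 < 2)%N. Proof. by []. Qed.
Let mA : measurable (A : set (lebesgueRn R 2)). Proof. by case: dA. Qed.
Let bA : bounded_set A. Proof. by case: dA. Qed.
Let mB : measurable (B : set (lebesgueRn R m)). Proof. by case: dB. Qed.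
Let bB : bounded_set B. Proof. by case: dB. Qed.
Let dAB : domain AB. Proof. exact: domain_cartesian. Qed.

Definition dual_group : set 'rV[R]_2 := [set xi | forall p q p' q', opposite V p q p' q' ->
  cis (euclid_dot xi (q' - p)) = 1].

Lemma dual_group0 : dual_group 0.
Proof. by move=> p q p' q' _; rewrite euclid_dot0l cis0. Qed.

Lemma dual_groupB x y : dual_group x -> dual_group y -> dual_group (x - y).
Proof.
move=> hx hy p q p' q' op; apply/cis_integer; rewrite euclid_dotBl.
by apply: is_integerB; apply/cis_integer; [exact: hx op|exact: hy op].
Qed.

(** The strips over opposite edges are translates of each other by a vector whose pairing with [xi]
    is an integer. *)
Lemma edge_strip_opposite w xi p q p' q' : opposite V p q p' q' -> dual_group xi ->
  det2 (q - p) w != 0 -> expint (edge_strip w (p', q')) xi = expint (edge_strip w (p, q)) xi.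
Proof.
move=> op G h; have [e e' pqE] := op.
have op' : opposite V p' q' p q by split=> //; rewrite pqE opprK.
have c1 := G _ _ _ _ op; have c2 := G _ _ _ _ op'.
have dirE : edge_dir w (p', q') = edge_dir w (p, q).
  rewrite /edge_dir /edge_vector /= pqE det2Nl oppr_gt0 opprK.
  by move: h; case: ltgtP.
have dp : det2 (edge_dir w (p, q)) w != 0 by rewrite gt_eqF// det2_edge_dir.
rewrite /edge_strip dirE !expint_parallelogram//; congr (_ * _ * _ * _).
rewrite /edge_base /edge_vector /= pqE det2Nl oppr_gt0.
have cE a b : cis (euclid_dot xi (a - b)) = 1 -> cis (euclid_dot xi a) = cis (euclid_dot xi b).
  by move=> ab; rewrite -[a](subrK b) euclid_dotDr cisD ab mul1r.
by move: h; case: ltgtP => // h _; [rewrite (cE _ _ c2)|exact: cE].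
Qed.

(** [w] is chosen so that its pairing with [xi] is 1/2, which makes the factor of the transform -2.
    Opposite edges have opposite signs and equal strip transforms, so the sum over the edges equals
    its own negative. *)
Lemma dual_group_zeros : (forall p q, is_edge V p q -> exists p' q', opposite V p q p' q') ->
  forall xi, dual_group xi -> xi <> 0 -> expint A xi = 0.
Proof.
move=> hop xi G xi0.
have xx : euclid_dot xi xi != 0.
  apply/eqP; rewrite euclid_dot2 => /eqP; rewrite -!expr2 paddr_eq0 ?sqr_ge0// !sqrf_eq0.
  by move=> /andP[/eqP h0 /eqP h1]; apply: xi0; apply/rowP; apply: ord2P; rewrite !mxE.
pose w := (2 * euclid_dot xi xi)^-1 *: xi.
have xw : euclid_dot xi w = 2^-1 by rewrite euclid_dotZr; field.
have w0 : w != 0 by apply/eqP => w0; move: xw; rewrite w0 euclid_dotC euclid_dot0l => /eqP; rewrite eq_sym invr_eq0 pnatr_eq0.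
have := polygon_expint uV mA bA xi w0; rewrite xw cis_half -big_filter.
set E := [seq _ <- _ | _].
set F := fun pq : 'rV[R]_2 * 'rV[R]_2 => (Num.sg (det2 (edge_vector pq) w))%:C%C * expint (edge_strip w pq) xi.
rewrite -/(\sum_(pq <- E) F pq).
have inE pq : pq \in E -> det2 (edge_vector pq) w != 0 /\ is_edge V pq.1 pq.2.
  by rewrite mem_filter => /andP[h /mem_edges].
(* Passing to an opposite edge is injective on the finite list [E], hence permutes it. *)
have /choice[s hs] (pq : 'rV[R]_2 * 'rV[R]_2) : exists pq', pq \in E -> opposite V pq.1 pq.2 pq'.1 pq'.2.
  have [/inE[_ e]|_] := boolP (pq \in E); last by exists pq.
  by have [p' [q' op]] := hop _ _ e; exists (p', q').
have sE pq : pq \in E -> s pq \in E.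
  move=> pqE; have [h _] := inE pq pqE; have [e e' pqE'] := hs pq pqE.
  by rewrite mem_filter /edge_vector pqE' det2Nl oppr_eq0 h /=; apply/mem_edges.
have sinj : {in E &, injective s}.
  move=> x y xE yE sxy; have [ex _ hx] := hs x xE; have [ey _ hy] := hs y yE.
  have [h1 h2] : x.1 = y.1 /\ x.2 = y.2.
    apply: (parallel_edge_eq ex ey ltr01); rewrite scale1r.
    by apply: oppr_inj; rewrite -hx -hy sxy.
  by case: x y h1 h2 {xE yE sxy ex ey hx hy} => [x1 x2] [y1 y2] /= -> ->.
have uE : uniq E by apply: filter_uniq; exact: uniq_edges.
have pE : perm_eq [seq s pq | pq <- E] E.
  have us : uniq [seq s pq | pq <- E] by rewrite map_inj_in_uniq.
  have sub : {subset [seq s pq | pq <- E] <= E} by move=> _ /mapP[pq pqE ->]; exact: sE.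
  have sz : (size E <= size [seq s pq | pq <- E])%N by rewrite size_map.
  by apply: uniq_perm => //; case: (uniq_min_size us sub sz).
have FN pq : pq \in E -> F (s pq) = - F pq.
  move=> pqE; have [h _] := inE pq pqE; have op := hs pq pqE; have [_ _ hv] := op.
  have hst : expint (edge_strip w (s pq)) xi = expint (edge_strip w pq) xi.
    by have := edge_strip_opposite op G h; rewrite -!surjective_pairing.
  by rewrite /F hst /edge_vector hv det2Nl sgrN (rmorphN (real_complex R)) mulNr.
have S0 : \sum_(pq <- E) F pq = 0.
  have S1 : \sum_(pq <- E) F pq = - \sum_(pq <- E) F pq.
    rewrite -[in LHS](perm_big _ pE) big_map -sumrN big_seq [RHS]big_seq.
    by apply: eq_bigr => pq; exact: FN.
  have : 2 * \sum_(pq <- E) F pq = 0 by rewrite mulr_natl mulr2n {1}S1 addNr.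
  by move/eqP; rewrite mulf_eq0 (pnatr_eq0 R[i] 2) => /eqP.
rewrite S0 => /eqP; rewrite mulf_eq0 => /orP[|/eqP//].
by rewrite -opprD oppr_eq0 (pnatr_eq0 R[i] 2).
Qed.

(** Up to a null set [A] is the parallelogram, whose transform is a product of [segint] along [d]
    and along [tau]. Straightening in both directions makes all these pairings integers; first
    components then differ by elements of the dual lattice, where the transform of [A] vanishes off
    0. *)
Lemma parallelogram_case p q p' q' Lam : opposite V p q p' q' -> is_spectrum Lam AB ->
  volume A = volume (parallelogram p (q - p) (q' - p)) ->
  (exists U, is_spectrum U A) /\ (exists W, is_spectrum W B).
Proof.
move=> op sL vAP; set d := q - p in vAP *; set tau := q' - p in vAP *.
set P := parallelogram p d tau in vAP.
have D0 : det2 d tau != 0 := opposite_det2 dA op.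
have PA : P `<=` A := parallelogram_sub dA op.
have mP : measurable (P : set (lebesgueRn R 2)) by exact: measurable_parallelogram.
have expA xi : expint A xi = expint P xi.
  rewrite (expint_setID xi mA mP bA) setIidr// (_ : expint (A `\` P) xi = 0) ?addr0//.
  have mD := measurableD mA mP; have DA : A `\` P `<=` A by move=> x [].
  have bD : bounded_set (A `\` P) by have [T [Tr hT]] := bA; exists T; split=> // x Tx y [Ay _]; exact: hT Tx _ Ay.
  have vD : volume (A `\` P) = 0.
    apply: EFin_inj; rewrite (volumeE bA DA).
    have Aoo := bounded_lty bA.
    have := measureD mA mP Aoo; rewrite (setIidr PA) => ->.
    by rewrite -[X in (X - _)%E](volumeE bA (@subset_refl _ A)) -[X in (_ - X)%E](volumeE bA PA) vAP subee.
  apply/eqP; rewrite -sqnorm_eq0 eq_le sqnorm_ge0 andbT.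
  by have := sqnorm_expint_le mD bD xi; rewrite vD expr0n.
have sqA xi : sqnorm (expint A xi) = area d tau ^+ 2 *
    (sqnorm (segint (euclid_dot xi d)) * sqnorm (segint (euclid_dot xi tau))).
  by rewrite expA expint_parallelogram// !sqnormM sqnorm_cis sqnorm_real mulr1 -mulrA.
(* The dual basis of [d] and [tau]: moving along one of its vectors leaves the other pairing
   unchanged, so the second reduction preserves what the first one achieved. *)
pose dd := (det2 tau d)^-1 *: normal tau; pose dt := (det2 d tau)^-1 *: normal d.
have D0' : det2 tau d != 0 by rewrite det2C oppr_eq0.
have ddd : euclid_dot dd d = 1 by rewrite euclid_dotZl euclid_dot_normal mulVf.
have ddt : euclid_dot dd tau = 0 by rewrite euclid_dotZl euclid_dot_normal det2vv mulr0.
have dtt : euclid_dot dt tau = 1 by rewrite euclid_dotZl euclid_dot_normal mulVf.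
have dtd : euclid_dot dt d = 0 by rewrite euclid_dotZl euclid_dot_normal det2vv mulr0.
pose chi v (x : 'rV[R]_(2 + m)) := euclid_dot (lsubmx x) v.
pose eps v : 'rV[R]_(2 + m) := row_mx v 0.
have chiB v x y : chi v (x - y) = chi v x - chi v y by rewrite /chi linearB euclid_dotBl.
have chiE v v' (t : R) x : chi v (x + t *: eps v') = chi v x + t * euclid_dot v' v.
  by rewrite /chi linearD linearZ /= row_mxKl euclid_dotDl euclid_dotZl.
have rE v' (t : R) x : rsubmx (x + t *: eps v') = rsubmx x.
  by rewrite linearD linearZ /= row_mxKr scaler0 addr0.
have sqAB x : sqnorm (expint AB x) = area d tau ^+ 2 *
    (sqnorm (segint (chi d x)) * sqnorm (segint (chi tau x))) * sqnorm (expint B (rsubmx x)).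
  by rewrite (expint_cartesian n0 m0 mA mB)// sqnormM sqA.
pose K1 x := area d tau ^+ 2 * sqnorm (segint (chi tau x)) * sqnorm (expint B (rsubmx x)).
pose K2 x := area d tau ^+ 2 * sqnorm (segint (chi d x)) * sqnorm (expint B (rsubmx x)).
have sL1 : is_spectrum (integer_reduction (chi d) (eps dd) Lam) AB.
  apply: (@integer_reduction_spectrum _ _ _ dAB (chi d) (eps dd) K1) => // [t x|t x|x].
  - by rewrite chiE ddd mulr1.
  - by rewrite /K1 chiE ddt mulr0 addr0 rE.
  - by rewrite sqAB /K1; ring.
have sL2 : is_spectrum (integer_reduction (chi tau) (eps dt) (integer_reduction (chi d) (eps dd) Lam)) AB.
  apply: (@integer_reduction_spectrum _ _ _ dAB (chi tau) (eps dt) K2) => // [t x|t x|x].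
  - by rewrite chiE dtt mulr1.
  - by rewrite /K2 chiE dtd mulr0 addr0 rE.
  - by rewrite sqAB /K2; ring.
set L2 := integer_reduction _ _ (integer_reduction _ _ _) in sL2.
have int2 x : L2 x -> is_integer (chi d x) /\ is_integer (chi tau x).
  move=> [l [r [[l' [r' [_ _ i1 ->]]] _ i2 ->]]]; split; last by rewrite chiE dtt mulr1.
  by rewrite chiE dtd mulr0 addr0 chiE ddd mulr1.
pose G := [set xi : 'rV[R]_2 | is_integer (euclid_dot xi d) /\ is_integer (euclid_dot xi tau)].
have G0 : G 0 by split; rewrite euclid_dot0l; exact: is_integer0.
have GB x y : G x -> G y -> G (x - y).
  by move=> [x1 x2] [y1 y2]; split; rewrite euclid_dotBl; exact: is_integerB.
have GA x : G x -> x <> 0 -> expint A x = 0.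
  move=> [x1 x2] x0; rewrite expA; apply/(expint_parallelogram_eq0 dA op).
  have [z|z] := pselect (euclid_dot x d = 0); last by left; apply/segint_eq0.
  right; apply/segint_eq0; split=> // z'; apply: x0.
  exact: (euclid_dot_basis_eq0 dA op z z').
have pairs l k : L2 l -> L2 k -> G (lsubmx (l - k)) \/ expint B (rsubmx (l - k)) = 0.
  move=> /int2[l1 l2] /int2[k1 k2]; left; split; rewrite -/(chi _ _) chiB; exact: is_integerB.
have [l Ll] := spectrum_nonempty dAB sL2.
split; eexists; first exact: (spectrum_left n0 m0 dA dB GB GA sL2 pairs Ll).
exact: (spectrum_right n0 m0 dA dB G0 GB GA sL2 pairs).
Qed.

(** If no parallelogram on opposite edges has the volume of [A], [integer_translation] applies to
    every pair of opposite edges, and [dual_group] is the group for the reduction. *)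
Lemma spectral_factors Lam : is_spectrum Lam AB ->
  (exists U, is_spectrum U A) /\ (exists W, is_spectrum W B).
Proof.
move=> sL; have [L [sL' hop rel]] := all_edges_relation uV m0 dA dB sL.
have [[p [q [p' [q' [op vAP]]]]]|no] := pselect (exists p q p' q', opposite V p q p' q' /\
    volume A = volume (parallelogram p (q - p) (q' - p))); first exact: (parallelogram_case op sL' vAP).
have pairs l k : L l -> L k -> dual_group (lsubmx (l - k)) \/ expint B (rsubmx (l - k)) = 0.
  move=> Ll Lk; have [z|nz] := pselect (expint B (rsubmx (l - k)) = 0); [by right|left].
  move=> p q p' q' op; have vAP : volume A != volume (parallelogram p (q - p) (q' - p)).
    by apply/eqP => v; apply: no; exists p, q, p', q'.
  have [//|//] := integer_translation m0 dA dB op sL' vAP (fun x x' => rel p q p' q' x x' op) Ll Lk.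
have GA := dual_group_zeros hop.
have [l Ll] := spectrum_nonempty dAB sL'.
split; eexists; first exact: (spectrum_left n0 m0 dA dB dual_groupB GA sL' pairs Ll).
exact: (spectrum_right n0 m0 dA dB dual_group0 dual_groupB GA sL' pairs).
Qed.

End spectral_factors.

Theorem theorem2p3 (R : realType) (m : nat) (hm : (1 <= m)%N)
    (A : set 'rV[R]_2) (B : set 'rV[R]_m)
    (hA : convex_polygon A)
    (hB : bounded_set B)
    (hBm : measurable (B : set (lebesgueRn R m))) :
  spectral (cartesian A B) <-> spectral A /\ spectral B.
Proof.
have [cA _ [V0 /finite_seqP[V1 V1E] AE]] := hA.
(* Listing the edges without repetition requires a list of vertices without repetition. *)
have AV : A = convex_hull [set` undup V1].
  by rewrite AE V1E; congr convex_hull; apply/seteqP; split=> x /=; rewrite mem_undup.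
have bA : bounded_set A by exact: compact_bounded.
have mA : measurable (A : set (lebesgueRn R 2)).
  by apply: measurable_closed_set; apply: compact_closed => //; exact: norm_hausdorff.
have volP (d : nat) (E : set 'rV[R]_d) : bounded_set E ->
    (0 < lebesgue_measure_Rn (E : set (lebesgueRn R d)))%E <-> 0 < volume E.
  by move=> bE; rewrite -lte_fin (volumeE bE).
have bAB := bounded_cartesian bA hB; have mAB := measurable_cartesian mA hBm.
have vAB := volume_cartesian (ltn0Sn 1) hm mA hBm bA hB.
have vge0 (d : nat) (E : set 'rV[R]_d) : 0 <= volume E by apply: fine_ge0; exact: lebesgue_outer_ge0.
split=> [[_ _ /(volP _ _ bAB) v0 [Lam sL]]|[[_ _ /(volP _ _ bA) vA [U sU]] [_ _ /(volP _ _ hB) vB [W sW]]]].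
  (* The volume of the product is the product of the volumes, so positive measure passes to both
     factors. *)
  have vA : 0 < volume A.
    by rewrite lt_neqAle vge0 andbT eq_sym; apply/eqP => z; move: v0; rewrite vAB z mul0r ltxx.
  have vB : 0 < volume B.
    by rewrite lt_neqAle vge0 andbT eq_sym; apply/eqP => z; move: v0; rewrite vAB z mulr0 ltxx.
  have dA : domain A by []. have dB : domain B by [].
  have [U W] : (exists U, is_spectrum U A) /\ (exists W, is_spectrum W B).
    by move: dA sL; rewrite AV => dA sL; exact: (spectral_factors (undup_uniq V1) hm dA dB sL).
  by split; split=> //; apply/volP.
have dA : domain A by []. have dB : domain B by [].
split=> //; first by apply/(volP _ _ bAB); rewrite vAB mulr_gt0.
by exists (cartesian U W); exact: (product_spectrum (ltn0Sn 1) hm dA dB sU sW).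
Qed.
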